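(* Consider stochastic linear bandits with $T$ rounds, dimension $d$ and $A$ actions per round, where $|\varepsilon_t|\le\sigma$, $b_a\le\|\mathbf a_{t,k}\|_2\le B_a$ and $\|\mathbf w^*\|_2\le B_w$ for all $t\in[T],k\in[A]$ (with constants $\sigma,b_a,B_a,B_w>0$), the soft LinUCB algorithm $\mathrm{Alg}_{\mathrm{sLinUCB}(\tau)}$ with ridge parameter $\lambda>0$, and the bandit token embedding, concatenation and extraction maps described in the context. For any small $\varepsilon,\tau>0$, there exists a transformer $\mathrm{TF}_{\boldsymbol\theta}^{\mathsf R}$ with $\log\mathsf R=\tilde{\mathcal O}(1)$, embedding dimension, number of layers, number of heads, hidden dimension and norm satisfying $$D\le \mathrm O(dA),\quad L=\tilde{\mathcal O}(\sqrt T),\quad M\le4A,\quad D'=\tilde{\mathcal O}\big(d+A\sqrt{Td/(\tau\varepsilon)}\big),\quad |\!|\!|\boldsymbol\theta|\!|\!|=\tilde{\mathcal O}\big(A+T\sqrt d/(\tau\varepsilon^{1/4})\big),$$ such that the induced algorithm $\mathrm{Alg}_{\boldsymbol\theta}$ satisfies $$\big|\log\mathrm{Alg}_{\mathrm{sLinUCB}(\tau)}(\mathbf a_{t,k}\mid D_{t-1},s_t)-\log\mathrm{Alg}_{\boldsymbol\theta}(\mathbf a_{t,k}\mid D_{t-1},s_t)\big|\le\varepsilon\qquad\text{for all }t\in[T],\ k\in[A].$$ Here $\mathrm O(\cdot)$ hides an absolute constant, and $\tilde{\mathcal O}(\cdot)$ additionally hides polynomial terms in $(\sigma,b_a^{-1},B_a,B_w,\lambda^{\pm1})$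 and poly-logarithmic terms in $(T,A,d,1/\varepsilon,1/\tau)$.
   Context: Stochastic linear bandit. At round $t\in[T]$ the state is the action set $s_t=\mathbb A_t=\{\mathbf a_{t,1},\dots,\mathbf a_{t,A}\}\subset\mathbb R^d$ (evolving independently of the chosen actions); the learner picks $a_t\in\mathbb A_t$ and receives $r_t=\langle a_t,\mathbf w^*\rangle+\varepsilon_t$, with $\varepsilon_t$ i.i.d. zero-mean noise and $\mathbf w^*\in\mathbb R^d$ unknown. $D_{t-1}=(s_1,a_1,r_1,\dots,s_{t-1},a_{t-1},r_{t-1})$. Soft LinUCB. With $\mathbf A_t=\lambda I_d+\sum_{j<t}a_ja_j^\top$ and $\mathbf w^t_{\mathrm{ridge},\lambda}=\arg\min_{\mathbf w}\sum_{j=1}^{t-1}(r_j-\langle a_j,\mathbf w\rangle)^2+\lambda\|\mathbf w\|_2^2$, set $v^*_{tk}=\langle\mathbf a_{t,k},\mathbf w^t_{\mathrm{ridge},\lambda}\rangle+\alpha\sqrt{\mathbf a_{t,k}^\top\mathbf A_t^{-1}\mathbf a_{t,k}}$, where $\alpha=\sqrt\lambda B_w+\sigma\sqrt{2\log(2B_aB_wT)+d\log((d\lambda+TB_a^2)/(d\lambda))}$. $\mathrm{Alg}_{\mathrm{sLinUCB}(\tau)}(\cdot\mid D_{t-1},s_t)$ selects $\mathbf a_{t,k}$ with probability proportional to $\exp(v^*_{tk}/\tau)$. Transformers. Let $\sigma_+(x)=\max\{x,0\}$. For an input $\mathbf H=[\mathbf h_1,\dots,\mathbf h_N]\in\mathbb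 R^{D\times N}$, a masked attention layer with $M$ heads and parameters $(\mathbf V_m,\mathbf Q_m,\mathbf K_m)_{m\in[M]}\subset\mathbb R^{D\times D}$ outputs $\bar{\mathbf h}_i=\mathbf h_i+\sum_{m=1}^M\frac1i\sum_{j=1}^i\sigma_+(\langle\mathbf Q_m\mathbf h_i,\mathbf K_m\mathbf h_j\rangle)\mathbf V_m\mathbf h_j$. An MLP layer with hidden dimension $D'$ and parameters $\mathbf W_1\in\mathbb R^{D'\times D},\mathbf W_2\in\mathbb R^{D\times D'}$ outputs $\bar{\mathbf h}_i=\mathbf h_i+\mathbf W_2\sigma_+(\mathbf W_1\mathbf h_i)$. $\mathrm{clip}_{\mathsf R}$ projects each column onto the $\ell_2$-ball of radius $\mathsf R$. The $L$-layer transformer $\mathrm{TF}^{\mathsf R}_{\boldsymbol\theta}(\mathbf H)=\mathbf H^{(L)}$ is defined by $\mathbf H^{(0)}=\mathrm{clip}_{\mathsf R}(\mathbf H)$, $\mathbf H^{(\ell)}=\mathrm{clip}_{\mathsf R}(\mathrm{MLP}^{(\ell)}(\mathrm{Attn}^{(\ell)}(\mathbf H^{(\ell-1)})))$, $\ell\in[L]$. Its norm is $|\!|\!|\boldsymbol\theta|\!|\!|=\max_{\ell\in[L]}\{\max_{m}\{\|\mathbf Q_m^{(\ell)}\|_{\rm op},\|\mathbf K_m^{(\ell)}\|_{\rm op}\}+\sum_{m}\|\mathbf V_m^{(\ell)}\|_{\rm op}+\|\mathbf W_1^{(\ell)}\|_{\rm op}+\|\mathbf W_2^{(\ell)}\|_{\rm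 op}\}$. Bandit embedding. Each round $t$ gives two tokens in $\mathbb R^D$: $\mathbf h_{2t-1}=[\mathbf 0_{d+1};\mathbf a_{t,1};\dots;\mathbf a_{t,A};\mathbf 0_A;\mathbf 0;\mathrm{pos}_{2t-1}]$ (embedding of $s_t$) and $\mathbf h_{2t}=[a_t;r_t;\mathbf 0_{Ad};\mathbf 0_A;\mathbf 0;\mathrm{pos}_{2t}]$ (embedding of $(a_t,r_t)$), with $\mathrm{pos}_i=(i,i^2,1)^\top$ and $\mathbf 0$ a zero padding filling up to dimension $D$. On input $(D_{t-1},s_t)$ the token matrix is $[\mathbf h_1,\dots,\mathbf h_{2t-1}]$. The extraction map reads the $A$ coordinates of the third block (those initialized as $\mathbf 0_A$) of the last output token $\bar{\mathbf h}_{2t-1}$, and $\mathrm{Alg}_{\boldsymbol\theta}(\cdot\mid D_{t-1},s_t)$ is the softmax of these $A$ values, the $k$-th entry being the probability of $\mathbf a_{t,k}$. *)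

(* Defs.v *)
From HB Require Import structures.
From mathcomp Require Import all_boot all_order all_algebra.
From mathcomp Require Import all_classical all_reals all_analysis.

Set Implicit Arguments.
Unset Strict Implicit.
Unset Printing Implicit Defensive.

Import Order.TTheory GRing.Theory Num.Theory.

Local Open Scope classical_set_scope.
Local Open Scope ring_scope.

Section Euclidean.
Context {R : realType}.

Definition dot n (x y : 'cV[R]_n) : R := \sum_(i < n) x i 0 * y i 0.

(* The norm that MathComp-Analysis puts on matrices is the max norm. *)
Definition norm2 n (x : 'cV[R]_n) : R := Num.sqrt (dot x x).

Definition opnorm m n (A : 'M[R]_(m, n)) : R :=
  sup [set norm2 (A *m x) | x in [set x : 'cV[R]_n | norm2 x <= 1]].

Definition relu (x : R) : R := Num.max x 0.

Definition softmax n (v : 'cV[R]_n) (k : 'I_n) : R :=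
  expR (v k 0) / \sum_(l < n) expR (v l 0).

End Euclidean.

Section Transformer.
Context {R : realType}.

Record attn_head (D : nat) := AttnHead {
  head_V : 'M[R]_D;
  head_Q : 'M[R]_D;
  head_K : 'M[R]_D }.

Record tf_layer (D M D' : nat) := TFLayer {
  layer_heads : 'I_M -> attn_head D;
  layer_W1 : 'M[R]_(D', D);
  layer_W2 : 'M[R]_(D, D') }.

(* Column [i : 'I_N] is the token of 1-based index [i.+1]. *)
Definition attn D M N (heads : 'I_M -> attn_head D) (H : 'M[R]_(D, N)) :
    'M[R]_(D, N) :=
  \matrix_(c < D, i < N)
    (col i H + \sum_(m < M) (i.+1%:R)^-1 *:
       \sum_(j < N | (j <= i)%N)
         relu (dot (head_Q (heads m) *m col i H) (head_K (heads m) *m col j H))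
           *: (head_V (heads m) *m col j H)) c 0.

Definition mlp D D' N (W1 : 'M[R]_(D', D)) (W2 : 'M[R]_(D, D'))
    (H : 'M[R]_(D, N)) : 'M[R]_(D, N) :=
  H + W2 *m map_mx relu (W1 *m H).

Definition proj_ball D (r : R) (h : 'cV[R]_D) : 'cV[R]_D :=
  if norm2 h <= r then h else (r / norm2 h) *: h.

Definition clip D N (r : R) (H : 'M[R]_(D, N)) : 'M[R]_(D, N) :=
  \matrix_(c < D, i < N) proj_ball r (col i H) c 0.

Definition transformer D M D' L (theta : L.-tuple (tf_layer D M D')) (r : R)
    N (H : 'M[R]_(D, N)) : 'M[R]_(D, N) :=
  foldl (fun G l =>
           clip r (mlp (layer_W1 l) (layer_W2 l) (attn (layer_heads l) G)))
        (clip r H) theta.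

(* The unit 0 of the maxima is harmless, operator norms being nonnegative. *)
Definition layer_norm D M D' (l : tf_layer D M D') : R :=
  \big[Num.max/0]_(m < M) Num.max (opnorm (head_Q (layer_heads l m)))
                                  (opnorm (head_K (layer_heads l m)))
  + \sum_(m < M) opnorm (head_V (layer_heads l m))
  + opnorm (layer_W1 l) + opnorm (layer_W2 l).

Definition tf_norm D M D' L (theta : L.-tuple (tf_layer D M D')) : R :=
  \big[Num.max/0]_(l <- theta) layer_norm l.

End Transformer.

Arguments attn_head : clear implicits.
Arguments tf_layer : clear implicits.

Section Bandit.
Context {R : realType}.
Variables d A : nat.

(* A state is the matrix whose [k]-th column is the [k]-th available action. *)
Record round := Round {
  rd_state : 'M[R]_(d, A);
  rd_action : 'cV[R]_d;
  rd_reward : R }.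

(* [action] and [noise] do not take the learner's choices as arguments: states
   and noise evolve independently of the actions chosen. *)
Record linear_bandit (T : nat) (dO : measure_display) (Omega : measurableType dO)
    (P : probability Omega R) := LinearBandit {
  weight : 'cV[R]_d;
  action : 'I_T -> Omega -> 'M[R]_(d, A);
  noise : 'I_T -> {RV P >-> R};
  action_measurable : forall t i k,
    measurable_fun setT (fun omega => action t omega i k);
  noise_independent : forall (J : {set 'I_T}) (B : 'I_T -> set R),
    (forall t, measurable (B t)) ->
    P [set omega | forall t, t \in J -> B t (noise t omega)]
      = (\prod_(t in J) P (noise t @^-1` B t))%E;
  noise_identically_distributed : forall (s t : 'I_T) (B : set R),
    measurable B -> P (noise s @^-1` B) = P (noise t @^-1` B);
  noise_centered : forall t, ('E_P[noise t] = 0)%E }.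

(* Rounds are counted from 0, and [c t] is the index of the action picked at
   round [t]; [dataset b omega c t] lists the rounds before [t]. *)
Definition dataset T dO (Omega : measurableType dO) (P : probability Omega R)
    (b : linear_bandit T P) (omega : Omega) (c : 'I_T -> 'I_A) (t : 'I_T) :
    seq round :=
  [seq (let a := col (c j) (action b j omega) in
        Round (action b j omega) a (dot a (weight b) + noise b j omega))
  | j : 'I_T <- enum 'I_T & (j < t)%N].

Section SoftLinUCB.
Variables (T : nat) (sigma Ba Bw lambda tau : R).

Definition ridge_loss (D : seq round) (w : 'cV[R]_d) : R :=
  \sum_(x <- D) (rd_reward x - dot (rd_action x) w) ^+ 2
  + lambda * norm2 w ^+ 2.

(* A minimiser; it exists and is unique as soon as [0 < lambda]. *)
Definition ridge (D : seq round) : 'cV[R]_d :=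
  xget 0 [set w | forall u, ridge_loss D w <= ridge_loss D u].

Definition gram (D : seq round) : 'M[R]_d :=
  lambda%:M + \sum_(x <- D) rd_action x *m (rd_action x)^T.

(* [Num.sqrt] is 0 on negative numbers, which only matters here when
   [2 * Ba * Bw * T < 1]. *)
Definition ucb_alpha : R :=
  Num.sqrt lambda * Bw
  + sigma * Num.sqrt (2 * ln (2 * Ba * Bw * T%:R)
                      + d%:R * ln ((d%:R * lambda + T%:R * Ba ^+ 2)
                                   / (d%:R * lambda))).

Definition ucb_value (D : seq round) (s : 'M[R]_(d, A)) (k : 'I_A) : R :=
  dot (col k s) (ridge D)
  + ucb_alpha * Num.sqrt (dot (col k s) (invmx (gram D) *m col k s)).

Definition soft_linucb (D : seq round) (s : 'M[R]_(d, A)) : 'I_A -> R :=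
  softmax (\col_k (ucb_value D s k / tau)).

End SoftLinUCB.

Section Embedding.
(* [p] is the length of the zero padding. *)
Variable p : nat.

Definition token_dim : nat := (d + 1) + (A * d + (A + (p + 3))).

Definition pos (i : nat) : 'cV[R]_3 :=
  \col_(l < 3) [:: i%:R; i%:R ^+ 2; 1]`_l.

(* [(mxvec s^T)^T] stacks the columns of [s]. *)
Definition state_token (i : nat) (s : 'M[R]_(d, A)) : 'cV[R]_token_dim :=
  col_mx (0 : 'cV_(d + 1))
    (col_mx (mxvec s^T)^T (col_mx (0 : 'cV_A) (col_mx (0 : 'cV_p) (pos i)))).

Definition action_token (i : nat) (a : 'cV[R]_d) (r : R) : 'cV[R]_token_dim :=
  col_mx (col_mx a (r%:M : 'cV_1))
    (col_mx (0 : 'cV_(A * d))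
       (col_mx (0 : 'cV_A) (col_mx (0 : 'cV_p) (pos i)))).

(* The token of 1-based index [i.+1]. *)
Definition token (D : seq round) (s : 'M[R]_(d, A)) (i : nat) :
    'cV[R]_token_dim :=
  if odd i then
    let x := nth (Round 0 0 0) D i./2 in
    action_token i.+1 (rd_action x) (rd_reward x)
  else state_token i.+1 (nth 0 (rcons [seq rd_state x | x <- D] s) i./2).

Definition token_matrix (D : seq round) (s : 'M[R]_(d, A)) :
    'M[R]_(token_dim, (size D).*2.+1) :=
  \matrix_(c, i) token D s i c 0.

Definition extract (h : 'cV[R]_token_dim) : 'cV[R]_A :=
  usubmx (dsubmx (dsubmx (h : 'cV_((d + 1) + (A * d + (A + (p + 3))))))).

Definition alg_tf M D' L (theta : L.-tuple (tf_layer R token_dim M D')) (r : R)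
    (D : seq round) (s : 'M[R]_(d, A)) : 'I_A -> R :=
  softmax (extract (col ord_max (transformer theta r (token_matrix D s)))).

End Embedding.
End Bandit.

Arguments round : clear implicits.
Arguments linear_bandit {R} d A T {dO Omega} P.

(* The factor hidden by the soft-O notation: polynomial in
   [sigma, ba^-1, Ba, Bw, lambda, lambda^-1] and polylogarithmic in
   [T, A, d, eps^-1, tau^-1], for absolute [C], [p] and [q]. *)
Definition soft_O_factor {R : realType} (C : R) (p q : nat)
    (sigma ba Ba Bw lambda : R) (T A d : nat) (eps tau : R) : R :=
  C * (1 + sigma + ba^-1 + Ba + Bw + lambda + lambda^-1) ^+ p
    * (1 + ln T%:R + ln A%:R + ln d%:R + ln eps^-1 + ln tau^-1) ^+ q.

(* Main.v *)
Require Import Defs.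
From HB Require Import structures.
From mathcomp Require Import all_boot all_order all_algebra.
From mathcomp Require Import all_classical all_reals all_analysis.
From mathcomp Require Import ring lra zify.

Set Implicit Arguments.
Unset Strict Implicit.
Unset Printing Implicit Defensive.

Import Order.TTheory GRing.Theory Num.Theory.

Local Open Scope classical_set_scope.
Local Open Scope ring_scope.

(** MLP layers are not needed: attention alone runs an optimisation algorithm in
    the last token.  Writing [G = (lambda I + sum_j a_j a_j^T) / i] for token
    [i], whose eigenvalues lie between [lambda / (3 T)] and
    [1 + lambda + Ba ^ 2], the solution of [G x = a_k] is [i A_t^{-1} a_k].
    Nesterov's accelerated gradient method needs only the products
    [(1 / i) sum_j <a_j, y> a_j], which a pair of heads computes through
    [x = relu x - relu (- x)], and converges in [O~(sqrt T)] layers.  One more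
    layer reads off [<a_k, w_ridge> = (1 / i) sum_j r_j <x, a_j>] and
    [a_k^T A_t^{-1} a_k = <x, a_k> / i]; then the recursion
    [z <- z + c (v - z ^ 2)] converges to [sqrt v], again in [O~(sqrt T)] layers
    because [v] is at least of order [1 / T].  The positional encoding
    [(i, i ^ 2, 1)] makes a head vanish off the diagonal, so attention also
    performs token-local linear maps and products. *)

(** * Euclidean norms and operator norms *)

(** State tokens carry neither action nor reward, so an attention average over the first [i] tokens
    is a sum over past rounds divided by [i]; scaling the linear system by [1 / i] absorbs this
    factor. As the Gram matrix is symmetric, the ridge prediction and the squared width both come
    from the single solve [A_t^{-1} a_k], and [w_ridge] itself is never formed. The obstacle is that
    attention and clipping act on every token, not only on the last one. Clipping must stay
    inactive, since it would rescale the stored actions, and a product head needs a margin above its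
    scores against all earlier tokens. Hence the bounds are proved for every token of the prompt.
    The lower bound [ba] on the action norms enters through the square root, whose recursion
    contracts by [1 - c * sqrt v] only. All magnitudes are measured in powers of one number [W],
    namely [big_scale]. Depth and radius see it through [ln W] only, so accuracies such as
    [(W ^+ 12)^-1] cost constant factors and the exponents can be generous. Log-softmax doubles the
    error of the scores, which are therefore computed within [eps / 2]. *)

Section Euclid.
Context {R : realType}.
Implicit Types n : nat.

Lemma dotC n (x y : 'cV[R]_n) : dot x y = dot y x.
Proof. by apply: eq_bigr => i _; rewrite mulrC. Qed.

Lemma dotDl n (x y z : 'cV[R]_n) : dot (x + y) z = dot x z + dot y z.
Proof. by rewrite /dot -big_split; apply: eq_bigr => i _; rewrite mxE mulrDl. Qed.

Lemma dotZl n a (x z : 'cV[R]_n) : dot (a *: x) z = a * dot x z.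
Proof. by rewrite /dot mulr_sumr; apply: eq_bigr => i _; rewrite mxE mulrA. Qed.

Lemma dotDr n (x y z : 'cV[R]_n) : dot z (x + y) = dot z x + dot z y.
Proof. by rewrite dotC dotDl !(dotC z). Qed.

Lemma dotZr n a (x z : 'cV[R]_n) : dot z (a *: x) = a * dot z x.
Proof. by rewrite dotC dotZl (dotC z). Qed.

Lemma dotNl n (x z : 'cV[R]_n) : dot (- x) z = - dot x z.
Proof. by rewrite -scaleN1r dotZl mulN1r. Qed.

Lemma dotNr n (x z : 'cV[R]_n) : dot z (- x) = - dot z x.
Proof. by rewrite dotC dotNl dotC. Qed.

Lemma dotBl n (x y z : 'cV[R]_n) : dot (x - y) z = dot x z - dot y z.
Proof. by rewrite dotDl dotNl. Qed.

Lemma dotBr n (x y z : 'cV[R]_n) : dot z (x - y) = dot z x - dot z y.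
Proof. by rewrite dotDr dotNr. Qed.

Lemma dot0l n (z : 'cV[R]_n) : dot 0 z = 0.
Proof. by rewrite -(scale0r 0) dotZl mul0r. Qed.

Lemma dot0r n (z : 'cV[R]_n) : dot z 0 = 0.
Proof. by rewrite dotC dot0l. Qed.

Lemma dot_sumr n (I : Type) (r : seq I) (P : pred I) (F : I -> 'cV[R]_n) z :
  dot z (\sum_(i <- r | P i) F i) = \sum_(i <- r | P i) dot z (F i).
Proof.
by elim/big_rec2: _ => [|i x y _ <-]; rewrite ?dot0r // dotDr.
Qed.

Lemma dot_ge0 n (x : 'cV[R]_n) : 0 <= dot x x.
Proof. by apply: sumr_ge0 => i _; rewrite -expr2 sqr_ge0. Qed.

Lemma dot_eq0 n (x : 'cV[R]_n) : dot x x = 0 -> x = 0.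
Proof.
move=> /eqP; rewrite psumr_eq0 => [/allP h|i _]; last by rewrite -expr2 sqr_ge0.
apply/colP => i; have := h i (mem_index_enum i).
by rewrite /= mulf_eq0 orbb mxE => /eqP.
Qed.

Lemma norm2_ge0 n (x : 'cV[R]_n) : 0 <= norm2 x.
Proof. exact: sqrtr_ge0. Qed.

Lemma norm2_sqr n (x : 'cV[R]_n) : norm2 x ^+ 2 = dot x x.
Proof. by rewrite sqr_sqrtr // dot_ge0. Qed.

Lemma norm2_0 n : norm2 (0 : 'cV[R]_n) = 0.
Proof. by rewrite /norm2 dot0l sqrtr0. Qed.

Lemma norm2Z n a (x : 'cV[R]_n) : norm2 (a *: x) = `|a| * norm2 x.
Proof.
by rewrite /norm2 dotZl dotZr mulrA -expr2 sqrtrM ?sqr_ge0 // sqrtr_sqr.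
Qed.

Lemma norm2_le n (x : 'cV[R]_n) b : 0 <= b -> dot x x <= b ^+ 2 -> norm2 x <= b.
Proof.
by move=> b0; rewrite -norm2_sqr ler_sqr ?nnegrE ?norm2_ge0.
Qed.

Lemma dot_sqr_le n (x y : 'cV[R]_n) : dot x y ^+ 2 <= dot x x * dot y y.
Proof.
have [y0|y0] := eqVneq (dot y y) 0.
  by rewrite (dot_eq0 y0) !dot0r expr0n mulr0.
have yp : 0 < dot y y by rewrite lt0r y0 dot_ge0.
(* The squared norm of this vector is [dot y y] times the gap in the Cauchy-Schwarz inequality. *)
have := dot_ge0 (dot y y *: x - dot x y *: y).
rewrite !(dotBl, dotBr, dotZl, dotZr) (dotC y x) => h.
by rewrite -(ler_pM2l yp); nra.
Qed.

Lemma norm_dot_le n (x y : 'cV[R]_n) : `|dot x y| <= norm2 x * norm2 y.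
Proof.
rewrite -ler_sqr ?nnegrE ?mulr_ge0 ?norm2_ge0 //.
by rewrite real_normK ?num_real // exprMn !norm2_sqr dot_sqr_le.
Qed.

Lemma dot_le n (x y : 'cV[R]_n) : dot x y <= norm2 x * norm2 y.
Proof. exact: le_trans (ler_norm _) (norm_dot_le _ _). Qed.

Lemma norm2D n (x y : 'cV[R]_n) : norm2 (x + y) <= norm2 x + norm2 y.
Proof.
apply: norm2_le; first by rewrite addr_ge0 ?norm2_ge0.
rewrite !(dotDl, dotDr) (dotC y x).
have := dot_le x y; have := norm2_sqr x; have := norm2_sqr y; nra.
Qed.

(** With this crude bound, clipping is controlled by a bound on single coordinates. *)
Lemma norm2_sum_le n (x : 'cV[R]_n) : norm2 x <= \sum_i `|x i 0|.
Proof.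
have s0 : 0 <= \sum_i `|x i 0| by apply: sumr_ge0.
apply: norm2_le => //; rewrite expr2 mulr_suml; apply: ler_sum => i _.
rewrite -expr2 -real_normK ?num_real // expr2 ler_wpM2l //.
by rewrite (bigD1 i) //= lerDl sumr_ge0.
Qed.

Lemma norm_coord_le n (x : 'cV[R]_n) i : `|x i 0| <= norm2 x.
Proof.
rewrite -ler_sqr ?nnegrE ?norm2_ge0 // norm2_sqr real_normK ?num_real //.
by rewrite /dot (bigD1 i) //= -expr2 lerDl sumr_ge0 // => j _; rewrite -expr2 sqr_ge0.
Qed.

Lemma opnorm_le m n (M : 'M[R]_(m, n)) b :
  (forall x, norm2 (M *m x) <= b * norm2 x) -> 0 <= b -> opnorm M <= b.
Proof.
move=> h b0; apply: ge_sup.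
  by exists (norm2 (M *m 0)), 0 => //=; rewrite norm2_0.
by move=> _ [x /= x1 <-]; apply: le_trans (h x) _; rewrite ler_piMr.
Qed.

Lemma norm_sub_relu (x y : R) : `|relu x - relu y| <= `|x - y|.
Proof.
rewrite /relu; case: (leP x 0) => ?; case: (leP y 0) => ?;
have := ler_norm (x - y); have := ler_norm (y - x); rewrite (distrC y);
by rewrite ler_norml => ? ?; apply/andP; split; lra.
Qed.

Lemma reluB (x : R) : relu x - relu (- x) = x.
Proof. by rewrite /relu; case: (leP x 0) => ?; case: (leP (- x) 0) => ?; lra. Qed.

Lemma relu_id (x : R) : 0 <= x -> relu x = x.
Proof. by rewrite /relu; case: (leP x 0) => //; lra. Qed.

Lemma relu_eq0 (x : R) : x <= 0 -> relu x = 0.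
Proof. by rewrite /relu; case: (leP x 0) => //; lra. Qed.

Lemma relu_ge0 (x : R) : 0 <= relu x.
Proof. by rewrite /relu le_max lexx orbT. Qed.

End Euclid.

(** * Gram matrices and accelerated gradient descent *)

Section Gram.
Context {R : realType} {d : nat}.
Variables (lambda : R) (a : nat -> 'cV[R]_d).

(** Built on a prefix of a sequence, so that it covers both the rounds of a dataset and the tokens
    up to a position. *)
Definition gramv n : 'M[R]_d := lambda%:M + \sum_(j < n) a j *m (a j)^T.

Lemma outer_mul (u v : 'cV[R]_d) : u *m u^T *m v = dot u v *: u.
Proof.
rewrite -mulmxA; apply/colP => i; rewrite !mxE big_ord1 mulrC; congr (_ * _).
by rewrite mxE; apply: eq_bigr => j _; rewrite mxE.
Qed.

Lemma gramv_mul n v : gramv n *m v = lambda *: v + \sum_(j < n) dot (a j) v *: a j.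
Proof.
rewrite mulmxDl mul_scalar_mx mulmx_suml; congr (_ + _).
by apply: eq_bigr => j _; rewrite outer_mul.
Qed.

Lemma dot_gramv n u v : dot u (gramv n *m v) =
  lambda * dot u v + \sum_(j < n) dot (a j) u * dot (a j) v.
Proof.
rewrite gramv_mul dotDr dotZr dot_sumr; congr (_ + _).
by apply: eq_bigr => j _; rewrite dotZr mulrC (dotC u).
Qed.

Lemma dot_gramv_sym n u v : dot (gramv n *m u) v = dot u (gramv n *m v).
Proof.
by rewrite dotC !dot_gramv (dotC v); congr (_ + _); apply: eq_bigr => j _; rewrite mulrC.
Qed.

Lemma gramv_lb n v : lambda * dot v v <= dot v (gramv n *m v).
Proof.
by rewrite dot_gramv lerDl sumr_ge0 // => j _; rewrite -expr2 sqr_ge0.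
Qed.

Lemma gramv_ub n v Ba : (forall j, (j < n)%N -> norm2 (a j) <= Ba) ->
  dot v (gramv n *m v) <= (lambda + n%:R * Ba ^+ 2) * dot v v.
Proof.
move=> aB; rewrite dot_gramv mulrDl lerD2l.
apply: (@le_trans _ _ (\sum_(j < n) Ba ^+ 2 * dot v v)).
  apply: ler_sum => j _; rewrite -expr2; apply: le_trans (dot_sqr_le _ _) _.
  have aj : norm2 (a j) <= Ba by apply: aB.
  have B0 := le_trans (norm2_ge0 _) aj.
  by rewrite ler_wpM2r ?dot_ge0 // -norm2_sqr ler_sqr ?nnegrE ?norm2_ge0.
by rewrite sumr_const card_ord -[X in X <= _]mulr_natl mulrA.
Qed.

Lemma gramv_unit n : 0 < lambda -> gramv n \in unitmx.
Proof.
move=> l0; rewrite unitmxE unitfE; apply/det0P => -[v v0 vP].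
have Pv : gramv n *m v^T = 0.
  (* [det0P] gives a row vector in the kernel; symmetry turns it into a column vector. *)
  rewrite -[gramv n]trmxK -trmx_mul; apply: (canLR trmxK); rewrite trmx0 -[RHS]vP.
  congr (_ *m _); rewrite raddfD /= tr_scalar_mx raddf_sum; congr (_ + _).
  by apply: eq_bigr => j _; rewrite /= trmx_mul trmxK.
have := gramv_lb n v^T; rewrite Pv dot0r => h.
have h0 : dot v^T v^T = 0.
  apply/eqP; rewrite eq_le dot_ge0 andbT.
  by rewrite -(ler_pM2l l0) mulr0.
by move/dot_eq0: h0 => /(congr1 trmx); rewrite trmxK trmx0 => h0; rewrite h0 eqxx in v0.
Qed.

Hypothesis l0 : 0 < lambda.

Lemma gramv_invK n (s : 'cV[R]_d) : gramv n *m (invmx (gramv n) *m s) = s.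
Proof. by rewrite mulmxA mulmxV ?gramv_unit // mul1mx. Qed.

Lemma dot_inv_ge0 n (s : 'cV[R]_d) : 0 <= dot s (invmx (gramv n) *m s).
Proof.
set v := _ *m s; have <- : gramv n *m v = s by exact: gramv_invK.
by rewrite dotC; apply: le_trans (gramv_lb _ _); rewrite mulr_ge0 ?dot_ge0 // ltW.
Qed.

Lemma norm_inv_le n (s : 'cV[R]_d) : norm2 (invmx (gramv n) *m s) <= norm2 s / lambda.
Proof.
set v := _ *m s; have Pv : gramv n *m v = s by exact: gramv_invK.
rewrite ler_pdivlMr //; have [v0|v0] := eqVneq (norm2 v) 0.
  by rewrite v0 mul0r norm2_ge0.
have vp : 0 < norm2 v by rewrite lt0r v0 norm2_ge0.
rewrite -(ler_pM2l vp) mulrA -expr2 norm2_sqr mulrC.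
by apply: le_trans (gramv_lb n v) _; rewrite Pv dot_le.
Qed.

Lemma dot_inv_ub n (s : 'cV[R]_d) : dot s (invmx (gramv n) *m s) <= norm2 s ^+ 2 / lambda.
Proof.
apply: le_trans (dot_le _ _) _; rewrite expr2 -mulrA ler_wpM2l ?norm2_ge0 //.
exact: norm_inv_le.
Qed.

(* Testing the Gram form on [v - theta *: s], with [theta] the inverse of its
   largest possible eigenvalue. *)
Lemma dot_inv_lb n (s : 'cV[R]_d) Ba : (forall j, (j < n)%N -> norm2 (a j) <= Ba) ->
  norm2 s ^+ 2 / (lambda + n%:R * Ba ^+ 2) <= dot s (invmx (gramv n) *m s).
Proof.
move=> aB; set v := _ *m s; have Pv : gramv n *m v = s by exact: gramv_invK.
set c := lambda + _.
have cp : 0 < c by rewrite /c ltr_wpDr // mulr_ge0 ?sqr_ge0.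
have := gramv_lb n (v - c^-1 *: s).
rewrite mulmxBr -scalemxAr Pv => h.
have h1 := le_trans (mulr_ge0 (ltW l0) (dot_ge0 _)) h.
have h2 := gramv_ub s aB; rewrite -/c in h2.
move: h1; rewrite !(dotBl, dotBr, dotZl, dotZr).
have -> : dot v (gramv n *m s) = dot s s by rewrite -dot_gramv_sym Pv.
rewrite (dotC v) norm2_sqr => h1.
have h3 : c^-1 * (c^-1 * dot s (gramv n *m s)) <= c^-1 * dot s s.
  rewrite ler_wpM2l ?invr_ge0 ?(ltW cp) //.
  by rewrite ler_pdivrMl.
by move: h1 h3; rewrite [_ / c]mulrC; lra.
Qed.

End Gram.

(** * Linear convergence of accelerated gradient descent on a quadratic *)

Section Nesterov.
Context {R : realType} {d : nat}.
Variables (G : 'M[R]_d) (s : 'cV[R]_d) (mu q : R).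

(* Step size [q ^+ 2 / mu]: the smoothness constant is [mu / q ^+ 2]. *)
Fixpoint agd n : 'cV[R]_d * 'cV[R]_d :=
  if n is m.+1 then
    let x := (agd m).1 in let y := (agd m).2 in
    let x' := y - (q ^+ 2 / mu) *: (G *m y - s) in
    (x', x' + ((1 - q) / (1 + q)) *: (x' - x))
  else (0, 0).

(* The auxiliary sequence of the Lyapunov function: [y = (x + q z) / (1 + q)]. *)
Definition agd_z n := q^-1 *: ((1 + q) *: (agd n).2 - (agd n).1).

Hypothesis Gsym : forall u v, dot (G *m u) v = dot u (G *m v).
Hypothesis mu0 : 0 < mu.
Hypothesis q0 : 0 < q.
Hypothesis q1 : q < 1.
Hypothesis Glb : forall v, mu * dot v v <= dot v (G *m v).
Hypothesis Gub : forall v, dot v (G *m v) <= mu / q ^+ 2 * dot v v.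

(** Nesterov's energy: the objective gap of [x], a quadratic form in its error [e], plus [mu / 2]
    times the squared error of [z]. *)
Let phi (e z : 'cV[R]_d) := dot e (G *m e) / 2 + mu / 2 * dot z z.

(* With the smoothness constant [mu / q ^+ 2], the terms [k1], ..., [k4]
   are exactly what the energy loses beyond the factor [1 - q]. *)
Lemma agd_lyapunov (u z : 'cV[R]_d) (g := G *m u) :
  phi (u - (q ^+ 2 / mu) *: g) ((1 - q) *: z + q *: u - (q / mu) *: g)
  <= (1 - q) * phi ((1 + q) *: u - q *: z) z.
Proof.
rewrite /phi !(mulmxBr, mulmxDr) -!scalemxAr -/g.
rewrite !(dotBl, dotBr, dotDl, dotDr, dotNl, dotNr, dotZl, dotZr).
have -> : dot u (G *m g) = dot g g by rewrite -Gsym.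
have -> : dot u (G *m z) = dot g z by rewrite -Gsym.
rewrite (dotC g u) (dotC g z) (dotC z u).
have h1 := Gub g; have h2 := Glb u.
have h3 : 0 <= dot (u - z) (G *m (u - z)).
  by apply: le_trans (Glb _); rewrite mulr_ge0 ?dot_ge0 // ltW.
have h4 := dot_ge0 (z - u).
move: h3 h4; rewrite !mulmxBr -/g !(dotBl, dotBr, dotC z u).
have -> : dot u (G *m z) = dot g z by rewrite -Gsym.
rewrite (dotC g z) => h3 h4.
rewrite -subr_ge0.
have k1 : 0 <= (q ^+ 2 / mu) ^+ 2 / 2 * (mu / q ^+ 2 * dot g g - dot g (G *m g)).
  by apply: mulr_ge0; rewrite ?subr_ge0 // divr_ge0 // sqr_ge0.
have k2 : 0 <= q / 2 * (dot u g - mu * dot u u).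
  by apply: mulr_ge0; rewrite ?subr_ge0 // divr_ge0 // ltW.
have k3 : 0 <= (1 - q) / 2 * q ^+ 2 * (dot u g - dot z g - (dot z g - dot z (G *m z))).
  by rewrite !mulr_ge0 ?sqr_ge0 ?invr_ge0 ?subr_ge0 ?(ltW q1) ?(ltW q0) //; move: h3; lra.
have k4 : 0 <= mu / 2 * q * (1 - q) * (dot z z - dot u z - (dot u z - dot u u)).
  rewrite !mulr_ge0 ?invr_ge0 ?(ltW mu0) ?(ltW q0) ?subr_ge0 ?(ltW q1) //.
  by move: h4; lra.
apply: le_trans (addr_ge0 (addr_ge0 k1 k2) (addr_ge0 k3 k4)) _.
rewrite le_eqVlt; apply/orP; left; apply/eqP.
by field; rewrite !gt_eqF.
Qed.

Variable x0 : 'cV[R]_d.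
Hypothesis Gx0 : G *m x0 = s.

(** The energy controls [x] and [z] only; this weighted mean transfers the control to [y]. *)
Lemma agd_yE n : (agd n).2 - x0 =
  (1 + q)^-1 *: (((agd n).1 - x0) + q *: (agd_z n - x0)).
Proof.
apply/colP => i; rewrite /agd_z !mxE; field.
by rewrite !gt_eqF // addr_gt0.
Qed.

(** All three sequences start at 0, so the initial energy is [dot s x0 / 2 + mu / 2 * dot x0 x0], at
    most [dot s x0] by strong convexity. Each step then costs a factor [1 - q]. *)
Lemma agd_energy n :
  phi ((agd n).1 - x0) (agd_z n - x0) <= (1 - q) ^+ n * dot s x0.
Proof.
have q1p : 1 + q != 0 by rewrite gt_eqF // addr_gt0.
elim: n => [|n IH].
  rewrite expr0 mul1r /agd_z /= scaler0 !subrr scaler0 !sub0r /phi mulmxN.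
  rewrite !(dotNl, dotNr) !opprK Gx0 (dotC s).
  by have := Glb x0; rewrite Gx0; lra.
rewrite exprS -mulrA.
apply: le_trans (ler_wpM2l _ IH); last by rewrite subr_ge0 ltW.
have := agd_lyapunov ((agd n).2 - x0) (agd_z n - x0); cbv zeta.
set g := G *m _; have gE : g = G *m (agd n).2 - s by rewrite /g mulmxBr Gx0.
have -> : (agd n).2 - x0 - (q ^+ 2 / mu) *: g = (agd n.+1).1 - x0.
  by rewrite gE /= addrAC.
have -> : (1 - q) *: (agd_z n - x0) + q *: ((agd n).2 - x0) - (q / mu) *: g
    = agd_z n.+1 - x0.
  rewrite gE /agd_z /=; apply/colP => i; rewrite !mxE.
  by field; rewrite ?q1p ?gt_eqF.
have -> // : (1 + q) *: ((agd n).2 - x0) - q *: (agd_z n - x0) = (agd n).1 - x0.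
by rewrite /agd_z; apply/colP => i; rewrite !mxE; field; rewrite ?q1p ?gt_eqF.
Qed.

Variable b : R.
Hypothesis sb : norm2 s <= b.

Lemma norm_sol_le : norm2 x0 <= b / mu.
Proof.
have [v0|v0] := eqVneq (norm2 x0) 0.
  by rewrite v0 divr_ge0 ?(ltW mu0) //; apply: le_trans (norm2_ge0 _) sb.
have vp : 0 < norm2 x0 by rewrite lt0r v0 norm2_ge0.
rewrite ler_pdivlMr // -(ler_pM2l vp) mulrA -expr2 norm2_sqr mulrC.
apply: le_trans (Glb _) _; rewrite Gx0; apply: le_trans (dot_le _ _) _.
by rewrite ler_wpM2l ?norm2_ge0.
Qed.

(** Each half of the energy dominates [mu / 2] times a squared error, for [x] by strong convexity,
    and [dot s x0] is at most [b * (b / mu)]. Dividing by [mu / 2] gives [D]. *)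
Lemma agd_dist n (D := 2 * (b / mu) ^+ 2 * (1 - q) ^+ n) :
  norm2 ((agd n).1 - x0) ^+ 2 <= D /\ norm2 ((agd n).2 - x0) ^+ 2 <= D.
Proof.
have bp : 0 <= b by apply: le_trans (norm2_ge0 _) sb.
have qn : 0 <= (1 - q) ^+ n by rewrite exprn_ge0 // subr_ge0 ltW.
have e1 : (1 - q) ^+ n * dot s x0 <= mu / 2 * D.
  have -> : mu / 2 * D = (1 - q) ^+ n * (b * (b / mu)).
    by rewrite /D; field; rewrite gt_eqF.
  rewrite ler_wpM2l //; apply: le_trans (dot_le _ _) _.
  by rewrite ler_pM ?norm2_ge0 ?norm_sol_le.
have e2 := le_trans (agd_energy n) e1.
have m2 : 0 < mu / 2 by rewrite divr_gt0.
have x1 : norm2 ((agd n).1 - x0) ^+ 2 <= D.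
  rewrite norm2_sqr -(ler_pM2l m2); apply: le_trans e2.
  rewrite /phi; have := Glb ((agd n).1 - x0); have := dot_ge0 (agd_z n - x0); nra.
have x2 : norm2 (agd_z n - x0) ^+ 2 <= D.
  rewrite norm2_sqr -(ler_pM2l m2); apply: le_trans e2.
  rewrite /phi; have := Glb ((agd n).1 - x0); have := dot_ge0 ((agd n).1 - x0); nra.
split=> //.
have D0 : 0 <= D by apply: le_trans x1; rewrite sqr_ge0.
have sD (v : R) : 0 <= v -> v ^+ 2 <= D -> v <= Num.sqrt D.
  by move=> v0 h; rewrite -(ler_sqr) ?nnegrE ?sqrtr_ge0 // sqr_sqrtr.
rewrite -[leRHS]sqr_sqrtr // ler_sqr ?nnegrE ?norm2_ge0 ?sqrtr_ge0 //.
have y1 := sD _ (norm2_ge0 _) x1; have y2 := sD _ (norm2_ge0 _) x2.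
rewrite agd_yE norm2Z ger0_norm ?invr_ge0 ?addr_ge0 ?(ltW q0) //.
rewrite ler_pdivrMl ?addr_gt0 //; apply: le_trans (norm2D _ _) _.
rewrite norm2Z gtr0_norm // mulrDl mul1r lerD // ler_wpM2l ?(ltW q0) //.
Qed.

End Nesterov.

(** * Square roots, softmax and ridge regression *)

Section SquareRoot.
Context {R : realType}.
Variables c x : R.

Fixpoint sqrt_iter n : R :=
  if n is m.+1 then sqrt_iter m + c * (x - sqrt_iter m ^+ 2) else 0.

Hypothesis c0 : 0 <= c.
Hypothesis x0 : 0 <= x.
Hypothesis cx : 2 * c * Num.sqrt x <= 1.

(** One step multiplies the error by [1 - c (s + z)], where [s] is the root and [z] the iterate. As
    [0 <= z <= s], the condition [2 c s <= 1] keeps this factor nonnegative, so the iterates never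
    overshoot, and [0 <= z] bounds it by [1 - c s]. *)
Lemma sqrt_iter_bound n :
  0 <= Num.sqrt x - sqrt_iter n <= (1 - c * Num.sqrt x) ^+ n * Num.sqrt x
  /\ 0 <= sqrt_iter n.
Proof.
set s := Num.sqrt x; have s0 : 0 <= s by exact: sqrtr_ge0.
have sE : s ^+ 2 = x by exact: sqr_sqrtr.
elim: n => [|n [/andP[h1 h2] h3]] /=; first by rewrite expr0 mul1r subr0 s0 !lexx.
set z := sqrt_iter n in h1 h2 h3 *; rewrite -sE.
have zc : c * z <= c * s by rewrite ler_wpM2l // -subr_ge0.
have cs1 : c * s + c * z <= 1 by move: cx; rewrite -/s; lra.
have -> : s - (z + c * (s ^+ 2 - z ^+ 2)) = (1 - (c * s + c * z)) * (s - z) by ring.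
have cz0 : 0 <= c * z by rewrite mulr_ge0.
split; last first.
  rewrite addr_ge0 // mulr_ge0 // subr_ge0 ler_sqr ?nnegrE //; lra.
apply/andP; split; first by rewrite mulr_ge0 // subr_ge0.
rewrite exprS -mulrA.
apply: (@le_trans _ _ ((1 - c * s) * (s - z))); first by rewrite ler_wpM2r //; lra.
by rewrite ler_wpM2l //; lra.
Qed.

End SquareRoot.

Section Softmax.
Context {R : realType}.

Lemma ln_softmax n (v : 'cV[R]_n) k :
  ln (softmax v k) = v k 0 - ln (\sum_(l < n) expR (v l 0)).
Proof.
rewrite /softmax ln_div ?posrE ?expR_gt0 ?expRK //.
by rewrite (bigD1 k) //= ltr_pwDl ?expR_gt0 // sumr_ge0 // => l _; rewrite expR_ge0.
Qed.

(** A shift of all scores by [e] multiplies the sum by [expR e]. The index [k] witnesses that the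
    sum is nonempty, hence positive. *)
Lemma ln_sum_expR_le n (v w : 'cV[R]_n) (k : 'I_n) e :
  (forall l, v l 0 <= w l 0 + e) ->
  ln (\sum_(l < n) expR (v l 0)) <= ln (\sum_(l < n) expR (w l 0)) + e.
Proof.
move=> vw; have pos (u : 'cV[R]_n) : 0 < \sum_(l < n) expR (u l 0).
  by rewrite (bigD1 k) //= ltr_pwDl ?expR_gt0 // sumr_ge0 // => l _; rewrite expR_ge0.
rewrite -[X in _ + X]expRK -lnM ?posrE ?expR_gt0 // ler_ln ?posrE ?mulr_gt0 ?expR_gt0 //.
by rewrite mulr_suml; apply: ler_sum => l _; rewrite -expRD ler_expR.
Qed.

(** One [e] comes from the score itself, the other from the logarithm of the normalising sum. *)
Lemma ln_softmax_dist n (v w : 'cV[R]_n) k e :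
  (forall l, `|v l 0 - w l 0| <= e) ->
  `|ln (softmax v k) - ln (softmax w k)| <= 2 * e.
Proof.
move=> vw; rewrite !ln_softmax.
have h l := vw l; have h1 := vw k.
have h2 : ln (\sum_(l < n) expR (v l 0)) <= ln (\sum_(l < n) expR (w l 0)) + e.
  by apply: (ln_sum_expR_le k) => l; move: (vw l); rewrite ler_norml; lra.
have h3 : ln (\sum_(l < n) expR (w l 0)) <= ln (\sum_(l < n) expR (v l 0)) + e.
  by apply: (ln_sum_expR_le k) => l; move: (vw l); rewrite ler_norml; lra.
by move: h1; rewrite !ler_norml; lra.
Qed.

End Softmax.

(** * Normal equations of ridge regression *)

Section Ridge.
Context {R : realType} {d A : nat}.
Variables (lambda : R) (D : seq (round R d A)).
Hypothesis l0 : 0 < lambda.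

Definition nth_action j := rd_action (nth (Round 0 0 0) D j).

Lemma gram_gramv : gram lambda D = gramv lambda nth_action (size D).
Proof. by rewrite /gram (big_nth (Round 0 0 0)) big_mkord. Qed.

Let b := \sum_(x <- D) rd_reward x *: rd_action x.

Lemma dot_gram (u v : 'cV[R]_d) : dot u (gram lambda D *m v) =
  lambda * dot u v + \sum_(x <- D) dot (rd_action x) u * dot (rd_action x) v.
Proof.
by rewrite gram_gramv dot_gramv [X in _ = _ + X](big_nth (Round 0 0 0)) big_mkord.
Qed.

Lemma ridge_lossE w : ridge_loss lambda D w =
  \sum_(x <- D) rd_reward x ^+ 2 - 2 * dot w b + dot w (gram lambda D *m w).
Proof.
rewrite dot_gram /b dot_sumr /ridge_loss norm2_sqr.
have -> : \sum_(x <- D) (rd_reward x - dot (rd_action x) w) ^+ 2 =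
    \sum_(x <- D) rd_reward x ^+ 2
    - 2 * \sum_(x <- D) dot w (rd_reward x *: rd_action x)
    + \sum_(x <- D) dot (rd_action x) w * dot (rd_action x) w.
  rewrite mulr_sumr -sumrB -big_split; apply: eq_bigr => x _ /=.
  by rewrite dotZr (dotC w); ring.
by ring.
Qed.

(** [ridge] is an arbitrary choice among minimisers. Completing the square around [w0] shows that
    [w0] is a minimiser and that any other one is at Gram distance 0 from it. *)
Lemma ridge_spec : gram lambda D *m ridge lambda D = b.
Proof.
have PK (s : 'cV[R]_d) : gram lambda D *m (invmx (gram lambda D) *m s) = s.
  by rewrite gram_gramv gramv_invK.
set P := gram lambda D in PK *; set w0 := invmx P *m b.
have lossE u : ridge_loss lambda D u
    = ridge_loss lambda D w0 + dot (u - w0) (P *m (u - w0)).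
  rewrite !ridge_lossE -/P !mulmxBr (PK b) !(dotBl, dotBr).
  have -> : dot w0 (P *m u) = dot u b.
    by rewrite /P gram_gramv -dot_gramv_sym -gram_gramv (PK b) dotC.
  ring.
have ge0 v : 0 <= dot v (P *m v).
  rewrite /P gram_gramv; apply: le_trans (gramv_lb _ _ _ _).
  by rewrite mulr_ge0 ?dot_ge0 // ltW.
have := @xgetPex _ 0 [set w | forall u, ridge_loss lambda D w <= ridge_loss lambda D u].
rewrite -/(ridge lambda D) /= => /(_ _)/(_ w0) h.
have : ridge_loss lambda D (ridge lambda D) <= ridge_loss lambda D w0.
  by apply: h; exists w0 => u; rewrite [leRHS]lossE lerDl.
rewrite lossE gerDl => h1.
have h2 : dot (ridge lambda D - w0) (ridge lambda D - w0) = 0.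
  apply/eqP; rewrite eq_le dot_ge0 andbT -(ler_pM2l l0) mulr0.
  by apply: le_trans h1; rewrite /P gram_gramv gramv_lb.
by move/dot_eq0/eqP: h2; rewrite subr_eq0 => /eqP ->; rewrite PK.
Qed.

(** Symmetry moves the inverse from the regression target to the query [v]: the solve that gives the
    confidence width also gives the predicted mean, as an attention average of rewards. *)
Lemma dot_ridge v : dot v (ridge lambda D) =
  \sum_(x <- D) rd_reward x * dot (rd_action x) (invmx (gram lambda D) *m v).
Proof.
have {1}-> : v = gram lambda D *m (invmx (gram lambda D) *m v).
  by rewrite gram_gramv gramv_invK.
rewrite gram_gramv dot_gramv_sym -gram_gramv ridge_spec dot_sumr.
by apply: eq_bigr => x _; rewrite dotZr (dotC _ (rd_action x)).
Qed.

End Ridge.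

(** * Sparse attention layers *)

Section SumOrd.

(** Nested sums mirror nested [col_mx]: a tagged coordinate computes to the matching [lshift] and
    [rshift], so that [col_mxEu] and [col_mxEd] read off token entries. *)
Definition esum (T1 T2 : Type) m n (f : T1 -> 'I_m) (g : T2 -> 'I_n)
    (c : T1 + T2) : 'I_(m + n) :=
  match c with inl a => lshift n (f a) | inr b => rshift m (g b) end.

Definition dsum (T1 T2 : Type) m n (f : 'I_m -> T1) (g : 'I_n -> T2)
    (i : 'I_(m + n)) : T1 + T2 :=
  match fintype.split i with inl a => inl (f a) | inr b => inr (g b) end.

Lemma esumK (T1 T2 : Type) m n (f : T1 -> 'I_m) (g : T2 -> 'I_n) f' g' :
  cancel f f' -> cancel g g' -> cancel (esum f g) (dsum f' g').
Proof.
move=> fK gK [a|b] /=; rewrite /dsum.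
  by rewrite (unsplitK (inl (f a))) fK.
by rewrite (unsplitK (inr (g b))) gK.
Qed.

Lemma dsumK (T1 T2 : Type) m n (f : T1 -> 'I_m) (g : T2 -> 'I_n) f' g' :
  cancel f' f -> cancel g' g -> cancel (dsum f' g') (esum f g).
Proof.
move=> fK gK i; rewrite /dsum -{2}(splitK i); case: (fintype.split i) => j /=.
  by rewrite fK.
by rewrite gK.
Qed.

Definition epair m n (p : 'I_m * 'I_n) : 'I_(m * n) := mxvec_index p.1 p.2.
Definition dpair m n (i : 'I_(m * n)) : 'I_m * 'I_n :=
  enum_val (cast_ord (esym (mxvec_cast m n)) i).

Lemma epairK m n : cancel (@epair m n) (@dpair m n).
Proof. by case=> i j; rewrite /dpair /epair /mxvec_index cast_ordK enum_rankK. Qed.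

Lemma dpairK m n : cancel (@dpair m n) (@epair m n).
Proof.
move=> i; rewrite /epair /mxvec_index -surjective_pairing /dpair enum_valK.
by rewrite cast_ordKV.
Qed.

End SumOrd.

(** * Named coordinates of a token *)

Section Coordinates.
Variables d A : nat.

Definition pad_len := (A * d + (A * d + (A + A)))%N.
Definition tdim := token_dim d A pad_len.

Definition pad_coord : Type := 'I_A * 'I_d + ('I_A * 'I_d + ('I_A + 'I_A)).
(** A tagged sum instead of an ordinal, so that layers are specified by pattern matching and
    verified by cases on the block. *)
Definition coord : Type :=
  ('I_d + 'I_1) + ('I_A * 'I_d + ('I_A + (pad_coord + 'I_3))).
HB.instance Definition _ := Finite.on coord.

Definition enc : coord -> 'I_tdim :=
  esum (esum id id) (esum (@epair A d) (esum id (esum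
    (esum (@epair A d) (esum (@epair A d) (esum id id))) id))).
Definition dec : 'I_tdim -> coord :=
  dsum (dsum id id) (dsum (@dpair A d) (dsum id (dsum
    (dsum (@dpair A d) (dsum (@dpair A d) (dsum id id))) id))).

Lemma encK : cancel enc dec.
Proof. by do ?[apply: esumK | apply: epairK]. Qed.

Lemma decK : cancel dec enc.
Proof. by do ?[apply: dsumK | apply: dpairK]. Qed.

(* Token blocks: action, reward, action set, output, the two iterates [x] and
   [y] of Nesterov's method, the squared confidence width, its square root,
   position. *)
Definition cA (l : 'I_d) : coord := inl (inl l).
Definition cR : coord := inl (inr ord0).
Definition cS k l : coord := inr (inl (k, l)).
Definition cO k : coord := inr (inr (inl k)).
Definition cX k l : coord := inr (inr (inr (inl (inl (k, l))))).
Definition cY k l : coord := inr (inr (inr (inl (inr (inl (k, l)))))).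
Definition cQ k : coord := inr (inr (inr (inl (inr (inr (inl k)))))).
Definition cZ k : coord := inr (inr (inr (inl (inr (inr (inr k)))))).
Definition cP (m : 'I_3) : coord := inr (inr (inr (inr m))).

Lemma coordP (P : coord -> Type) :
  (forall l, P (cA l)) -> P cR -> (forall k l, P (cS k l)) ->
  (forall k, P (cO k)) -> (forall k l, P (cX k l)) -> (forall k l, P (cY k l)) ->
  (forall k, P (cQ k)) -> (forall k, P (cZ k)) -> (forall m, P (cP m)) ->
  forall c, P c.
Proof.
move=> hA hR hS hO hX hY hQ hZ hP.
case=> [[l|i]|[[k l]|[k|[[[k l]|[[k l]|[k|k]]]|m]]]];
  [exact: hA | rewrite (ord1 i); exact: hR | exact: hS | exact: hO | exact: hX
  | exact: hY | exact: hQ | exact: hZ | exact: hP].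
Qed.

Lemma sum_coord (R : nmodType) (F : coord -> R) :
  \sum_c F c = (\sum_l F (cA l) + F cR)
    + (\sum_k \sum_l F (cS k l) + (\sum_k F (cO k)
    + ((\sum_k \sum_l F (cX k l) + (\sum_k \sum_l F (cY k l)
    + (\sum_k F (cQ k) + \sum_k F (cZ k)))) + \sum_m F (cP m)))).
Proof.
do ![rewrite big_sumType /=]; rewrite big_ord1; congr (_ + _).
by rewrite !pair_big /=; congr (_ + (_ + (_ + (_ + _) + _)));
  apply: eq_bigr => -[].
Qed.

(** The dimension is [3 A d + 3 A + d + 4], and each monomial is at most [d * A]. *)
Lemma tdim_le : (0 < d)%N -> (0 < A)%N -> (tdim <= 11 * (d * A))%N.
Proof. by rewrite /tdim /token_dim /pad_len => d0 A0; nia. Qed.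

(** No coordinate is copied twice, so a move is a partial permutation matrix, of operator norm at
    most 1. The norm of a weight matrix is then bounded by the sum of its coefficients. *)
Definition pinj (src : coord -> option coord) :=
  forall c1 c2 e, src c1 = Some e -> src c2 = Some e -> c1 = c2.

(* [pm c] is the coordinate copied into [c], if any. *)
Record pmove := PMove { pm :> coord -> option coord; _ : pinj pm }.

End Coordinates.

Arguments cA {d A} l.
Arguments cR {d A}.
Arguments cS {d A} k l.
Arguments cO {d A} k.
Arguments cX {d A} k l.
Arguments cY {d A} k l.
Arguments cQ {d A} k.
Arguments cZ {d A} k.
Arguments cP {d A} m.

(** * Layers whose weights are signed sums of partial permutations *)

Section SparseTransformer.
Context {R : realType} {d A : nat}.
Notation coord := (coord d A).
Notation tdim := (tdim d A).
Notation pmove := (pmove d A).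

Definition colv (f : coord -> R) : 'cV[R]_tdim := \col_i f (dec i).

Lemma sum_dec (F : coord -> R) : \sum_(i < tdim) F (dec i) = \sum_c F c.
Proof.
rewrite [RHS](reindex (@dec d A)) //; exists (@enc d A) => c _; first exact: decK.
exact: encK.
Qed.

Lemma dot_colv f g : dot (colv f) (colv g) = \sum_c f c * g c.
Proof. by rewrite -sum_dec; apply: eq_bigr => i _; rewrite !mxE. Qed.

Definition ap1 (src : pmove) (f : coord -> R) c := oapp f 0 (src c).

Definition pmx (src : pmove) : 'M[R]_tdim :=
  \matrix_(i, j) (src (dec i) == Some (dec j))%:R.

Lemma sum_option (o : option coord) f :
  \sum_c (o == Some c)%:R * f c = oapp f 0 o :> R.
Proof.
case: o => [c|] /=; last by rewrite big1 // => c _; rewrite mul0r.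
rewrite (bigD1 c) //= eqxx mul1r big1 ?addr0 // => c' c'c.
by rewrite (_ : (_ == _) = false) ?mul0r //; apply: contra_neqF c'c => /eqP[].
Qed.

Lemma pmx_mul src f : pmx src *m colv f = colv (ap1 src f).
Proof.
apply/colP => i; rewrite !mxE /ap1 -sum_option -sum_dec.
by apply: eq_bigr => j _; rewrite !mxE.
Qed.

Lemma colvK (x : 'cV[R]_tdim) : colv (fun c => x (enc c) 0) = x.
Proof. by apply/colP => i; rewrite mxE decK. Qed.

(** After exchanging the sums, each square [f c' ^ 2] is counted once per destination that copies
    [c'], and [pinj] allows at most one. *)
Lemma norm2_colv_ap1 src f : norm2 (colv (ap1 src f)) <= norm2 (colv f).
Proof.
apply: ler_wsqrtr; rewrite !dot_colv.
have -> : \sum_c ap1 src f c * ap1 src f c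
    = \sum_c \sum_c' (src c == Some c')%:R * (f c' * f c').
  apply: eq_bigr => c _; rewrite (sum_option _ (fun e => f e * f e)) /ap1.
  by case: (pm src c) => //=; rewrite mul0r.
rewrite exchange_big; apply: ler_sum => c' _ /=.
rewrite -mulr_suml ler_piMl -?expr2 ?sqr_ge0 //.
apply: (@le_trans _ _ #|[pred c | src c == Some c']|%:R).
  rewrite -sum1_card natr_sum [leRHS]big_mkcond; apply: ler_sum => c _ /=.
  by rewrite inE; case: (_ == _).
rewrite (ler_nat _ _ 1).
apply/card_le1_eqP => c1 c2; rewrite !inE => /eqP h1 /eqP h2.
by case: src h1 h2 => s si /= h1 h2; exact: (si _ _ _ h2 h1).
Qed.

Notation lin := (seq (R * pmove)).

Definition lmx (ts : lin) : 'M[R]_tdim := \sum_(t <- ts) t.1 *: pmx t.2.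
Definition ap (ts : lin) (f : coord -> R) c : R := \sum_(t <- ts) t.1 * ap1 t.2 f c.
Definition wt (ts : lin) : R := \sum_(t <- ts) `|t.1|.

Lemma wt_ge0 ts : 0 <= wt ts.
Proof. exact: sumr_ge0. Qed.

Lemma lmx_mul ts f : lmx ts *m colv f = colv (ap ts f).
Proof.
rewrite mulmx_suml; apply/colP => i; rewrite summxE mxE; apply: eq_bigr => t _.
by rewrite -scalemxAl pmx_mul !mxE.
Qed.

Lemma opnorm_lmx ts : opnorm (lmx ts) <= wt ts.
Proof.
apply: opnorm_le (wt_ge0 _) => x; rewrite /lmx mulmx_suml /wt mulr_suml.
elim/big_rec2: _ => [|t y z _ h]; first by rewrite norm2_0.
apply: le_trans (norm2D _ _) _; rewrite lerD //.
rewrite -scalemxAl norm2Z ler_wpM2l // -(colvK x) pmx_mul.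
exact: norm2_colv_ap1.
Qed.

Record shead := SHead { hV : lin; hQ : lin; hK : lin }.
Definition shead0 := SHead [::] [::] [::].
Definition head_of h := AttnHead (lmx (hV h)) (lmx (hQ h)) (lmx (hK h)).

(** The remaining heads are null heads, which contribute nothing; the MLP has hidden dimension 0 and
    is the identity. *)
Definition layer_of (hs : seq shead) : tf_layer R tdim (4 * A) 0 :=
  TFLayer (fun m => head_of (nth shead0 hs m)) 0 0.

Definition tokmx N (u : nat -> coord -> R) : 'M[R]_(tdim, N) :=
  \matrix_(c, i) u i (dec c).

Definition score h (f g : coord -> R) : R := \sum_c ap (hQ h) f c * ap (hK h) g c.
Definition contrib h (u : nat -> coord -> R) i c : R :=
  i.+1%:R^-1 * \sum_(j < i.+1) relu (score h (u i) (u j)) * ap (hV h) (u j) c.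
(** By the causal mask, token [i] depends on tokens up to [i] only. A layer thus acts on infinite
    sequences of tokens, whatever the prompt length, and [tokmx] truncates them. *)
Definition astep hs u i c : R := u i c + \sum_(h <- hs) contrib h u i c.

Lemma big_nth_widen (F : shead -> R) hs M : (size hs <= M)%N -> F shead0 = 0 ->
  \sum_(m < M) F (nth shead0 hs m) = \sum_(h <- hs) F h.
Proof.
move=> hM F0; rewrite (big_nth shead0) big_mkord.
rewrite (big_ord_widen _ (fun i => F (nth shead0 hs i)) hM) [RHS]big_mkcond /=.
by apply: eq_bigr => i _; case: ltnP => // h; rewrite nth_default.
Qed.

Lemma attn_tokmx N hs u : (size hs <= 4 * A)%N ->
  attn (layer_heads (layer_of hs)) (tokmx N u) = tokmx N (astep hs u).
Proof.
move=> hM; have colE i : col i (tokmx N u) = colv (u i).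
  by apply/colP => c; rewrite !mxE.
apply/matrixP => c i; rewrite mxE colE [RHS]mxE mxE [in LHS]mxE summxE /astep.
congr (_ + _); rewrite -(big_nth_widen hM); last first.
  rewrite /contrib big1 ?mulr0 // => j _.
  by rewrite /score big1 ?relu_id ?mul0r // => e _; rewrite /ap big_nil mul0r.
apply: eq_bigr => m _; rewrite mxE summxE /contrib; congr (_ * _).
rewrite (big_ord_widen N (fun j => relu (score _ (u i) (u j)) * ap _ (u j) (dec c))) //.
apply: eq_bigr => j _; rewrite !colE !lmx_mul dot_colv !mxE.
by [].
Qed.

(** Coordinates bounded by [b] give columns of norm at most the dimension times [b], inside the
    ball. *)
Lemma clip_tokmx N u r b :
  (forall i c, (i < N)%N -> `|u i c| <= b) -> tdim%:R * b <= r ->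
  clip r (tokmx N u) = tokmx N u.
Proof.
move=> ub br; apply/matrixP => c i; rewrite [LHS]mxE /proj_ball.
have -> : col i (tokmx N u) = colv (u i) by apply/colP => e; rewrite !mxE.
rewrite ifT ?mxE //; apply: le_trans (norm2_sum_le _) _; apply: le_trans br.
apply: (@le_trans _ _ (\sum_(j < tdim) b)).
  by apply: ler_sum => j _; rewrite mxE ub.
by rewrite sumr_const card_ord mulr_natl.
Qed.

Lemma layer_tokmx N hs u r b : (size hs <= 4 * A)%N ->
  (forall i c, (i < N)%N -> `|astep hs u i c| <= b) -> tdim%:R * b <= r ->
  clip r (mlp (layer_W1 (layer_of hs)) (layer_W2 (layer_of hs))
    (attn (layer_heads (layer_of hs)) (tokmx N u))) = tokmx N (astep hs u).
Proof.
move=> hM ub br; rewrite attn_tokmx // /mlp /= mul0mx addr0.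
exact: clip_tokmx ub br.
Qed.

Lemma opnorm0 m n : opnorm (0 : 'M[R]_(m, n)) <= 0.
Proof. by apply: opnorm_le => // x; rewrite mul0mx norm2_0 mul0r. Qed.

Lemma layer_norm_le hs : (size hs <= 4 * A)%N ->
  layer_norm (layer_of hs) <=
  \big[Num.max/0]_(h <- hs) Num.max (wt (hQ h)) (wt (hK h)) + \sum_(h <- hs) wt (hV h).
Proof.
move=> hM; rewrite /layer_norm /= -[leRHS]addr0 -[leRHS]addr0.
rewrite !lerD ?opnorm0 //; last first.
  rewrite -(big_nth_widen hM) /wt ?big_nil //.
  by apply: ler_sum => m _; exact: opnorm_lmx.
have B0 : 0 <= \big[Num.max/0]_(h <- hs) Num.max (wt (hQ h)) (wt (hK h)).
  by elim/big_ind: _ => // [x y x0 y0|h _]; rewrite le_max ?x0 ?wt_ge0.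
apply: bigmax_le => // m _.
apply: (@le_trans _ _ (Num.max (wt (hQ (nth shead0 hs m))) (wt (hK (nth shead0 hs m))))).
  by rewrite ge_max !le_max !opnorm_lmx orbT.
have [ms|ms] := ltnP m (size hs); last first.
  by rewrite nth_default //= /wt !big_nil maxxx.
elim: hs {hM B0} (nat_of_ord m) ms => // h hs IH [|n] ms; rewrite big_cons le_max.
  by rewrite lexx.
by rewrite IH ?orbT.
Qed.

End SparseTransformer.

(** * Attention heads *)

Section Moves.
Variables d A : nat.
Notation coord := (coord d A).

(** A move is described from its destinations: [tgt] gives the index of a slot within the block that
    is written. Injectivity there and in the source map yields [pinj]. *)
Definition tinj (J : Type) (tgt : coord -> option J) :=
  forall c1 c2 j, tgt c1 = Some j -> tgt c2 = Some j -> c1 = c2.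

Lemma move_inj (J : Type) (tgt : coord -> option J) (f : J -> coord) :
  tinj tgt -> injective f -> pinj (fun c => omap f (tgt c)).
Proof.
move=> ti fi c1 c2 e; case E1: (tgt c1) => [j1|] //= -[<-].
by case E2: (tgt c2) => [j2|] //= -[/fi ej]; apply: ti E1 _; rewrite E2 ej.
Qed.

Definition move J tgt f (ti : @tinj J tgt) (fi : injective f) := PMove (move_inj ti fi).

Definition tA (c : coord) := if c is inl (inl l) then Some l else None.
Definition tR (c : coord) := if c is inl (inr _) then Some tt else None.
Definition tO (c : coord) := if c is inr (inr (inl k)) then Some k else None.
Definition tX (c : coord) :=
  if c is inr (inr (inr (inl (inl p)))) then Some p else None.
Definition tY (c : coord) :=
  if c is inr (inr (inr (inl (inr (inl p))))) then Some p else None.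
Definition tQ (c : coord) :=
  if c is inr (inr (inr (inl (inr (inr (inl k)))))) then Some k else None.
Definition tZ (c : coord) :=
  if c is inr (inr (inr (inl (inr (inr (inr k)))))) then Some k else None.
Definition tP (c : coord) := if c is inr (inr (inr (inr m))) then Some m else None.

Ltac tinj_tac :=
  case=> [[?|i1]|[[? ?]|[?|[[[? ?]|[[? ?]|[?|?]]]|?]]]] //;
  case=> [[?|i2]|[[? ?]|[?|[[[? ?]|[[? ?]|[?|?]]]|?]]]] // j /= [<-] // [];
  by repeat move=> ->.

Lemma tA_inj : tinj tA. Proof. tinj_tac. Qed.
Lemma tR_inj : tinj tR.
Proof.
case=> [[?|i1]|[[? ?]|[?|[[[? ?]|[[? ?]|[?|?]]]|?]]]] //;
case=> [[?|i2]|[[? ?]|[?|[[[? ?]|[[? ?]|[?|?]]]|?]]]] // _ _ _.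
by rewrite (ord1 i1) (ord1 i2).
Qed.
Lemma tO_inj : tinj tO. Proof. tinj_tac. Qed.
Lemma tX_inj : tinj tX. Proof. tinj_tac. Qed.
Lemma tY_inj : tinj tY. Proof. tinj_tac. Qed.
Lemma tQ_inj : tinj tQ. Proof. tinj_tac. Qed.
Lemma tZ_inj : tinj tZ. Proof. tinj_tac. Qed.
Lemma tP_inj : tinj tP. Proof. tinj_tac. Qed.

Definition at_key (J : eqType) (j : J) (tgt : coord -> option J) c :=
  if tgt c is Some j' then (if j' == j then Some tt else None) else None.
Definition at_row (tgt : coord -> option ('I_A * 'I_d)) k c :=
  if tgt c is Some (k', l) then (if k' == k then Some l else None) else None.

Lemma at_key_inj (J : eqType) (j : J) tgt : tinj tgt -> tinj (at_key j tgt).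
Proof.
move=> ti c1 c2 [] ; rewrite /at_key.
case E1: (tgt c1) => [j1|] //; case: eqP => // e1 _.
case E2: (tgt c2) => [j2|] //; case: eqP => // e2 _.
by apply: ti E1 _; rewrite E2 e1 e2.
Qed.

Lemma at_row_inj tgt k : tinj tgt -> tinj (at_row tgt k).
Proof.
move=> ti c1 c2 l ; rewrite /at_row.
case E1: (tgt c1) => [[k1 l1]|] //; case: eqP => // e1 [l1E].
case E2: (tgt c2) => [[k2 l2]|] //; case: eqP => // e2 [l2E].
by apply: ti E1 _; rewrite E2 e1 e2 l1E l2E.
Qed.

Lemma cA_inj : injective (@cA d A). Proof. by move=> ? ? []. Qed.
Lemma cSk_inj k : injective (@cS d A k). Proof. by move=> ? ? []. Qed.
Lemma cXk_inj k : injective (@cX d A k). Proof. by move=> ? ? []. Qed.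
Lemma cYk_inj k : injective (@cY d A k). Proof. by move=> ? ? []. Qed.
Lemma cS_inj : injective (fun p => @cS d A p.1 p.2).
Proof. by move=> [? ?] [? ?] [-> ->]. Qed.
Lemma cX_inj : injective (fun p => @cX d A p.1 p.2).
Proof. by move=> [? ?] [? ?] [-> ->]. Qed.
Lemma cY_inj : injective (fun p => @cY d A p.1 p.2).
Proof. by move=> [? ?] [? ?] [-> ->]. Qed.
Lemma cO_inj : injective (@cO d A). Proof. by move=> ? ? []. Qed.
Lemma cQ_inj : injective (@cQ d A). Proof. by move=> ? ? []. Qed.
Lemma cZ_inj : injective (@cZ d A). Proof. by move=> ? ? []. Qed.
Lemma unit_inj (T : Type) (e : T) : injective (fun _ : unit => e).
Proof. by move=> [] []. Qed.

Definition toA f fi := @move 'I_d tA f tA_inj fi.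
Definition toR e := move tR_inj (@unit_inj _ e).
Definition toP m e := move (@at_key_inj _ m _ tP_inj) (@unit_inj _ e).
Definition toX f fi := @move ('I_A * 'I_d) tX f tX_inj fi.
Definition toY f fi := @move ('I_A * 'I_d) tY f tY_inj fi.
Definition toXk k f fi := @move 'I_d (at_row tX k) f (@at_row_inj _ k tX_inj) fi.
Definition toYk k f fi := @move 'I_d (at_row tY k) f (@at_row_inj _ k tY_inj) fi.
Definition toO f fi := @move 'I_A tO f tO_inj fi.
Definition toZ f fi := @move 'I_A tZ f tZ_inj fi.
Definition toOk k e := move (@at_key_inj _ k _ tO_inj) (@unit_inj _ e).
Definition toQk k e := move (@at_key_inj _ k _ tQ_inj) (@unit_inj _ e).
Definition toZk k e := move (@at_key_inj _ k _ tZ_inj) (@unit_inj _ e).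

End Moves.

Section Heads.
Context {R : realType} {d A : nat}.
Notation coord := (coord d A).
Notation pmove := (pmove d A).
Notation lin := (seq (R * pmove)).
Notation P0 := (@cP d A 0).
Notation P1 := (@cP d A 1).
Notation P2 := (@cP d A 2).
Implicit Types (u : nat -> coord -> R) (V : lin) (k : 'I_A).

Definition pos_ok u := forall i,
  [/\ u i P0 = i.+1%:R, u i P1 = i.+1%:R ^+ 2 & u i P2 = 1].

(** With 1-based positions, the score [1 + j - i] is bilinear: slot 0 of the position block holds
    the product [1 * (j + 1)], slot 1 the product [- i * 1]. *)
Definition one_minus_Q : lin := [:: (1, toP 0 P2); (-1, toP 1 P0)].
Definition one_minus_K : lin := [:: (1, toP 0 P0); (1, toP 0 P2); (1, toP 1 P2)].

(* The score is 1 on the diagonal and nonpositive below it. *)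
Definition avg_head V := SHead V one_minus_Q one_minus_K.

(* The score [i (j + 1) - i ^ 2] is [i] on the diagonal, which undoes the
   averaging, and nonpositive below it. *)
Definition local_head V :=
  SHead V [:: (1, toP 0 P0); (-1, toP 1 P1)] one_minus_K.

(* Adding [b (j - i)] to a score bounded by [b] keeps its diagonal only. *)
Definition prod_head (b : R) q r V := SHead V
  [:: (1, q); (b, toP 0 P2); (- b, toP 1 P0)]
  [:: (1, r); (1, toP 0 P0); (1, toP 1 P2)].

(** The sign [e] occurs in both the query and the values, so the heads for [1] and [-1] add up to
    [(relu s - relu (- s)) V = s V], with no rectification left. *)
Definition gram_head (e : R) q V1 :=
  SHead [seq (e * t.1, t.2) | t <- V1] [:: (e, q)] [:: (1, toA (@cA_inj d A))].

Lemma apE t V (f : coord -> R) c : ap (t :: V) f c = t.1 * ap1 t.2 f c + ap V f c.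
Proof. by rewrite /ap big_cons. Qed.

Lemma ap0 (f : coord -> R) c : ap [::] f c = 0.
Proof. by rewrite /ap big_nil. Qed.

(** All heads place their query-key products in the action block, the reward slot and the first two
    position slots, used as scratch space; elsewhere the products vanish. *)
Lemma sum_slots (F : coord -> R) :
  (forall k l, F (cS k l) = 0) -> (forall k, F (cO k) = 0) ->
  (forall k l, F (cX k l) = 0) -> (forall k l, F (cY k l) = 0) ->
  (forall k, F (cQ k) = 0) -> (forall k, F (cZ k) = 0) -> F P2 = 0 ->
  \sum_c F c = \sum_l F (cA l) + F cR + (F P0 + F P1).
Proof.
move=> hS hO hX hY hQ hZ hP; rewrite sum_coord.
rewrite !big_ord_recl big_ord0.
have -> : lift ord0 ord0 = 1 :> 'I_3 by apply: val_inj.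
have -> : lift ord0 (lift ord0 ord0) = 2 :> 'I_3 by apply: val_inj.
rewrite hP !addr0 (eq_bigr _ (fun k _ => eq_bigr _ (fun l _ => hS k l))).
rewrite (eq_bigr _ (fun k _ => hO k)) (eq_bigr _ (fun k _ => hQ k)).
rewrite (eq_bigr _ (fun k _ => hZ k)).
rewrite (eq_bigr _ (fun k _ => eq_bigr _ (fun l _ => hX k l))).
rewrite (eq_bigr _ (fun k _ => eq_bigr _ (fun l _ => hY k l))).
have z1 : \sum_(k < A) \sum_(l < d) 0 = 0 :> R by rewrite big1 // => ? _; rewrite big1.
have z2 : \sum_(k < A) 0 = 0 :> R by rewrite big1.
by rewrite !(z1, z2) !add0r.
Qed.

Ltac zeros := move=> *; rewrite !(apE, ap0) /ap1 /=; ring.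

Lemma score_avg V f g : score (avg_head V) f g =
  f P2 * (g P0 + g P2) - f P0 * g P2.
Proof.
rewrite /score sum_slots; try zeros.
by rewrite big1 => [|l _]; zeros.
Qed.

Lemma score_local V f g : score (local_head V) f g =
  f P0 * (g P0 + g P2) - f P1 * g P2.
Proof.
rewrite /score sum_slots; try zeros.
by rewrite big1 => [|l _]; zeros.
Qed.

Lemma score_prodA b p p' (pi : injective p) (pi' : injective p') V f g :
  score (prod_head b (toA pi) (toA pi') V) f g =
  \sum_l f (p l) * g (p' l) + b * (f P2 * g P0 - f P0 * g P2).
Proof.
rewrite /score sum_slots; try zeros.
have -> : \sum_l f (p l) * g (p' l) = \sum_l
    ap (hQ (prod_head b (toA pi) (toA pi') V)) f (cA l) *
    ap (hK (prod_head b (toA pi) (toA pi') V)) g (cA l).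
  by apply: eq_bigr => l _; rewrite !(apE, ap0) /ap1 /=; ring.
by rewrite !(apE, ap0) /ap1 /=; ring.
Qed.

Lemma score_prodR b p p' V f g :
  score (prod_head b (toR p) (toR p') V) f g =
  f p * g p' + b * (f P2 * g P0 - f P0 * g P2).
Proof.
rewrite /score sum_slots; try zeros.
by rewrite big1 => [|l _]; zeros.
Qed.

Lemma score_gram e p (pi : injective p) V f g :
  score (gram_head e (toA pi) V) f g = e * \sum_l f (p l) * g (cA l).
Proof.
rewrite /score sum_slots; try zeros.
have -> : e * \sum_l f (p l) * g (cA l) = \sum_l
    ap (hQ (gram_head e (toA pi) V)) f (cA l) *
    ap (hK (gram_head e (toA pi) V)) g (cA l).
  by rewrite mulr_sumr; apply: eq_bigr => l _; rewrite !(apE, ap0) /ap1 /=; ring.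
by rewrite !(apE, ap0) /ap1 /=; ring.
Qed.

Lemma contrib_diag h u i c : (forall j, (j < i)%N -> score h (u i) (u j) <= 0) ->
  contrib h u i c = i.+1%:R^-1 * (relu (score h (u i) (u i)) * ap (hV h) (u i) c).
Proof.
move=> hs; rewrite /contrib big_ord_recr /= big1 ?add0r // => j _.
by rewrite relu_eq0 ?mul0r // hs.
Qed.

Lemma contrib_avg V u i c : pos_ok u ->
  contrib (avg_head V) u i c = i.+1%:R^-1 * ap V (u i) c.
Proof.
move=> pu; have [i0 _ i2] := pu i; rewrite contrib_diag => [|j ji].
  by rewrite score_avg i0 i2 relu_id; [congr (_ * _)|]; lra.
have [j0 _ j2] := pu j; rewrite score_avg i0 i2 j0 j2 mul1r mulr1.
by rewrite natr1 subr_le0 ler_nat ltnS.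
Qed.

Lemma contrib_local V u i c : pos_ok u ->
  contrib (local_head V) u i c = ap V (u i) c.
Proof.
move=> pu; have [i0 i1 i2] := pu i; rewrite contrib_diag => [|j ji].
  rewrite score_local i0 i1 i2 (_ : _ - _ = i.+1%:R); last by ring.
  by rewrite relu_id // mulrA mulVf ?mul1r // pnatr_eq0.
have [j0 _ j2] := pu j; rewrite score_local i0 i1 j0 j2 mulr1 natr1 expr2.
by rewrite subr_le0 ler_wpM2l // ler_nat ltnS.
Qed.

Lemma nat_lt_ler1 j i : (j < i)%N -> j.+1%:R - i.+1%:R <= -1 :> R.
Proof.
by move=> ji; rewrite lerBlDr addrC -lerBlDr opprK natr1 ler_nat ltnS.
Qed.

Lemma contrib_prodA b p p' (pi : injective p) (pi' : injective p') V u i c :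
  pos_ok u -> 0 <= b ->
  (forall j, (j < i)%N -> \sum_l u i (p l) * u j (p' l) <= b) ->
  contrib (prod_head b (toA pi) (toA pi') V) u i c =
  i.+1%:R^-1 * (relu (\sum_l u i (p l) * u i (p' l)) * ap V (u i) c).
Proof.
move=> pu b0 hb; have [i0 i1 i2] := pu i; rewrite contrib_diag => [|j ji].
  by rewrite score_prodA i0 i2 mul1r mulr1 subrr mulr0 addr0.
have [j0 _ j2] := pu j; rewrite score_prodA i0 i2 j0 j2 mul1r mulr1.
have := nat_lt_ler1 ji; have := hb _ ji; nra.
Qed.

Lemma contrib_prodR b p p' V u i c :
  pos_ok u -> 0 <= b ->
  (forall j, (j < i)%N -> u i p * u j p' <= b) ->
  contrib (prod_head b (toR p) (toR p') V) u i c =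
  i.+1%:R^-1 * (relu (u i p * u i p') * ap V (u i) c).
Proof.
move=> pu b0 hb; have [i0 i1 i2] := pu i; rewrite contrib_diag => [|j ji].
  by rewrite score_prodR i0 i2 mul1r mulr1 subrr mulr0 addr0.
have [j0 _ j2] := pu j; rewrite score_prodR i0 i2 j0 j2 mul1r mulr1.
have := nat_lt_ler1 ji; have := hb _ ji; nra.
Qed.

Lemma contrib_gram p (pi : injective p) V u i c :
  contrib (gram_head 1 (toA pi) V) u i c + contrib (gram_head (-1) (toA pi) V) u i c
  = i.+1%:R^-1 * \sum_(j < i.+1) (\sum_l u i (p l) * u j (cA l)) * ap V (u j) c.
Proof.
have apV e f : ap [seq (e * t.1, t.2) | t <- V] f c = e * ap V f c.
  by rewrite /ap big_map mulr_sumr; apply: eq_bigr => t _; rewrite mulrA.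
rewrite /contrib -mulrDr -big_split; congr (_ * _); apply: eq_bigr => j _ /=.
rewrite !score_gram !apV mul1r mul1r mulN1r mulN1r mulrN -mulrBl reluB.
by [].
Qed.

Lemma sum_heads (f : 'I_A -> shead) (F : @shead R d A -> R) :
  \sum_(h <- map f (enum 'I_A)) F h = \sum_k F (f k).
Proof. by rewrite big_map big_enum. Qed.

End Heads.

(** * The layers of the soft LinUCB transformer *)

Section Phases.
Context {R : realType} {d A : nat}.
Notation coord := (coord d A).
Notation lin := (seq (R * pmove d A)).
Variables (u0 : nat -> coord -> R) (lambda mu q : R).

Definition acts i : 'cV[R]_d := \col_l u0 i (cA l).
Definition rews i : R := u0 i cR.
Definition sts i k : 'cV[R]_d := \col_l u0 i (cS k l).

(* The attention average over the first [i.+1] tokens produces the Gram matrix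
   divided by [i.+1]. *)
Definition avg_gram i : 'M[R]_d := i.+1%:R^-1 *: gramv lambda acts i.+1.
Definition sol n i k := (agd (avg_gram i) (sts i k) mu q n).1.
Definition aux n i k := (agd (avg_gram i) (sts i k) mu q n).2.

Definition set_XY (f g : 'I_A -> 'cV[R]_d) (h : coord -> R) (c : coord) :=
  match c with
  | inr (inr (inr (inl (inl (k, l))))) => f k l 0
  | inr (inr (inr (inl (inr (inl (k, l)))))) => g k l 0
  | _ => h c
  end.

Definition set_O (f : 'I_A -> R) (h : coord -> R) (c : coord) :=
  if c is inr (inr (inl k)) then f k else h c.
Definition set_Q (f : 'I_A -> R) (h : coord -> R) (c : coord) :=
  if c is inr (inr (inr (inl (inr (inr (inl k)))))) then f k else h c.
Definition set_Z (f : 'I_A -> R) (h : coord -> R) (c : coord) :=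
  if c is inr (inr (inr (inl (inr (inr (inr k)))))) then f k else h c.

Definition st_agd n i := set_XY (sol n i) (aux n i) (u0 i).

Let eta := q ^+ 2 / mu.
Let beta := (1 - q) / (1 + q).

(** Increments of one descent step [x' = y - eta (G y - s)], [y' = (1 + beta) x' - beta x], split by
    origin: [agd_V] for the rank-one terms of [G y], [agd_ridge_V] for [lambda y / i], and
    [agd_local_V] for the rest. The term [- x] cancels the residual connection. *)
Definition agd_V k : lin := [:: (- eta, toXk k (@cA_inj d A));
                           (- ((1 + beta) * eta), toYk k (@cA_inj d A))].
Definition agd_ridge_V : lin := [:: (- (eta * lambda), toX (@cY_inj d A));
                              (- ((1 + beta) * eta * lambda), toY (@cY_inj d A))].
Definition agd_local_V : lin :=
  [:: (-1, toX (@cX_inj d A)); (1, toX (@cY_inj d A)); (eta, toX (@cS_inj d A));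
      (beta, toY (@cY_inj d A)); ((1 + beta) * eta, toY (@cS_inj d A));
      (- beta, toY (@cX_inj d A))].
Definition agd_heads : seq shead :=
  [seq gram_head 1 (toA (@cYk_inj d A k)) (agd_V k) | k <- enum 'I_A]
  ++ [seq gram_head (-1) (toA (@cYk_inj d A k)) (agd_V k) | k <- enum 'I_A]
  ++ [:: avg_head agd_ridge_V; local_head agd_local_V].

Hypothesis pos0 : pos_ok u0.

Lemma astep_agdE u i c : pos_ok u -> astep agd_heads u i c = u i c
  + (i.+1%:R^-1 * \sum_(j < i.+1) \sum_k
        (\sum_l u i (cY k l) * u j (cA l)) * ap (agd_V k) (u j) c
     + i.+1%:R^-1 * ap agd_ridge_V (u i) c + ap agd_local_V (u i) c).
Proof.
move=> pu; rewrite /astep /agd_heads !big_cat !sum_heads !big_cons big_nil /= addr0.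
rewrite contrib_avg // contrib_local // !addrA -[u i c + _ + _]addrA -big_split /=.
rewrite exchange_big [X in _ = _ + X + _ + _]mulr_sumr; congr (u i c + _ + _ + _).
by apply: eq_bigr => k _; rewrite contrib_gram.
Qed.

Lemma avg_gram_mul i (y : 'cV[R]_d) l : (avg_gram i *m y) l 0 =
  i.+1%:R^-1 * (lambda * y l 0 + \sum_(j < i.+1) dot (acts j) y * acts j l 0).
Proof.
rewrite -scalemxAl gramv_mul !mxE summxE; congr (_ * (_ + _)).
by apply: eq_bigr => j _; rewrite mxE.
Qed.

Lemma solS n i k l : sol n.+1 i k l 0 =
  aux n i k l 0 - eta * ((avg_gram i *m aux n i k) l 0 - u0 i (cS k l)).
Proof. by rewrite /sol /= !mxE. Qed.

Lemma auxS n i k l : aux n.+1 i k l 0 =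
  sol n.+1 i k l 0 + beta * (sol n.+1 i k l 0 - sol n i k l 0).
Proof. by rewrite /aux /= !mxE. Qed.

Lemma st_agd_step n i c : astep agd_heads (st_agd n) i c = st_agd n.+1 i c.
Proof.
rewrite astep_agdE; last by move=> j; exact: pos0.
have dotE k j : \sum_l st_agd n i (cY k l) * st_agd n j (cA l) = dot (acts j) (aux n i k).
  by apply: eq_bigr => l _; rewrite mxE mulrC.
under eq_bigr do under eq_bigr do rewrite dotE.
(* Gram heads write only to the blocks [x] and [y], and row [k0] receives from the heads of arm [k0]
   alone. *)
have zero (F : 'I_i.+1 -> 'I_A -> R) (G : 'I_i.+1 -> 'I_A -> R) : (forall j k, G j k = 0) ->
    \sum_(j < i.+1) \sum_k F j k * G j k = 0.
  by move=> h; rewrite big1 // => j _; rewrite big1 // => k _; rewrite h mulr0.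
have one (F : 'I_i.+1 -> 'I_A -> R) (G : 'I_i.+1 -> 'I_A -> R) (w : R) k0 (l : 'I_d) :
    (forall j k, G j k = if k0 == k then w * acts j l 0 else 0) ->
    \sum_(j < i.+1) \sum_k F j k * G j k = w * \sum_(j < i.+1) F j k0 * acts j l 0.
  move=> h; rewrite mulr_sumr; apply: eq_bigr => j _.
  rewrite (bigD1 k0) //= h eqxx big1 => [|k kk0]; first by rewrite addr0 mulrCA.
  by rewrite h eq_sym (negbTE kk0) mulr0.
elim/coordP: c => [l||k l|k|k l|k l|k|k|m];
  try by rewrite zero => [|j k'];
    rewrite !(apE, ap0) /ap1 /= /at_row /= ?(mulr0, addr0).
- rewrite (one _ _ (- eta) k l) => [|j k'].
    by rewrite [RHS]solS avg_gram_mul !(apE, ap0) /ap1 /=; ring.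
  rewrite !(apE, ap0) /ap1 /= /at_row /=.
  by case: (k == k') => /=; rewrite ?mxE; ring.
- rewrite (one _ _ (- ((1 + beta) * eta)) k l) => [|j k'].
    by rewrite [RHS]auxS solS avg_gram_mul !(apE, ap0) /ap1 /=; ring.
  rewrite !(apE, ap0) /ap1 /= /at_row /=.
  by case: (k == k') => /=; rewrite ?mxE; ring.
Qed.

Variables (n1 : nat) (bp : R).

(** A head can only deliver a rectified product. The exact value is nonnegative and [relu] is
    1-Lipschitz, so rectifying does not enlarge the error. *)
Definition quad i k : R := i.+1%:R^-1 * relu (dot (sol n1 i k) (sts i k)).
Definition lin_read i k : R :=
  i.+1%:R^-1 * \sum_(j < i.+1) dot (acts j) (sol n1 i k) * rews j.
Definition st_read i := set_O (lin_read i) (set_Q (quad i) (st_agd n1 i)).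

(** The product heads take the constant position coordinate as value, so they deposit their score
    alone, already divided by [i] as the width requires. *)
Definition read_heads : seq shead :=
  [seq gram_head 1 (toA (@cXk_inj d A k)) [:: (1, toOk k cR)] | k <- enum 'I_A]
  ++ [seq gram_head (-1) (toA (@cXk_inj d A k)) [:: (1, toOk k cR)] | k <- enum 'I_A]
  ++ [seq prod_head bp (toA (@cXk_inj d A k)) (toA (@cSk_inj d A k))
        [:: (1, toQk k (cP 2))] | k <- enum 'I_A].

Hypothesis O0 : forall i k, u0 i (cO k) = 0.
Hypothesis Q0 : forall i k, u0 i (cQ k) = 0.
Hypothesis Z0 : forall i k, u0 i (cZ k) = 0.

Lemma st_read_step i c : 0 <= bp ->
  (forall j k, (j < i)%N -> dot (sol n1 i k) (sts j k) <= bp) ->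
  astep read_heads (st_agd n1) i c = st_read i c.
Proof.
move=> bp0 hb; set u := st_agd n1.
have pu : pos_ok u by move=> j; exact: pos0.
have dotE k j : \sum_l u i (cX k l) * u j (cS k l) = dot (sol n1 i k) (sts j k).
  by apply: eq_bigr => l _; rewrite mxE.
have dotE' k j : \sum_l u i (cX k l) * u j (cA l) = dot (acts j) (sol n1 i k).
  by apply: eq_bigr => l _; rewrite mxE mulrC.
rewrite /astep /read_heads !big_cat !sum_heads /= addrA -big_split /=.
have -> : \sum_k contrib (prod_head bp (toA (@cXk_inj d A k)) (toA (@cSk_inj d A k))
        [:: (1, toQk k (cP 2))]) u i c =
    \sum_k i.+1%:R^-1 * (relu (dot (sol n1 i k) (sts i k))
        * ap [:: (1, toQk k (cP 2))] (u i) c).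
  apply: eq_bigr => k _; rewrite contrib_prodA ?dotE // => j ji.
  by rewrite dotE hb.
have -> : \sum_k (contrib (gram_head 1 (toA (@cXk_inj d A k)) [:: (1, toOk k cR)]) u i c
      + contrib (gram_head (-1) (toA (@cXk_inj d A k)) [:: (1, toOk k cR)]) u i c) =
    \sum_k i.+1%:R^-1 * \sum_(j < i.+1) dot (acts j) (sol n1 i k)
        * ap [:: (1, toOk k cR)] (u j) c.
  apply: eq_bigr => k _; rewrite contrib_gram; congr (_ * _).
  by apply: eq_bigr => j _; rewrite dotE'.
have [i0 i1 i2] := pu i.
have zQ : (forall k, ap [:: (1, toQk k (cP 2))] (u i) c = 0) ->
  \sum_k i.+1%:R^-1 * (relu (dot (sol n1 i k) (sts i k))
        * ap [:: (1, toQk k (cP 2))] (u i) c) = 0.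
  by move=> h; rewrite big1 // => k _; rewrite h !mulr0.
have zO : (forall k j, ap [:: (1, toOk k cR)] (u j) c = 0) ->
    \sum_k i.+1%:R^-1 * \sum_(j < i.+1) dot (acts j) (sol n1 i k)
        * ap [:: (1, toOk k cR)] (u j) c = 0.
  move=> h; rewrite big1 // => k _; rewrite big1 ?mulr0 // => j _.
  by rewrite h mulr0.
elim/coordP: c zQ zO => [l||k l|k|k l|k l|k|k|m] zQ zO;
  try by rewrite zQ ?zO => *; rewrite ?(apE, ap0) /ap1 /= /at_key /= ?(mulr0, addr0).
- rewrite zQ => [|k']; last by rewrite !(apE, ap0) /ap1 /= /at_key /= ?(mulr0, addr0).
  rewrite [u i _]O0 add0r addr0 (bigD1 k) //= [X in _ + X]big1 => [|k' kk']; last first.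
    rewrite big1 ?mulr0 // => j _; rewrite !(apE, ap0) /ap1 /= /at_key /=.
    by rewrite eq_sym (negbTE kk') /= !(mulr0, addr0).
  rewrite addr0 /lin_read; congr (_ * _); apply: eq_bigr => j _; congr (_ * _).
  by rewrite !(apE, ap0) /ap1 /= /at_key /= eqxx /= mul1r addr0.
- rewrite zO => [|k' j]; last by rewrite !(apE, ap0) /ap1 /= /at_key /= ?(mulr0, addr0).
  rewrite [u i _]Q0 !add0r (bigD1 k) //= big1 => [|k' kk']; last first.
    rewrite !(apE, ap0) /ap1 /= /at_key /=.
    by rewrite eq_sym (negbTE kk') /= !(mulr0, addr0).
  rewrite addr0 /quad; congr (_ * _).
  have -> : ap [:: (1, toQk k (cP 2))] (u i) (cQ k) = 1.
    by rewrite !(apE, ap0) /ap1 /= /at_key /= eqxx /= mul1r addr0; exact: i2.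
  by rewrite mulr1.
Qed.

Variables (cz bz : R).

Definition st_sqrt n i := set_Z (fun k => sqrt_iter cz (quad i k) n) (st_read i).

Definition sqrt_V : lin := [:: (cz, toZ (@cQ_inj d A))].
(** The value of a product head is the position [i] times [- cz], which cancels the averaging by
    [1 / i]. Its score is a square on the diagonal, so [relu] leaves it unchanged. *)
Definition sqrt_heads : seq shead :=
  [seq prod_head bz (toR (cZ k)) (toR (cZ k)) [:: (- cz, toZk k (cP 0))] | k <- enum 'I_A]
  ++ [:: local_head sqrt_V].

Lemma st_sqrt0 i c : st_sqrt 0 i c = st_read i c.
Proof. by elim/coordP: c => // k; rewrite [RHS]Z0. Qed.

Lemma st_sqrt_step n i c : 0 <= bz ->
  (forall j k, (j < i)%N ->
    sqrt_iter cz (quad i k) n * sqrt_iter cz (quad j k) n <= bz) ->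
  astep sqrt_heads (st_sqrt n) i c = st_sqrt n.+1 i c.
Proof.
move=> bz0 hb; set u := st_sqrt n.
have pu : pos_ok u by move=> j; exact: pos0.
rewrite /astep /sqrt_heads big_cat sum_heads big_cons big_nil /= addr0 contrib_local //.
have -> : \sum_k contrib (prod_head bz (toR (cZ k)) (toR (cZ k))
        [:: (- cz, toZk k (cP 0))]) u i c =
    \sum_k i.+1%:R^-1 * (u i (cZ k) ^+ 2 * ap [:: (- cz, toZk k (cP 0))] (u i) c).
  apply: eq_bigr => k _; rewrite contrib_prodR //; last by move=> j ji; exact: hb.
  by rewrite -expr2 relu_id // sqr_ge0.
have [i0 i1 i2] := pu i.
have zZ : (forall k, ap [:: (- cz, toZk k (cP 0))] (u i) c = 0) ->
    \sum_k i.+1%:R^-1 * (u i (cZ k) ^+ 2 * ap [:: (- cz, toZk k (cP 0))] (u i) c) = 0.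
  by move=> h; rewrite big1 // => k _; rewrite h !mulr0.
elim/coordP: c zZ => [l||k l|k|k l|k l|k|k|m] zZ;
  try by rewrite zZ => *; rewrite !(apE, ap0) /ap1 /= /at_key /= ?(mulr0, addr0).
rewrite (bigD1 k) //= big1 => [|k' kk']; last first.
  rewrite !(apE, ap0) /ap1 /= /at_key /=.
  by rewrite eq_sym (negbTE kk') /= !(mulr0, addr0).
rewrite !(apE, ap0) /ap1 /= /at_key /= eqxx /=.
have -> : u0 i (cP 0) = i.+1%:R by exact: i0.
by field; rewrite ?nat1r ?pnatr_eq0 // addrC natr1 pnatr_eq0.
Qed.

Variables (n2 : nat) (alpha tau : R).

Definition st_out i := set_O (fun k =>
    lin_read i k / tau + alpha / tau * sqrt_iter cz (quad i k) n2) (st_sqrt n2 i).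

(** The residual connection already contributes the linear reading once, hence [tau^-1 - 1]. *)
Definition out_V : lin := [:: (tau^-1 - 1, toO (@cO_inj d A)); (alpha / tau, toO (@cZ_inj d A))].
Definition out_heads : seq shead := [:: local_head out_V].

Lemma st_out_step i c : astep out_heads (st_sqrt n2) i c = st_out i c.
Proof.
have pu : pos_ok (st_sqrt n2) by move=> j; exact: pos0.
rewrite /astep /out_heads big_cons big_nil /= addr0 contrib_local //.
elim/coordP: c => [l||k l|k|k l|k l|k|k|m];
  rewrite !(apE, ap0) /ap1 /= ?(mulr0, addr0) //.
ring.
Qed.

End Phases.

(** * The initial tokens and sums over them *)

Section Prompt.
Context {R : realType} {d A : nat}.
Variables (D : seq (round R d A)) (s : 'M[R]_(d, A)).

Definition prompt i (c : coord d A) : R := token (pad_len d A) D s i (enc c) 0.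

Lemma token_matrix_tokmx :
  token_matrix (pad_len d A) D s = tokmx (size D).*2.+1 prompt.
Proof. by apply/matrixP => c i; rewrite !mxE /prompt decK. Qed.

Definition nth_round i := nth (Round 0 0 0) D i./2.
Definition nth_state i : 'M[R]_(d, A) :=
  nth 0 (rcons [seq rd_state x | x <- D] s) i./2.

Ltac prompt_tac := rewrite /prompt /token; case: ifP => _;
  rewrite /action_token /state_token /enc /=
    ?(col_mxEu, col_mxEd) ?mxvecE ?mxE.

Lemma prompt_A i l : prompt i (cA l) = if odd i then rd_action (nth_round i) l 0 else 0.
Proof. by prompt_tac. Qed.

Lemma prompt_R i : prompt i cR = if odd i then rd_reward (nth_round i) else 0.
Proof. by prompt_tac; rewrite ?eqxx ?mulr1n. Qed.

Lemma prompt_S i k l : prompt i (cS k l) = if odd i then 0 else nth_state i l k.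
Proof. by prompt_tac => //; rewrite mxvecE mxE. Qed.

Lemma prompt_O i k : prompt i (cO k) = 0. Proof. by prompt_tac. Qed.
Lemma prompt_X i k l : prompt i (cX k l) = 0. Proof. by prompt_tac. Qed.
Lemma prompt_Y i k l : prompt i (cY k l) = 0. Proof. by prompt_tac. Qed.
Lemma prompt_Q i k : prompt i (cQ k) = 0. Proof. by prompt_tac. Qed.
Lemma prompt_Z i k : prompt i (cZ k) = 0. Proof. by prompt_tac. Qed.

Lemma prompt_P i m : prompt i (cP m) = [:: i.+1%:R; i.+1%:R ^+ 2; 1]`_m.
Proof. by prompt_tac. Qed.

Lemma prompt_pos_ok : pos_ok prompt.
Proof. by move=> i; rewrite !prompt_P. Qed.

Variables (b rb : R).
Hypothesis b0 : 0 <= b.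
Hypothesis rb0 : 0 <= rb.
Hypothesis D_ok : forall n, (n < size D)%N -> let x := nth (Round 0 0 0) D n in
  [/\ forall k, norm2 (col k (rd_state x)) <= b, norm2 (rd_action x) <= b
    & `|rd_reward x| <= rb].
Hypothesis s_ok : forall k, norm2 (col k s) <= b.

(** Valid at every index: even tokens hold no action, and past the data the default round is
    zero. *)
Lemma norm_acts i : norm2 (acts prompt i) <= b.
Proof.
have [oi|oi] := boolP (odd i); last first.
  suff -> : acts prompt i = 0 by rewrite norm2_0.
  by apply/colP => l; rewrite !mxE prompt_A (negbTE oi).
have -> : acts prompt i = rd_action (nth_round i).
  by apply/colP => l; rewrite !mxE prompt_A oi.
rewrite /nth_round; have [h|h] := ltnP i./2 (size D); first by have [] := D_ok h.
by rewrite nth_default //= norm2_0.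
Qed.

Lemma norm_rews i : `|rews prompt i| <= rb.
Proof.
rewrite /rews prompt_R; case: ifP => _; last by rewrite normr0.
rewrite /nth_round; have [h|h] := ltnP i./2 (size D); first by have [] := D_ok h.
by rewrite nth_default //= normr0.
Qed.

Lemma norm_sts i k : norm2 (sts prompt i k) <= b.
Proof.
have [oi|oi] := boolP (odd i).
  suff -> : sts prompt i k = 0 by rewrite norm2_0.
  by apply/colP => l; rewrite !mxE prompt_S oi.
have -> : sts prompt i k = col k (nth_state i).
  by apply/colP => l; rewrite !mxE prompt_S (negbTE oi).
rewrite /nth_state nth_rcons size_map; case: ltnP => h.
  by rewrite (nth_map (Round 0 0 0)) //; have [] := D_ok h.
by case: eqP => _; rewrite ?s_ok // col0 norm2_0.
Qed.

Lemma sts_last k : sts prompt (size D).*2 k = col k s.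
Proof.
apply/colP => l; rewrite !mxE prompt_S odd_double /nth_state doubleK.
by rewrite nth_rcons size_map ltnn eqxx.
Qed.

(** With 0-based indices, state tokens are even and the action of round [m] sits at [2 m + 1]; the
    last token is a state and adds nothing. *)
Lemma sum_tokens (V : nmodType) (F : nat -> V) n : (forall m, F m.*2 = 0) ->
  \sum_(j < n.*2.+1) F j = \sum_(m < n) F m.*2.+1.
Proof.
move=> F0; elim: n => [|n IH]; first by rewrite big_ord1 big_ord0 (F0 0%N).
rewrite doubleS big_ord_recr big_ord_recr /= IH -doubleS F0 addr0.
by rewrite big_ord_recr.
Qed.

Lemma acts_even m : acts prompt m.*2 = 0.
Proof. by apply/colP => l; rewrite !mxE prompt_A odd_double. Qed.

Lemma acts_odd m : acts prompt m.*2.+1 = rd_action (nth (Round 0 0 0) D m).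
Proof.
by apply/colP => l; rewrite !mxE prompt_A /= odd_double /= /nth_round /= uphalf_double.
Qed.

Lemma gramv_prompt lambda : gramv lambda (acts prompt) (size D).*2.+1 = gram lambda D.
Proof.
rewrite /gramv /gram (big_nth (Round 0 0 0)) big_mkord.
rewrite (sum_tokens (F := fun j => acts prompt j *m (acts prompt j)^T)) => [|m].
  by congr (_ + _); apply: eq_bigr => m _; rewrite acts_odd.
by rewrite acts_even mul0mx.
Qed.

Lemma sum_prompt (x : 'cV[R]_d) :
  \sum_(j < (size D).*2.+1) dot (acts prompt j) x * rews prompt j =
  \sum_(y <- D) rd_reward y * dot (rd_action y) x.
Proof.
rewrite (sum_tokens (F := fun j => dot (acts prompt j) x * rews prompt j)) => [|m].
  rewrite (big_nth (Round 0 0 0)) big_mkord; apply: eq_bigr => m _.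
  by rewrite acts_odd /rews prompt_R /= odd_double /= /nth_round /= uphalf_double mulrC.
by rewrite acts_even dot0l mul0r.
Qed.

End Prompt.

(** * Stacking the layers *)

Section Composition.
Context {R : realType} {d A : nat}.
Notation coord := (coord d A).

Lemma size_heads (T : Type) (f : 'I_A -> T) : size [seq f k | k <- enum 'I_A] = A.
Proof. by rewrite size_map size_enum_ord. Qed.

Lemma size_agd_heads (lambda mu q : R) : (0 < A)%N ->
  (size (@agd_heads R d A lambda mu q) <= 4 * A)%N.
Proof. by move=> A0; rewrite /agd_heads !(size_cat, size_heads) /=; lia. Qed.

Lemma size_read_heads (bp : R) : (size (@read_heads R d A bp) <= 4 * A)%N.
Proof. by rewrite /read_heads !(size_cat, size_heads); lia. Qed.

Lemma size_sqrt_heads (cz bz : R) : (0 < A)%N ->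
  (size (@sqrt_heads R d A cz bz) <= 4 * A)%N.
Proof. by move=> A0; rewrite /sqrt_heads !(size_cat, size_heads) /=; lia. Qed.

Lemma size_out_heads (alpha tau : R) : (0 < A)%N ->
  (size (@out_heads R d A alpha tau) <= 4 * A)%N.
Proof. by move=> A0; rewrite /=; lia. Qed.

Lemma transformer_tokmx N (u v : nat -> coord -> R) (hs : seq shead) r b :
  (size hs <= 4 * A)%N ->
  (forall i c, (i < N)%N -> astep hs u i c = v i c) ->
  (forall i c, (i < N)%N -> `|v i c| <= b) -> (tdim d A)%:R * b <= r ->
  clip r (mlp (layer_W1 (layer_of hs)) (layer_W2 (layer_of hs))
    (attn (layer_heads (layer_of hs)) (tokmx N u))) = tokmx N v.
Proof.
move=> hM uv vb br; rewrite (@layer_tokmx _ _ _ _ _ _ _ b) //.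
  by apply/matrixP => c i; rewrite !mxE uv.
by move=> i c iN; rewrite uv // vb.
Qed.

Lemma foldl_nseq (S T : Type) (f : S -> T -> S) (v : nat -> S) t n :
  (forall m, (m < n)%N -> f (v m) t = v m.+1) -> foldl f (v 0%N) (nseq n t) = v n.
Proof.
elim: n v => //= n IH v h; rewrite h // (IH (fun m => v m.+1)) // => m mn.
exact: h.
Qed.

Lemma eq_tokmx N (u v : nat -> coord -> R) :
  (forall i c, (i < N)%N -> u i c = v i c) -> tokmx N u = tokmx N v.
Proof. by move=> uv; apply/matrixP => c i; rewrite !mxE uv. Qed.

Lemma extract_tokmx N (u : nat -> coord -> R) k :
  extract (col ord_max (tokmx N.+1 u) : 'cV_(token_dim d A (pad_len d A))) k 0
  = u N (cO k).
Proof. by rewrite !mxE -[cO k]encK. Qed.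

Variables (lambda mu q bp cz bz alpha tau : R) (n1 n2 : nat).

Definition ucb_layers : seq (tf_layer R (tdim d A) (4 * A) 0) :=
  nseq n1 (layer_of (agd_heads lambda mu q)) ++
  layer_of (read_heads bp) ::
  nseq n2 (layer_of (sqrt_heads cz bz)) ++
  [:: layer_of (out_heads alpha tau)].

Lemma size_ucb_layers : size ucb_layers = (n1 + n2 + 2)%N.
Proof. by rewrite !(size_cat, size_nseq) /= !(size_cat, size_nseq) /=; lia. Qed.

Variables (N : nat) (u0 : nat -> coord -> R) (r b : R).
Hypothesis A0 : (0 < A)%N.
Hypothesis pos0 : pos_ok u0.
Hypothesis O0 : forall i k, u0 i (cO k) = 0.
Hypothesis X0 : forall i k l, u0 i (cX k l) = 0.
Hypothesis Y0 : forall i k l, u0 i (cY k l) = 0.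
Hypothesis Q0 : forall i k, u0 i (cQ k) = 0.
Hypothesis Z0 : forall i k, u0 i (cZ k) = 0.
Hypothesis bp0 : 0 <= bp.
Hypothesis bz0 : 0 <= bz.
Hypothesis br : (tdim d A)%:R * b <= r.
Notation sol := (sol u0 lambda mu q).
Notation aux := (aux u0 lambda mu q).
Notation quad := (quad u0 lambda mu q n1).
Notation lin_read := (lin_read u0 lambda mu q n1).
Hypothesis u0b : forall i c, (i < N)%N -> `|u0 i c| <= b.
Hypothesis solb : forall n i k, (i < N)%N -> norm2 (sol n i k) <= b.
Hypothesis auxb : forall n i k, (i < N)%N -> norm2 (aux n i k) <= b.
Hypothesis readb : forall i j k, (i < N)%N -> (j < i)%N ->
  dot (sol n1 i k) (sts u0 j k) <= bp.
Hypothesis quadb : forall i k, (i < N)%N -> `|quad i k| <= b.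
Hypothesis lin_readb : forall i k, (i < N)%N -> `|lin_read i k| <= b.
Hypothesis sqrtb : forall n i k, (i < N)%N -> `|sqrt_iter cz (quad i k) n| <= b.
Hypothesis sqrtz : forall n i j k, (i < N)%N -> (j < i)%N ->
  sqrt_iter cz (quad i k) n * sqrt_iter cz (quad j k) n <= bz.
Hypothesis outb : forall i k, (i < N)%N ->
  `|lin_read i k / tau + alpha / tau * sqrt_iter cz (quad i k) n2| <= b.

(** The bounds by [b] make every clipping step the identity, while [readb] and [sqrtz] provide the
    margins that silence the product heads off the diagonal. *)
Lemma transformer_ucb (theta : seq (tf_layer R (tdim d A) (4 * A) 0)) :
  theta = ucb_layers ->
  foldl (fun G l => clip r (mlp (layer_W1 l) (layer_W2 l) (attn (layer_heads l) G)))
    (clip r (tokmx N u0)) theta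
  = tokmx N (st_out u0 lambda mu q n1 cz n2 alpha tau).
Proof.
move=> ->; have b_agd n i c : (i < N)%N -> `|st_agd u0 lambda mu q n i c| <= b.
  move=> iN; elim/coordP: c => [l||k l|k|k l|k l|k|k|m] /=; try exact: u0b.
    by apply: le_trans (norm_coord_le _ _) (solb n k iN).
  by apply: le_trans (norm_coord_le _ _) (auxb n k iN).
have b_read i c : (i < N)%N -> `|st_read u0 lambda mu q n1 i c| <= b.
  move=> iN; move: (b_agd n1 i c iN).
  elim/coordP: c => [l||k l|k|k l|k l|k|k|m] //= _.
    exact: lin_readb.
  exact: quadb.
have b_sqrt n i c : (i < N)%N -> `|st_sqrt u0 lambda mu q n1 cz n i c| <= b.
  move=> iN; move: (b_read i c iN).
  elim/coordP: c => [l||k l|k|k l|k l|k|k|m] //= _.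
  exact: sqrtb.
have b_out i c : (i < N)%N -> `|st_out u0 lambda mu q n1 cz n2 alpha tau i c| <= b.
  move=> iN; move: (b_sqrt n2 i c iN).
  elim/coordP: c => [l||k l|k|k l|k l|k|k|m] //= _.
  exact: outb.
rewrite (@clip_tokmx _ _ _ _ _ _ b) //.
(* The zero padding is the starting point [x = y = 0] of the descent. *)
have -> : tokmx N u0 = tokmx N (st_agd u0 lambda mu q 0).
  apply: eq_tokmx => i c _.
  by elim/coordP: c => [l||k l|k|k l|k l|k|k|m] //=; rewrite mxE ?X0 ?Y0.
rewrite /ucb_layers foldl_cat.
rewrite (foldl_nseq (v := fun n => tokmx N (st_agd u0 lambda mu q n))) /=; last first.
  move=> n _; apply: (@transformer_tokmx _ _ _ _ _ b) => //.
    exact: size_agd_heads.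
  by move=> i c _; apply: st_agd_step.
  by move=> i c; apply: b_agd.
rewrite (@transformer_tokmx N _ (st_read u0 lambda mu q n1) _ _ b) //; first last.
- by move=> i c iN; apply: st_read_step => // j k ji; apply: readb.
- exact: size_read_heads.
have -> : tokmx N (st_read u0 lambda mu q n1) = tokmx N (st_sqrt u0 lambda mu q n1 cz 0).
  by apply: eq_tokmx => i c _; rewrite st_sqrt0.
rewrite foldl_cat.
rewrite (foldl_nseq (v := fun n => tokmx N (st_sqrt u0 lambda mu q n1 cz n))) /=; last first.
  move=> n _; apply: (@transformer_tokmx _ _ _ _ _ b) => //.
    exact: size_sqrt_heads.
  by move=> i c iN; apply: st_sqrt_step => // j k ji; apply: sqrtz.
  by move=> i c; apply: b_sqrt.
apply: (@transformer_tokmx _ _ _ _ _ b) => //.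
  exact: size_out_heads.
by move=> i c iN; apply: st_out_step.
Qed.

End Composition.

(** * Accuracy *)

Section Accuracy.
Context {R : realType} {d A : nat}.
Variables (u0 : nat -> coord d A -> R) (lambda mu q Ba rb : R) (N : nat).
Hypothesis l0 : 0 < lambda.
Hypothesis mu0 : 0 < mu.
Hypothesis q0 : 0 < q.
Hypothesis q1 : q < 1.
Hypothesis muN : N%:R * mu <= lambda.
Hypothesis smooth : lambda + Ba ^+ 2 <= mu / q ^+ 2.
Hypothesis Ba0 : 0 <= Ba.
Hypothesis rb0 : 0 <= rb.
Hypothesis actB : forall i, norm2 (acts u0 i) <= Ba.
Hypothesis rewB : forall i, `|rews u0 i| <= rb.
Hypothesis stB : forall i k, norm2 (sts u0 i k) <= Ba.

Notation gramN i := (gramv lambda (acts u0) i.+1).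
Notation G := (avg_gram u0 lambda).
Notation sol := (sol u0 lambda mu q).
Notation aux := (aux u0 lambda mu q).

Definition inv_st i k : 'cV[R]_d := invmx (gramN i) *m sts u0 i k.
Definition fixpt i k : 'cV[R]_d := i.+1%:R *: inv_st i k.

Let i1_gt0 i : 0 < i.+1%:R^-1 :> R.
Proof. by rewrite invr_gt0 ltr0n. Qed.

Lemma avg_gram_sym i u v : dot (G i *m u) v = dot u (G i *m v).
Proof. by rewrite -!scalemxAl dotZl dotZr dot_gramv_sym. Qed.

Lemma avg_gram_lb i v : (i < N)%N -> mu * dot v v <= dot v (G i *m v).
Proof.
move=> iN; rewrite -scalemxAl dotZr ler_pdivlMl ?ltr0n // mulrA.
apply: le_trans (gramv_lb _ _ _ _); rewrite ler_wpM2r ?dot_ge0 //.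
by apply: le_trans muN; rewrite ler_wpM2r ?(ltW mu0) // ler_nat.
Qed.

(** Averaging keeps the largest eigenvalue below [lambda / i + Ba ^ 2], uniformly in the position,
    so one step size serves all tokens. *)
Lemma avg_gram_ub i v : dot v (G i *m v) <= mu / q ^+ 2 * dot v v.
Proof.
rewrite -scalemxAl dotZr ler_pdivrMl ?ltr0n // mulrA.
apply: (le_trans (@gramv_ub _ _ _ _ _ _ Ba _)) => //.
rewrite ler_wpM2r ?dot_ge0 //.
have i1 : 1 <= i.+1%:R :> R by rewrite ler1n.
apply: (@le_trans _ _ (i.+1%:R * (lambda + Ba ^+ 2))); last by rewrite ler_wpM2l.
by rewrite mulrDr lerD2r ler_peMl // ltW.
Qed.

Lemma fixptP i k : G i *m fixpt i k = sts u0 i k.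
Proof.
rewrite /fixpt -scalemxAl -scalemxAr scalerA mulVf ?pnatr_eq0 // scale1r.
exact: gramv_invK.
Qed.

Lemma dist_agd n i k (D := 2 * (Ba / mu) ^+ 2 * (1 - q) ^+ n) : (i < N)%N ->
  norm2 (sol n i k - fixpt i k) ^+ 2 <= D /\ norm2 (aux n i k - fixpt i k) ^+ 2 <= D.
Proof.
move=> iN; apply: agd_dist => //.
- exact: avg_gram_sym.
- by move=> v; apply: avg_gram_lb.
- exact: avg_gram_ub.
- exact: fixptP.
Qed.

Lemma norm_fixpt i k : (i < N)%N -> norm2 (fixpt i k) <= Ba / mu.
Proof.
move=> iN; apply: (@norm_sol_le _ _ (G i) (sts u0 i k)) => //.
  by move=> v; apply: avg_gram_lb.
exact: fixptP.
Qed.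

(** The convergence bound never exceeds [2 * B ^+ 2], so the distance stays below [2 * B] at any
    step [n], converged or not. *)
Lemma norm_near (x y : 'cV[R]_d) B n : 0 <= B ->
  norm2 (x - y) ^+ 2 <= 2 * B ^+ 2 * (1 - q) ^+ n -> norm2 y <= B -> norm2 x <= 3 * B.
Proof.
move=> B0 h yB; have -> : x = (x - y) + y by rewrite subrK.
apply: le_trans (norm2D _ _) _.
suff : norm2 (x - y) <= 2 * B by lra.
rewrite -ler_sqr ?nnegrE ?norm2_ge0 ?mulr_ge0 //; apply: le_trans h _.
have : (1 - q) ^+ n <= 1 by rewrite exprn_ile1 // ?subr_ge0 ?(ltW q1) // gerBl ltW.
have := sqr_ge0 B; nra.
Qed.

Let Bmu0 : 0 <= Ba / mu. Proof. by rewrite divr_ge0 // ltW. Qed.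

Lemma norm_sol n i k : (i < N)%N -> norm2 (sol n i k) <= 3 * (Ba / mu).
Proof. by move=> iN; apply: norm_near (norm_fixpt k iN) => //; exact: (dist_agd n k iN).1. Qed.

Lemma norm_aux n i k : (i < N)%N -> norm2 (aux n i k) <= 3 * (Ba / mu).
Proof. by move=> iN; apply: norm_near (norm_fixpt k iN) => //; exact: (dist_agd n k iN).2. Qed.

Variables (n1 : nat) (delta : R).
Hypothesis delta0 : 0 <= delta.
Hypothesis n1_large : 2 * (Ba / mu) ^+ 2 * (1 - q) ^+ n1 <= delta ^+ 2.
Notation quad := (quad u0 lambda mu q n1).
Notation lin_read := (lin_read u0 lambda mu q n1).

Lemma dist_sol i k : (i < N)%N -> norm2 (sol n1 i k - fixpt i k) <= delta.
Proof.
move=> iN; rewrite -ler_sqr ?nnegrE ?norm2_ge0 //.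
by apply: le_trans n1_large; exact: (dist_agd n1 k iN).1.
Qed.

Definition quad0 i k : R := dot (sts u0 i k) (inv_st i k).

Lemma quad0_ge0 i k : 0 <= quad0 i k.
Proof. exact: dot_inv_ge0. Qed.

Lemma quad0_le i k : quad0 i k <= Ba ^+ 2 / lambda.
Proof.
apply: le_trans (dot_inv_ub _ l0 _ _) _; rewrite ler_wpM2r ?invr_ge0 ?(ltW l0) //.
by rewrite ler_sqr ?nnegrE ?norm2_ge0.
Qed.

Lemma dist_quad i k : (i < N)%N -> `|quad i k - quad0 i k| <= Ba * delta.
Proof.
move=> iN.
have -> : quad0 i k = i.+1%:R^-1 * relu (dot (fixpt i k) (sts u0 i k)).
  rewrite dotZl (dotC (inv_st i k)) -/(quad0 i k) relu_id ?mulr_ge0 ?quad0_ge0 //.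
  by rewrite mulrA mulVf ?mul1r // pnatr_eq0.
rewrite -mulrBr normrM ger0_norm ?(ltW (i1_gt0 i)) //.
apply: (@le_trans _ _ (1 * (Ba * delta))); last by rewrite mul1r.
rewrite ler_pM ?(ltW (i1_gt0 i)) // ?invf_le1 ?ler1n ?ltr0n //.
apply: le_trans (norm_sub_relu _ _) _; rewrite -dotBl.
apply: le_trans (norm_dot_le _ _) _; rewrite mulrC ler_pM ?norm2_ge0 ?dist_sol //.
Qed.

Lemma avg_sum_le i (F : nat -> R) b : (forall j, `|F j| <= b) ->
  `|i.+1%:R^-1 * \sum_(j < i.+1) F j| <= b.
Proof.
move=> Fb; rewrite normrM ger0_norm ?(ltW (i1_gt0 i)) // mulrC ler_pdivrMr ?ltr0n //.
apply: le_trans (ler_norm_sum _ _ _) _.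
apply: le_trans (ler_sum _ (fun j _ => Fb (nat_of_ord j))) _.
by rewrite sumr_const card_ord mulr_natr.
Qed.

Lemma lin_read_le i k : (i < N)%N -> `|lin_read i k| <= Ba * (3 * (Ba / mu)) * rb.
Proof.
move=> iN; apply: (@avg_sum_le _ (fun j => dot (acts u0 j) (sol n1 i k) * rews u0 j)).
move=> j; rewrite normrM ler_pM //; apply: le_trans (norm_dot_le _ _) _.
by rewrite ler_pM ?norm2_ge0 ?norm_sol.
Qed.

Lemma dist_lin_read i k : (i < N)%N ->
  `|lin_read i k - \sum_(j < i.+1) dot (acts u0 j) (inv_st i k) * rews u0 j|
  <= Ba * delta * rb.
Proof.
move=> iN; have -> : \sum_(j < i.+1) dot (acts u0 j) (inv_st i k) * rews u0 j =
    i.+1%:R^-1 * \sum_(j < i.+1) dot (acts u0 j) (fixpt i k) * rews u0 j.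
  rewrite mulr_sumr; apply: eq_bigr => j _.
  by rewrite dotZr !mulrA mulVf ?mul1r // pnatr_eq0.
rewrite -mulrBr -sumrB.
apply: (@avg_sum_le _ (fun j => dot (acts u0 j) (sol n1 i k) * rews u0 j
  - dot (acts u0 j) (fixpt i k) * rews u0 j)) => j.
rewrite -mulrBl -dotBr normrM ler_pM //; apply: le_trans (norm_dot_le _ _) _.
by rewrite ler_pM ?norm2_ge0 ?dist_sol.
Qed.

Hypothesis delta1 : Ba * delta <= 1.
Notation h := (Ba ^+ 2 / lambda + 2).

Lemma quad_ge0 i k : 0 <= quad i k.
Proof. by rewrite mulr_ge0 ?relu_ge0 // ltW. Qed.

Lemma quad_le i k : (i < N)%N -> quad i k <= h.
Proof.
move=> iN; have := dist_quad k iN; have := quad0_le i k.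
by move: delta1; rewrite ler_norml; lra.
Qed.

Lemma sqrt_le1D (x : R) : 0 <= x -> Num.sqrt x <= 1 + x.
Proof.
move=> x0; rewrite -ler_sqr ?nnegrE ?sqrtr_ge0 ?addr_ge0 // sqr_sqrtr //.
have := sqr_ge0 x; nra.
Qed.

(** The 2 in [width_max] is made here: one unit for the error on the square, one from
    [sqrt x <= 1 + x]. *)
Lemma sqrt_quad_le i k : (i < N)%N -> Num.sqrt (quad i k) <= h.
Proof.
move=> iN; apply: le_trans (sqrt_le1D (quad_ge0 _ _)) _.
have := dist_quad k iN; have := quad0_le i k.
by move: delta1; rewrite ler_norml; lra.
Qed.

Let h0 : 0 < h.
Proof. by rewrite ltr_wpDl // divr_ge0 ?sqr_ge0 // ltW. Qed.
Notation cz := ((2 * h)^-1).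

Lemma sqrt_iter_quad n i k (s := Num.sqrt (quad i k)) : (i < N)%N ->
  0 <= s - sqrt_iter cz (quad i k) n <= (1 - cz * s) ^+ n * s
  /\ 0 <= sqrt_iter cz (quad i k) n.
Proof.
move=> iN; apply: sqrt_iter_bound; first by rewrite invr_ge0 mulr_ge0 // ltW.
  exact: quad_ge0.
rewrite invfM mulrA divff // mul1r mulrC ler_pdivrMr // mul1r.
exact: sqrt_quad_le.
Qed.

Lemma sqrt_iter_le n i k : (i < N)%N -> 0 <= sqrt_iter cz (quad i k) n <= h.
Proof.
move=> iN; have [/andP[s1 _] ->] := sqrt_iter_quad n k iN.
by have := sqrt_quad_le k iN; lra.
Qed.

Variable smin : R.
Hypothesis smin0 : 0 < smin.
Hypothesis delta_smin : 2 * (Ba * delta) <= smin ^+ 2.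

(** The first term perturbs the root, through [s ^ 2 - t ^ 2 = (s - t) (s + t)] with [smin <= t];
    the second is the unfinished recursion. [delta_smin] ensures that the perturbed root is still at
    least [smin / 2], which gives the rate. *)
Lemma dist_sqrt n i k : (i < N)%N -> smin ^+ 2 <= quad0 i k ->
  `|sqrt_iter cz (quad i k) n - Num.sqrt (quad0 i k)|
  <= Ba * delta / smin + (1 - cz * (smin / 2)) ^+ n * h.
Proof.
move=> iN qmin; have [/andP[s1 s2] _] := sqrt_iter_quad n k iN.
have sh := sqrt_quad_le k iN; have dq := dist_quad k iN.
set s := Num.sqrt (quad i k) in s1 s2 sh *; set t := Num.sqrt (quad0 i k).
have sE : s ^+ 2 = quad i k by rewrite sqr_sqrtr ?quad_ge0.
have tE : t ^+ 2 = quad0 i k by rewrite sqr_sqrtr ?quad0_ge0.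
have s0 : 0 <= s by exact: sqrtr_ge0.
have t0 : 0 <= t by exact: sqrtr_ge0.
have tmin : smin <= t by rewrite -ler_sqr ?nnegrE ?(ltW smin0) // tE.
have smin_s : smin / 2 <= s.
  rewrite -ler_sqr ?nnegrE ?divr_ge0 ?(ltW smin0) // sE expr_div_n.
  by move: dq qmin delta_smin; rewrite ler_norml; nra.
have d1 : `|s - t| <= Ba * delta / smin.
  rewrite ler_pdivlMr //; apply: le_trans dq.
  have -> : quad i k - quad0 i k = (s - t) * (s + t) by rewrite -sE -tE; ring.
  rewrite normrM ler_wpM2l // ger0_norm ?addr_ge0 //; lra.
have d2 : s - sqrt_iter cz (quad i k) n <= (1 - cz * (smin / 2)) ^+ n * h.
  apply: le_trans s2 _; apply: ler_pM => //.
    rewrite exprn_ge0 // subr_ge0 mulrC ler_pdivrMr ?mulr_gt0 // mul1r.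
    by move: sh h0; lra.
  apply: lerXn2r; rewrite ?nnegrE ?subr_ge0.
  - rewrite mulrC ler_pdivrMr ?mulr_gt0 // mul1r; by move: sh h0; lra.
  - rewrite mulrC ler_pdivrMr ?mulr_gt0 // mul1r; by move: sh h0; lra.
  by rewrite lerD2l lerN2 ler_wpM2l // invr_ge0 mulr_ge0 // ltW.
by move: d1 d2 s1; rewrite !ler_norml; lra.
Qed.

End Accuracy.

(** * Size and norm *)

Lemma agd_weights_le (R : realType) (x1 x2 e b x3 : R) :
  x2 <= 1 -> x1 <= 2 -> e <= 1 -> b <= 1 -> x3 <= 2 ->
  x2 + x1 + (1 + (1 + (e + (b + (x3 + b))))) <= 10 + 3.
Proof. by move=> *; lra. Qed.

Lemma momentum_weights (R : realType) (b e l : R) :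
  0 <= l -> 0 <= e -> 0 <= b -> b <= 1 -> e <= 1 -> l * e <= 1 ->
  [/\ (1 + b) * e <= 2, 0 <= (1 + b) * e, (1 + b) * e * l <= 2
    & 0 <= (1 + b) * e * l].
Proof.
move=> l0 e0 b0 b1 e1 le1; have le0 : 0 <= l * e by rewrite mulr_ge0.
by split; nra.
Qed.

Section NormBound.
Context {R : realType} {d A : nat}.
Notation lin := (seq (R * pmove d A)).
Variables (lambda mu q bp cz bz alpha tau : R) (n1 n2 : nat).
Hypothesis A0 : (0 < A)%N.
Hypothesis l0 : 0 < lambda.
Hypothesis q0 : 0 < q.
Hypothesis q1 : q < 1.
Hypothesis mu0 : 0 < mu.
Hypothesis eta1 : (1 + lambda) * (q ^+ 2 / mu) <= 1.
Hypothesis bp0 : 0 <= bp.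
Hypothesis bz0 : 0 <= bz.
Hypothesis cz0 : 0 <= cz.
Hypothesis alpha0 : 0 <= alpha.
Hypothesis tau0 : 0 < tau.
Hypothesis tau1 : tau < 1.

Lemma wtE (w : R) m (ts : lin) : wt ((w, m) :: ts) = `|w| + wt ts.
Proof. by rewrite /wt big_cons. Qed.

Lemma wt0 : wt ([::] : lin) = 0.
Proof. by rewrite /wt big_nil. Qed.

Lemma bigmax_cat_le (T : Type) (F : T -> R) s1 s2 b :
  \big[Num.max/0]_(x <- s1) F x <= b -> \big[Num.max/0]_(x <- s2) F x <= b ->
  \big[Num.max/0]_(x <- s1 ++ s2) F x <= b.
Proof.
elim: s1 => //= x s1 IH; rewrite !big_cons !ge_max => /andP[-> h1] h2 /=.
exact: IH.
Qed.

Lemma bigmax_nseq_le (T : Type) (F : T -> R) x n b : 0 <= b -> F x <= b ->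
  \big[Num.max/0]_(y <- nseq n x) F y <= b.
Proof.
by move=> b0 Fx; elim: n => [|n IH] /=; rewrite ?big_nil // big_cons ge_max Fx.
Qed.

Lemma bigmax_heads_le (f : 'I_A -> @shead R d A) (F : shead -> R) b :
  0 <= b -> (forall k, F (f k) <= b) ->
  \big[Num.max/0]_(x <- [seq f k | k <- enum 'I_A]) F x <= b.
Proof. by move=> b0 h; rewrite big_map; apply: bigmax_le. Qed.

Lemma sum_heads_const (f : 'I_A -> @shead R d A) (F : shead -> R) b :
  (forall k, F (f k) <= b) ->
  \sum_(x <- [seq f k | k <- enum 'I_A]) F x <= A%:R * b.
Proof.
move=> h; rewrite sum_heads; apply: le_trans (ler_sum _ (fun k _ => h k)) _.
by rewrite sumr_const card_ord mulr_natl.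
Qed.

Lemma layer_norm_split hs b v : (size hs <= 4 * A)%N ->
  \big[Num.max/0]_(h <- hs) Num.max (wt (hQ h)) (wt (hK h)) <= b ->
  \sum_(h <- hs) wt (hV h) <= v -> layer_norm (@layer_of R d A hs) <= b + v.
Proof. by move=> hM hb hv; apply: le_trans (layer_norm_le hM) _; rewrite lerD. Qed.

Let eta0 : 0 < q ^+ 2 / mu. Proof. by rewrite divr_gt0 ?exprn_gt0. Qed.
Let beta0 : 0 <= (1 - q) / (1 + q).
Proof. by rewrite divr_ge0 ?subr_ge0 ?addr_ge0 ?(ltW q0) ?(ltW q1). Qed.
Let beta1 : (1 - q) / (1 + q) <= 1.
Proof. by rewrite ler_pdivrMr ?addr_gt0 //; have := q0; lra. Qed.

Lemma agd_layer_norm : layer_norm (layer_of (@agd_heads R d A lambda mu q)) <= 22 * A%:R.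
Proof.
have A1 : 1 <= A%:R :> R by rewrite ler1n.
have e0 := eta0; have be0 := beta0; have be1 := beta1.
have e1 : q ^+ 2 / mu <= 1 by apply: le_trans eta1; rewrite ler_peMl ?(ltW e0) // lerDl ltW.
have le1 : lambda * (q ^+ 2 / mu) <= 1 by move: eta1; rewrite mulrDl; lra.
have le0 : 0 <= lambda * (q ^+ 2 / mu) by rewrite mulr_ge0 ?(ltW l0) ?(ltW e0).
have [bee bee0 beel beel0] : [/\ (1 + (1 - q) / (1 + q)) * (q ^+ 2 / mu) <= 2,
    0 <= (1 + (1 - q) / (1 + q)) * (q ^+ 2 / mu),
    (1 + (1 - q) / (1 + q)) * (q ^+ 2 / mu) * lambda <= 2 &
    0 <= (1 + (1 - q) / (1 + q)) * (q ^+ 2 / mu) * lambda].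
  exact: momentum_weights (ltW l0) (ltW e0) be0 be1 e1 le1.
(* Queries and keys weigh at most 3, each of the [2 A] gram heads has values of weight at most
   [1 + 2], and 13 is ample for the two other heads. *)
apply: le_trans (@layer_norm_split _ 3 (A%:R * 3 + (A%:R * 3 + (3 + 10))) _ _ _) _.
- exact: size_agd_heads.
- rewrite /agd_heads; do ?[apply: bigmax_cat_le].
  + apply: bigmax_heads_le => // k; rewrite /= !(wtE, wt0) !normr1 !addr0 maxxx; lra.
  + apply: bigmax_heads_le => // k; rewrite /= !(wtE, wt0) !normrN !normr1 !addr0 maxxx; lra.
  rewrite !big_cons big_nil /= !(wtE, wt0) !normrN !normr1 !ge_max.
  by do ?[apply/andP; split]; lra.
- rewrite /agd_heads !big_cat /=.
  have gram_le (x : R) : x = 1 \/ x = -1 -> forall k,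
      wt (hV (gram_head x (toA (@cYk_inj d A k)) (agd_V mu q k))) <= 3.
    move=> x1 k; rewrite /= !(wtE, wt0) /= !normrM !normrN addr0.
    have -> : `|x| = 1 by case: x1 => ->; rewrite ?normrN normr1.
    rewrite !mul1r (ger0_norm bee0) (ger0_norm (ltW e0)).
    by apply: le_trans (lerD e1 bee) _; lra.
  apply: lerD; first by apply: sum_heads_const; apply: gram_le; left.
  apply: lerD; first by apply: sum_heads_const; apply: gram_le; right.
  rewrite !big_cons big_nil /= !(wtE, wt0) !normrN !normr1.
  rewrite (ger0_norm bee0) (ger0_norm beel0) (ger0_norm (ltW e0)) (ger0_norm be0).
  rewrite [_ / mu * lambda]mulrC (ger0_norm le0).
  by rewrite !addr0 [X in _ <= X]addrC; apply: agd_weights_le.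
by lra.
Qed.

Lemma read_layer_norm : layer_norm (layer_of (@read_heads R d A bp))
  <= 4 + 2 * bp + 3 * A%:R.
Proof.
apply: le_trans (@layer_norm_split _ (3 + 2 * bp) (A%:R * 1 + (A%:R * 1 + A%:R * 1)) _ _ _) _.
- exact: size_read_heads.
- rewrite /read_heads; do ?[apply: bigmax_cat_le]; apply: bigmax_heads_le => [|k];
    rewrite /= ?(wtE, wt0) ?normrN ?normr1 ?(ger0_norm bp0) ?ge_max;
    try (apply/andP; split); move: bp0; lra.
- rewrite /read_heads !big_cat /=.
  by do ?[apply: lerD]; apply: sum_heads_const => k;
    rewrite /= !(wtE, wt0) /= ?mul1r ?mulN1r ?normrN !normr1 addr0.
by lra.
Qed.

Lemma sqrt_layer_norm : layer_norm (layer_of (@sqrt_heads R d A cz bz))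
  <= 4 + 2 * bz + (A%:R + 1) * cz.
Proof.
apply: le_trans (@layer_norm_split _ (4 + 2 * bz) (A%:R * cz + cz) _ _ _) _.
- exact: size_sqrt_heads.
- rewrite /sqrt_heads; apply: bigmax_cat_le.
    apply: bigmax_heads_le => [|k];
    rewrite /= ?(wtE, wt0) ?normrN ?normr1 ?(ger0_norm bz0) ?ge_max;
    try (apply/andP; split); move: bz0; lra.
  rewrite !big_cons big_nil /= !(wtE, wt0) !normrN !normr1 !ge_max.
  by move: bz0 => bz0'; do ?[apply/andP; split]; lra.
- rewrite /sqrt_heads big_cat /=; apply: lerD.
    by apply: sum_heads_const => k; rewrite /= !(wtE, wt0) normrN ger0_norm ?addr0.
  by rewrite big_cons big_nil /= !(wtE, wt0) ger0_norm ?addr0.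
by lra.
Qed.

Lemma out_layer_norm : layer_norm (layer_of (@out_heads R d A alpha tau))
  <= 3 + tau^-1 + alpha / tau.
Proof.
have t1 : 1 <= tau^-1 by rewrite invf_ge1 // ltW.
apply: le_trans (@layer_norm_split _ 3 (tau^-1 - 1 + alpha / tau) _ _ _) _.
- exact: size_out_heads.
- rewrite big_cons big_nil /= !(wtE, wt0) !normrN !normr1 !ge_max.
  by do ?[apply/andP; split]; lra.
- rewrite big_cons big_nil /= !(wtE, wt0) !ger0_norm ?addr0 ?subr_ge0 //.
  by rewrite divr_ge0 // ltW.
by lra.
Qed.

Lemma ucb_layers_norm b : 22 * A%:R <= b -> 4 + 2 * bp + 3 * A%:R <= b ->
  4 + 2 * bz + (A%:R + 1) * cz <= b -> 3 + tau^-1 + alpha / tau <= b ->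
  \big[Num.max/0]_(l <- @ucb_layers R d A lambda mu q bp cz bz alpha tau n1 n2)
    layer_norm l <= b.
Proof.
move=> b1 b2 b3 b4; have b0 : 0 <= b by apply: le_trans b1; rewrite mulr_ge0.
have r1 := le_trans agd_layer_norm b1; have r2 := le_trans read_layer_norm b2.
have r3 := le_trans sqrt_layer_norm b3; have r4 := le_trans out_layer_norm b4.
apply: bigmax_cat_le; first exact: bigmax_nseq_le.
rewrite big_cons ge_max r2 /=; apply: bigmax_cat_le; first exact: bigmax_nseq_le.
by rewrite big_cons big_nil ge_max r4.
Qed.

End NormBound.

(** * Choice of the parameters *)

Section Arithmetic.
Context {R : realType}.
Implicit Types x y W S : R.

(** From [1 - x <= expR (- x)]: a rate [x] reaches accuracy [(W ^+ m)^-1] after [m ln W / x]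
    steps. *)
Lemma geometric_le x W m n : 0 <= x <= 1 -> 0 < W ->
  m%:R * ln W <= x * n%:R -> (1 - x) ^+ n <= (W ^+ m)^-1.
Proof.
move=> /andP[x0 x1] W0 h.
have WE : W ^+ m = expR (m%:R * ln W) by rewrite mulr_natl -lnXn // lnK // posrE exprn_gt0.
rewrite WE -expRN; apply: (@le_trans _ _ (expR (- (x * n%:R)))); last first.
  by rewrite ler_expR lerN2.
rewrite mulrC -mulrN expRM_natl.
by apply: lerXn2r; rewrite ?nnegrE ?subr_ge0 ?expR_ge0 // expR_ge1Dx.
Qed.

Lemma nat_ceil x : 0 <= x -> exists n : nat, x <= n%:R <= x + 1.
Proof.
move=> x0; exists (Num.truncn x).+1; have /andP[h1 h2] := truncn_itv x0.
by rewrite (ltW h2) /= -natr1 lerD2r.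
Qed.

Lemma le_mulX x y W i j : 0 <= x <= W ^+ i -> 0 <= y <= W ^+ j ->
  0 <= x * y <= W ^+ (i + j).
Proof.
by move=> /andP[x0 x1] /andP[y0 y1]; rewrite mulr_ge0 //= exprD ler_pM.
Qed.

Lemma smoothness_le (l B S : R) : 0 < l -> 0 < B -> 1 + l + B <= S ->
  1 + l + B ^+ 2 <= S ^+ 2.
Proof.
move=> l0 B0 h; apply: (@le_trans _ _ ((1 + l + B) ^+ 2)); first by nra.
by rewrite ler_sqr ?nnegrE; lra.
Qed.

End Arithmetic.

(** * The reference magnitudes and the confidence radius *)

Section Scale.
Context {R : realType}.
Variables (T d A : nat) (sigma ba Ba Bw lambda eps tau : R).
Hypothesis T0 : (0 < T)%N.
Hypothesis d0 : (0 < d)%N.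
Hypothesis A0 : (0 < A)%N.
Hypothesis sigma0 : 0 < sigma.
Hypothesis ba0 : 0 < ba.
Hypothesis Ba0 : 0 < Ba.
Hypothesis Bw0 : 0 < Bw.
Hypothesis lambda0 : 0 < lambda.
Hypothesis eps01 : 0 < eps < 1.
Hypothesis tau01 : 0 < tau < 1.

Definition scale : R := 1 + sigma + ba^-1 + Ba + Bw + lambda + lambda^-1.
Definition log_scale : R :=
  1 + ln T%:R + ln A%:R + ln d%:R + ln eps^-1 + ln tau^-1.
(* Every quantity of the construction is bounded by a fixed power of this
   number, whose logarithm is a soft-O factor. *)
Definition big_scale : R := 8 * scale * (T%:R * A%:R * d%:R * eps^-1 * tau^-1).
Notation S := scale.
Notation W := big_scale.

Lemma scale_bounds : [/\ 1 <= S, ba^-1 <= S, lambda^-1 <= S, Ba <= S &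
  Ba * Bw + sigma <= S ^+ 2 /\ 1 + lambda + Ba ^+ 2 <= S ^+ 2].
Proof.
have bi : 0 < ba^-1 by rewrite invr_gt0.
have li : 0 < lambda^-1 by rewrite invr_gt0.
have := sigma0; have := Ba0; have := Bw0; have := lambda0; rewrite /scale => h1 h2 h3 h4.
split; [lra|lra|lra|lra|split].
  apply: (@le_trans _ _ ((1 + sigma + Ba + Bw) ^+ 2)); first by nra.
  by rewrite ler_sqr ?nnegrE; lra.
by apply: smoothness_le => //; lra.
Qed.

Lemma inv_ge1 (x : R) : 0 < x < 1 -> 1 <= x^-1.
Proof. by move=> /andP[x0 x1]; rewrite invf_ge1 // ltW. Qed.

Lemma big_scale_bounds : [/\ 8 <= W, 8 * S * T%:R <= W, 8 * eps^-1 <= W,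
  8 * tau^-1 <= W & 8 * (d%:R * A%:R) <= W].
Proof.
have [S1 _ _ _ _] := scale_bounds.
have T1 : 1 <= T%:R :> R by rewrite ler1n.
have A1 : 1 <= A%:R :> R by rewrite ler1n.
have d1 : 1 <= d%:R :> R by rewrite ler1n.
have e1 := inv_ge1 eps01; have t1 := inv_ge1 tau01.
have m1 (x y : R) : 1 <= x -> 1 <= y -> 1 <= x * y by move=> *; rewrite mulr_ege1.
have p (x y : R) : 0 <= x -> 1 <= y -> x <= x * y by move=> *; rewrite ler_peMr.
have g (x : R) : 1 <= x -> 0 <= x by apply: le_trans.
have WE (x y : R) : W = 8 * (x * y) -> 1 <= x -> 1 <= y -> 8 * x <= W.
  by move=> -> x1 y1; rewrite ler_wpM2l // p // g.
split.
- by rewrite -[leLHS]mulr1; apply: (@WE _ (S * (T%:R * A%:R * d%:R * eps^-1 * tau^-1)));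
    rewrite ?m1 //; rewrite /W; ring.
- by rewrite -mulrA; apply: (@WE _ (A%:R * d%:R * eps^-1 * tau^-1));
    rewrite ?m1 //; rewrite /W; ring.
- by apply: (@WE _ (S * (T%:R * A%:R * d%:R * tau^-1)));
    rewrite ?m1 //; rewrite /W; ring.
- by apply: (@WE _ (S * (T%:R * A%:R * d%:R * eps^-1)));
    rewrite ?m1 //; rewrite /W; ring.
by apply: (@WE _ (S * (T%:R * eps^-1 * tau^-1)));
    rewrite ?m1 //; rewrite /W; ring.
Qed.

Lemma log_scale_ge1 : 1 <= log_scale.
Proof.
have e1 := inv_ge1 eps01; have t1 := inv_ge1 tau01.
by rewrite /log_scale -!addrA lerDl !addr_ge0 // ln_ge0 // ler1n.
Qed.

(** The logarithm turns the product into [log_scale - 1] plus [ln 8 + ln S], which [ln x < x] bounds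
    by [8 + S]. *)
Lemma ln_big_scale : 0 <= ln W <= 9 * S * log_scale.
Proof.
have [S1 _ _ _ _] := scale_bounds; have [W8 _ _ _ _] := big_scale_bounds.
have L1 := log_scale_ge1.
rewrite ln_ge0 /=; last by apply: le_trans W8; rewrite ler1n.
have S0 : 0 < S by apply: lt_le_trans S1.
have Tp : 0 < T%:R :> R by rewrite ltr0n.
have Ap : 0 < A%:R :> R by rewrite ltr0n.
have dp : 0 < d%:R :> R by rewrite ltr0n.
have ep : 0 < eps^-1 by apply: lt_le_trans (inv_ge1 eps01).
have tp : 0 < tau^-1 by apply: lt_le_trans (inv_ge1 tau01).
have -> : ln W = ln 8 + ln S + (log_scale - 1).
  rewrite /W !lnM ?posrE ?mulr_gt0 // /log_scale; ring.
have h1 := ln_sublinear S0; have h2 : ln (8 : R) < 8 by apply: ln_sublinear.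
by move: h1 h2 S1 L1; move: (ln S) (ln 8) S log_scale => *; nra.
Qed.

Lemma sqrtT_le : 1 <= Num.sqrt (T%:R : R) <= T%:R.
Proof.
have T1 : 1 <= T%:R :> R by rewrite ler1n.
apply/andP; split; first by rewrite -[leLHS]sqrtr1 ler_wsqrtr.
rewrite -ler_sqr ?nnegrE ?sqrtr_ge0 // sqr_sqrtr // expr2 ler_peMr //.
Qed.

Notation alpha := (@ucb_alpha R d T sigma Ba Bw lambda).

(** [ln (1 + x) <= x] cancels the factor [d] of the log-determinant term. Linear growth in [T] is
    affordable because the norm budget contains [T / tau]. *)
Lemma ucb_alpha_bound : 0 <= alpha <= 7 * S ^+ 4 * T%:R.
Proof.
rewrite /ucb_alpha; set X := _ + d%:R * _.
have Tp : 0 < T%:R :> R by rewrite ltr0n.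
have T1 : 1 <= T%:R :> R by rewrite ler1n.
have dp : 0 < d%:R :> R by rewrite ltr0n.
have [S1 _ li BS _] := scale_bounds.
have bi : 0 < ba^-1 by rewrite invr_gt0.
have li0 : 0 < lambda^-1 by rewrite invr_gt0.
have lS : 1 + lambda <= S by have := sigma0; have := Ba0; have := Bw0; rewrite /scale; lra.
have sS : sigma <= S by have := lambda0; have := Ba0; have := Bw0; rewrite /scale; lra.
have wS : Bw <= S by have := lambda0; have := Ba0; have := sigma0; rewrite /scale; lra.
have S0 : 0 <= S by apply: le_trans S1.
have S2 : 1 <= S ^+ 2 by rewrite exprn_ege1.
rewrite addr_ge0 ?mulr_ge0 ?sqrtr_ge0 ?(ltW sigma0) ?(ltW Bw0) //=.
have XB : X <= 5 * S ^+ 3 * T%:R.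
  have l1 : ln (2 * Ba * Bw * T%:R) <= 2 * Ba * Bw * T%:R.
    by apply/ltW/ln_sublinear; rewrite !mulr_gt0.
  have l2 : d%:R * ln ((d%:R * lambda + T%:R * Ba ^+ 2) / (d%:R * lambda))
      <= T%:R * Ba ^+ 2 * lambda^-1.
    have y0 : 0 <= T%:R * Ba ^+ 2 / (d%:R * lambda).
      by rewrite divr_ge0 ?mulr_ge0 ?sqr_ge0 // ltW // mulr_gt0.
    rewrite mulrDl divff ?gt_eqF ?mulr_gt0 //.
    apply: (@le_trans _ _ (d%:R * (T%:R * Ba ^+ 2 / (d%:R * lambda)))).
      by rewrite ler_wpM2l // le_ln1Dx // (lt_le_trans _ y0) // ltrN10.
    by rewrite le_eqVlt; apply/orP; left; apply/eqP; field; rewrite !gt_eqF.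
  have m1 : Ba * Bw <= S ^+ 2 by rewrite expr2 ler_pM // ltW.
  have m2 : Ba ^+ 2 <= S ^+ 2 by rewrite ler_sqr ?nnegrE // ltW.
  have m3 : Ba ^+ 2 * lambda^-1 <= S ^+ 3 by rewrite [S ^+ 3]exprSr ler_pM ?sqr_ge0 // ltW.
  have m4 : S ^+ 2 <= S ^+ 3 by rewrite [leRHS]exprSr ler_peMr ?sqr_ge0.
  have k1 : T%:R * Ba ^+ 2 * lambda^-1 <= S ^+ 3 * T%:R.
    by rewrite -mulrA [leLHS]mulrC; apply: ler_wpM2r.
  have k2 : 2 * Ba * Bw * T%:R <= 2 * (S ^+ 3 * T%:R).
    rewrite -[2 * Ba * Bw]mulrA -[leLHS]mulrA; apply: ler_wpM2l => //.
    by apply: ler_wpM2r => //; apply: le_trans m1 m4.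
  have l3 := le_trans l1 k2; have l4 := le_trans l2 k1.
  by apply: le_trans (lerD (ler_wpM2l (ler0n _ 2) l3) l4) _; rewrite -mulrA; lra.
have sX : Num.sqrt X <= 6 * S ^+ 3 * T%:R.
  have Y0 : 0 <= 5 * S ^+ 3 * T%:R by rewrite !mulr_ge0 // exprn_ge0.
  apply: le_trans (ler_wsqrtr XB) (le_trans (sqrt_le1D Y0) _).
  have : 1 <= S ^+ 3 * T%:R by rewrite mulr_ege1 // exprn_ege1.
  by rewrite -!mulrA; lra.
have sl : Num.sqrt lambda <= S by apply: le_trans (sqrt_le1D (ltW lambda0)) lS.
have t1 : Num.sqrt lambda * Bw <= S ^+ 2 by rewrite expr2 ler_pM ?sqrtr_ge0 // ltW.
have t2 : sigma * Num.sqrt X <= S * (6 * S ^+ 3 * T%:R).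
  by rewrite ler_pM ?sqrtr_ge0 // ltW.
have t3 : S ^+ 2 <= S ^+ 4 * T%:R.
  by rewrite -[leLHS]mulr1 ler_pM ?sqr_ge0 // ler_weXn2l.
have -> : 7 * S ^+ 4 * T%:R = S ^+ 4 * T%:R + S * (6 * S ^+ 3 * T%:R) by ring.
by rewrite lerD // (le_trans t1).
Qed.

End Scale.

(** * Step sizes, rates and extreme widths *)

Section Constants.
Context {R : realType}.
Variables (T d A : nat) (sigma ba Ba Bw lambda eps tau : R).
Hypothesis T0 : (0 < T)%N.
Hypothesis d0 : (0 < d)%N.
Hypothesis A0 : (0 < A)%N.
Hypothesis sigma0 : 0 < sigma.
Hypothesis ba0 : 0 < ba.
Hypothesis Ba0 : 0 < Ba.
Hypothesis Bw0 : 0 < Bw.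
Hypothesis lambda0 : 0 < lambda.
Hypothesis eps01 : 0 < eps < 1.
Hypothesis tau01 : 0 < tau < 1.

Notation S := (scale sigma ba Ba Bw lambda).
Notation W := (big_scale T d A sigma ba Ba Bw lambda eps tau).
Notation alpha := (@ucb_alpha R d T sigma Ba Bw lambda).

(** The added unit makes the step [1 / smoothness] at most [1 / (1 + lambda)], which bounds the
    weights [eta] and [eta * lambda] of the descent layers. *)
Definition smoothness : R := 1 + lambda + Ba ^+ 2.
(** Averaging divides [lambda] by at most the prompt length, and [2 T + 1 <= 3 T]. *)
Definition convexity : R := lambda / (3 * T%:R).
Definition rate : R := Num.sqrt (convexity / smoothness).
Definition width_max : R := Ba ^+ 2 / lambda + 2.
Definition width_min : R := ba / (2 * smoothness * Num.sqrt T%:R).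
Definition width_step : R := (2 * width_max)^-1.
Definition reward_max : R := Ba * Bw + sigma.
Definition read_margin : R := Ba * (3 * (Ba / convexity)).

Notation Ls := smoothness.
Notation mu := convexity.
Notation q := rate.
Notation h := width_max.
Notation smin := width_min.
Notation cz := width_step.
Notation rb := reward_max.

Let Tp : 0 < T%:R :> R. Proof. by rewrite ltr0n. Qed.
Let T1 : 1 <= T%:R :> R. Proof. by rewrite ler1n. Qed.
Let S1 : 1 <= S. Proof. by have [] := scale_bounds sigma0 ba0 Ba0 Bw0 lambda0. Qed.
Let S0 : 0 <= S. Proof. exact: le_trans ler01 S1. Qed.
Let W8 : 8 <= W.
Proof. by have [] := big_scale_bounds T0 d0 A0 sigma0 ba0 Ba0 Bw0 lambda0 eps01 tau01. Qed.
Let W0 : 0 < W. Proof. by apply: lt_le_trans W8. Qed.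
Let W1 : 1 <= W. Proof. by apply: le_trans W8; rewrite ler1n. Qed.
Let Wge0 : 0 <= W. Proof. exact: ltW. Qed.
Let tau0 : 0 < tau. Proof. by case/andP: tau01. Qed.
Let eps0 : 0 < eps. Proof. by case/andP: eps01. Qed.

Let STW : 8 * S * T%:R <= W.
Proof. by have [] := big_scale_bounds T0 d0 A0 sigma0 ba0 Ba0 Bw0 lambda0 eps01 tau01. Qed.

Let SW : 8 * S <= W.
Proof. by apply: le_trans STW; rewrite ler_peMr // mulr_ge0. Qed.

Let SW1 : S <= W.
Proof. by have := SW; have := S0; lra. Qed.

Let XW i j : (i <= j)%N -> W ^+ i <= W ^+ j.
Proof. by move=> ij; rewrite ler_weXn2l. Qed.

Lemma smoothness_bound : [/\ 1 <= Ls, Ls <= S ^+ 2 & lambda + Ba ^+ 2 <= Ls].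
Proof.
have [_ _ _ _ [_ ->]] := scale_bounds sigma0 ba0 Ba0 Bw0 lambda0.
by rewrite /Ls -addrA lerDl lerDr ler01 addr_ge0 ?sqr_ge0 // ltW.
Qed.

Let Ls0 : 0 < Ls. Proof. by have [h1 _ _] := smoothness_bound; apply: lt_le_trans h1. Qed.

Lemma convexity_gt0 : 0 < mu.
Proof. by rewrite divr_gt0 ?mulr_gt0. Qed.

Lemma rate_sqr : q ^+ 2 = mu / Ls.
Proof. by rewrite sqr_sqrtr // divr_ge0 ?ltW ?convexity_gt0. Qed.

Lemma rate_gt0 : 0 < q.
Proof. by rewrite sqrtr_gt0 divr_gt0 ?convexity_gt0. Qed.

Lemma rate_lt1 : q < 1.
Proof.
rewrite -ltr_sqr ?nnegrE ?ltW ?rate_gt0 ?ltr01 // rate_sqr expr1n.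
rewrite ltr_pdivrMr // mul1r; apply: (@le_lt_trans _ _ lambda).
  rewrite /mu ler_pdivrMr ?mulr_gt0 // ler_peMr ?(ltW lambda0) //.
  by rewrite mulr_ege1 // ler1n.
by rewrite /Ls addrAC -addrA ltr_pwDl // lerDr ?sqr_ge0.
Qed.

Lemma step_le1 : (1 + lambda) * (q ^+ 2 / mu) <= 1.
Proof.
rewrite rate_sqr mulrAC divff ?gt_eqF ?convexity_gt0 // mul1r ler_pdivrMr // mul1r.
by rewrite lerDl sqr_ge0.
Qed.

Lemma smooth_rate : lambda + Ba ^+ 2 <= mu / q ^+ 2.
Proof.
rewrite rate_sqr invfM invrK mulrA divff ?gt_eqF ?convexity_gt0 // mul1r.
by have [] := smoothness_bound.
Qed.

(** The inverse rate is the square root of the condition number [3 T * smoothness / lambda]: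
    acceleration is what makes the depth of order [sqrt T]. *)
Lemma rate_inv : q^-1 <= 4 * S ^+ 3 * Num.sqrt T%:R.
Proof.
have [_ LsS _] := smoothness_bound.
have [_ _ liS _ _] := scale_bounds sigma0 ba0 Ba0 Bw0 lambda0.
have li0 : 0 < lambda^-1 by rewrite invr_gt0.
have e : q^-1 = Num.sqrt T%:R * Num.sqrt (3 * Ls * lambda^-1).
  rewrite -sqrtrM ?(ltW Tp) // /q -sqrtrV; last by rewrite divr_ge0 ?ltW ?convexity_gt0.
  by congr (Num.sqrt _); rewrite /mu; field; rewrite !gt_eqF.
rewrite e mulrC ler_wpM2r ?sqrtr_ge0 //.
have y0 : 0 <= 3 * Ls * lambda^-1 by rewrite !mulr_ge0 // ltW.
apply: le_trans (sqrt_le1D y0) _.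
have S3 : 1 <= S ^+ 3 by rewrite exprn_ege1.
have : Ls * lambda^-1 <= S ^+ 3 by rewrite [S ^+ 3]exprSr ler_pM // ltW.
by rewrite -mulrA; lra.
Qed.

Lemma Ba_convexity : 0 <= Ba / mu <= 3 * T%:R * S ^+ 2.
Proof.
have [_ _ liS BaS _] := scale_bounds sigma0 ba0 Ba0 Bw0 lambda0.
have m0 := ltW convexity_gt0; have l0 := ltW lambda0.
rewrite divr_ge0 ?(ltW Ba0) //=.
have -> : Ba / mu = 3 * T%:R * (Ba * lambda^-1) by rewrite /mu; field; rewrite !gt_eqF.
rewrite ler_wpM2l ?mulr_ge0 ?(ltW Tp) // expr2 ler_pM ?(ltW Ba0) ?invr_ge0 //.
Qed.

Lemma Ba_convexity_W : 0 <= Ba / mu <= W ^+ 2.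
Proof.
have /andP[-> /le_trans->//] := Ba_convexity.
apply: (@le_trans _ _ ((8 * S * T%:R) * S)); last by rewrite expr2 ler_pM ?mulr_ge0 ?(ltW Tp).
have -> : 8 * S * T%:R * S = 8 * T%:R * S ^+ 2 by ring.
by rewrite ler_wpM2r ?sqr_ge0 // ler_wpM2r ?(ltW Tp) // ler_nat.
Qed.

Lemma width_max_bound : 0 < h <= 3 * S ^+ 3.
Proof.
have [_ _ liS BaS _] := scale_bounds sigma0 ba0 Ba0 Bw0 lambda0.
have li0 : 0 < lambda^-1 by rewrite invr_gt0.
have S3 : 1 <= S ^+ 3 by rewrite exprn_ege1.
have B2 : 0 <= Ba ^+ 2 / lambda by rewrite divr_ge0 ?sqr_ge0 // ltW.
have B3 : Ba ^+ 2 / lambda <= S ^+ 3.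
  rewrite [S ^+ 3]exprSr ler_pM ?sqr_ge0 ?(ltW li0) //.
  by rewrite ler_sqr ?nnegrE // ltW.
by rewrite /h; apply/andP; split; lra.
Qed.

Lemma width_max_W : 0 <= h <= W ^+ 3.
Proof.
have /andP[h0 h1] := width_max_bound; rewrite (ltW h0) /=; apply: le_trans h1 _.
have -> : 3 * S ^+ 3 = (3 * S) * (S ^+ 2) by ring.
have : 0 <= 3 * S <= W ^+ 1 by have := SW; have := S0 => *; apply/andP; split; lra.
have : 0 <= S ^+ 2 <= W ^+ 2 by rewrite sqr_ge0 ler_sqr ?nnegrE.
by move=> a b; have /andP[] := le_mulX b a.
Qed.

Lemma width_min_gt0 : 0 < smin.
Proof. by rewrite divr_gt0 // !mulr_gt0 // sqrtr_gt0. Qed.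

Lemma width_min_inv : smin^-1 <= 2 * S ^+ 3 * Num.sqrt T%:R.
Proof.
have [_ LsS _] := smoothness_bound.
have [_ biS _ _ _] := scale_bounds sigma0 ba0 Ba0 Bw0 lambda0.
have -> : smin^-1 = 2 * (Ls * ba^-1) * Num.sqrt T%:R.
  by rewrite /smin; field; rewrite !gt_eqF // sqrtr_gt0.
rewrite ler_wpM2r ?sqrtr_ge0 // ler_wpM2l // [S ^+ 3]exprSr ler_pM ?invr_ge0 ?(ltW Ls0) ?(ltW ba0) //.
Qed.

Lemma width_min_inv_W : 0 <= smin^-1 <= W ^+ 3.
Proof.
rewrite invr_ge0 (ltW width_min_gt0) /=; apply: le_trans width_min_inv _.
have /andP[s0 sT] := @sqrtT_le R _ T0.
have st0 : 0 <= Num.sqrt T%:R :> R by exact: sqrtr_ge0.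
have e : 0 <= 2 * S * Num.sqrt T%:R <= W ^+ 1.
  rewrite !mulr_ge0 //= expr1; apply: le_trans STW.
  by rewrite ler_pM ?mulr_ge0 // ler_wpM2r // ler_nat.
have f : 0 <= S ^+ 2 <= W ^+ 2 by rewrite sqr_ge0 ler_sqr ?nnegrE.
have -> : 2 * S ^+ 3 * Num.sqrt T%:R = 2 * S * Num.sqrt T%:R * S ^+ 2 by ring.
by have /andP[] := le_mulX e f.
Qed.

Lemma reward_max_W : 0 <= rb <= W ^+ 2.
Proof.
have [_ _ _ _ [rS _]] := scale_bounds sigma0 ba0 Ba0 Bw0 lambda0.
rewrite addr_ge0 ?mulr_ge0 ?(ltW Ba0) ?(ltW Bw0) ?(ltW sigma0) //=; apply: le_trans rS _.
by rewrite ler_sqr ?nnegrE.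
Qed.

Lemma Ba_W : 0 <= Ba <= W ^+ 1.
Proof.
have [_ _ _ BaS _] := scale_bounds sigma0 ba0 Ba0 Bw0 lambda0.
by rewrite (ltW Ba0) expr1 (le_trans BaS).
Qed.

Lemma tau_inv_W : 0 <= tau^-1 <= W ^+ 1.
Proof.
have [_ _ _ tW _] := big_scale_bounds T0 d0 A0 sigma0 ba0 Ba0 Bw0 lambda0 eps01 tau01.
have ti : 0 < tau^-1 by rewrite invr_gt0.
by apply/andP; split; rewrite ?expr1; lra.
Qed.

Lemma alpha_W : 0 <= alpha <= W ^+ 4.
Proof.
have /andP[-> h1] := ucb_alpha_bound T0 d0 sigma0 ba0 Ba0 Bw0 lambda0; apply: le_trans h1 _.
apply: (@le_trans _ _ ((8 * S * T%:R) * S ^+ 3)).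
  have -> : 8 * S * T%:R * S ^+ 3 = 8 * S ^+ 4 * T%:R by ring.
  by rewrite ler_wpM2r ?(ltW Tp) // ler_wpM2r ?exprn_ge0 // ler_nat.
rewrite [W ^+ 4]exprS ler_pM ?mulr_ge0 ?exprn_ge0 ?(ltW Tp) //.
by apply: lerXn2r; rewrite ?nnegrE.
Qed.

(** The denominator is at most [3 T * smoothness], hence at most [4 T * smoothness ^ 2], the square
    of the denominator of [width_min]. *)
Lemma width_min_sqr (n : nat) : (n <= 3 * T)%N ->
  smin ^+ 2 <= ba ^+ 2 / (lambda + n%:R * Ba ^+ 2).
Proof.
move=> nT; have [L1 _ lB] := smoothness_bound.
have c0 : 0 < lambda + n%:R * Ba ^+ 2 by rewrite ltr_pwDl // mulr_ge0 ?sqr_ge0.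
rewrite /smin expr_div_n; apply: ler_wpM2l; first exact: sqr_ge0.
have sT : 0 < Num.sqrt T%:R :> R by rewrite sqrtr_gt0.
rewrite lef_pV2 ?posrE ?exprn_gt0 ?mulr_gt0 //.
rewrite !exprMn sqr_sqrtr ?(ltW Tp) //.
have nT' : n%:R <= 3 * T%:R :> R by rewrite -natrM ler_nat.
apply: (@le_trans _ _ (3 * T%:R * Ls)).
  apply: (@le_trans _ _ (3 * T%:R * (lambda + Ba ^+ 2))); last first.
    by rewrite ler_wpM2l // mulr_ge0 // ltW.
  rewrite mulrDr lerD ?ler_wpM2r ?sqr_ge0 // ler_peMl ?(ltW lambda0) //.
  by rewrite mulr_ege1 // ler1n.
have LL : Ls <= Ls ^+ 2 by rewrite expr2 ler_peMr // ltW.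
have := ler_wpM2l (ltW Tp) LL; have := mulr_ge0 (ltW Tp) (ltW Ls0).
by rewrite -!natrX -[3 * _ * _]mulrA -[_ * Ls ^+ 2 * _]mulrA (mulrC (Ls ^+ 2)); lra.
Qed.

End Constants.

Lemma tokens_le n T : (0 < T)%N -> (n <= T)%N -> (n.*2.+1 <= 3 * T)%N.
Proof. lia. Qed.

(** * Accuracy of the assembled transformer *)

Section SoftLinUCBTransformer.
Context {R : realType}.
Variables (T d A : nat) (sigma ba Ba Bw lambda eps tau : R).
Hypothesis T0 : (0 < T)%N.
Hypothesis d0 : (0 < d)%N.
Hypothesis A0 : (0 < A)%N.
Hypothesis sigma0 : 0 < sigma.
Hypothesis ba0 : 0 < ba.
Hypothesis Ba0 : 0 < Ba.
Hypothesis Bw0 : 0 < Bw.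
Hypothesis lambda0 : 0 < lambda.
Hypothesis eps01 : 0 < eps < 1.
Hypothesis tau01 : 0 < tau < 1.

Notation S := (scale sigma ba Ba Bw lambda).
Notation Lam := (log_scale T d A eps tau).
Notation W := (big_scale T d A sigma ba Ba Bw lambda eps tau).
Notation alpha := (@ucb_alpha R d T sigma Ba Bw lambda).
Notation Ls := (smoothness Ba lambda).
Notation mu := (convexity T lambda).
Notation q := (rate T Ba lambda).
Notation h := (width_max Ba lambda).
Notation smin := (width_min T ba Ba lambda).
Notation cz := (width_step Ba lambda).
Notation rb := (reward_max sigma Ba Bw).
Notation bp := (read_margin T Ba lambda).

Let W8 : 8 <= W.
Proof. by have [] := big_scale_bounds T0 d0 A0 sigma0 ba0 Ba0 Bw0 lambda0 eps01 tau01. Qed.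
Let W0 : 0 < W. Proof. by apply: lt_le_trans W8. Qed.
Let W1 : 1 <= W. Proof. by apply: le_trans W8; rewrite ler1n. Qed.
Let tau0 : 0 < tau. Proof. by case/andP: tau01. Qed.
Let XW i j : (i <= j)%N -> W ^+ i <= W ^+ j.
Proof. by move=> ij; rewrite ler_weXn2l. Qed.

Let BmW : 0 <= Ba / mu <= W ^+ 2. Proof. exact: Ba_convexity_W. Qed.
Let hW : 0 <= h <= W ^+ 3. Proof. exact: width_max_W. Qed.
Let siW : 0 <= smin^-1 <= W ^+ 3. Proof. exact: width_min_inv_W. Qed.
Let rbW : 0 <= rb <= W ^+ 2. Proof. exact: reward_max_W. Qed.
Let BaW : 0 <= Ba <= W ^+ 1. Proof. exact: Ba_W. Qed.
Let tiW : 0 <= tau^-1 <= W ^+ 1. Proof. exact: tau_inv_W. Qed.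
Let alW : 0 <= alpha <= W ^+ 4. Proof. exact: alpha_W. Qed.
Let mu0 : 0 < mu. Proof. exact: convexity_gt0. Qed.
Let q0 : 0 < q. Proof. exact: rate_gt0. Qed.
Let q1 : q < 1. Proof. exact: rate_lt1. Qed.
Let smin0 : 0 < smin. Proof. exact: width_min_gt0. Qed.
Let h0 : 0 < h. Proof. by have /andP[] := width_max_bound sigma0 ba0 Ba0 Bw0 lambda0. Qed.

Variables (n1 n2 : nat).
Hypothesis n1_large : 29 * ln W <= q * n1%:R.
Hypothesis n2_large : 10 * ln W <= cz * (smin / 2) * n2%:R.

(** The most amplified error is [alpha * Ba * delta / (tau * smin)], with an amplification of at
    most [W ^+ 9]. Exponent 12 leaves more than the required [(W ^+ 2)^-1]. *)
Definition accuracy : R := (W ^+ 12)^-1.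
Notation delta := accuracy.

(** [29 = 5 + 2 * 12]: the prefactor is at most [W ^+ 5] and the target is the square of
    [(W ^+ 12)^-1]. *)
Lemma agd_rounds : 2 * (Ba / mu) ^+ 2 * (1 - q) ^+ n1 <= delta ^+ 2.
Proof.
have g : (1 - q) ^+ n1 <= (W ^+ 29)^-1 by apply: geometric_le => //; rewrite ltW //= ltW.
have e : 2 * (Ba / mu) ^+ 2 <= W ^+ 5.
  have /andP[_ e] := le_mulX BmW BmW; rewrite -expr2 in e.
  apply: le_trans (ler_wpM2l (ler0n _ 2) e) _.
  by rewrite [W ^+ 5]exprS ler_wpM2r ?exprn_ge0 ?ltW //; move: W8; lra.
apply: (@le_trans _ _ (W ^+ 5 * (W ^+ 29)^-1)).
  apply: ler_pM => //; first by rewrite mulr_ge0 ?sqr_ge0.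
  by rewrite exprn_ge0 // subr_ge0 ltW.
rewrite /delta (_ : 29 = 5 + (12 + 12))%N // (exprD _ 5) invfM mulrA divff; last first.
  by rewrite expf_neq0 // gt_eqF.
by rewrite mul1r exprD invfM expr2.
Qed.

Hypothesis baBa : ba <= Ba.

Lemma width_rate_le1 : 0 <= cz * (smin / 2) <= 1.
Proof.
have [L1 _ lB] := smoothness_bound sigma0 ba0 Ba0 Bw0 lambda0.
have /andP[s1 _] := @sqrtT_le R _ T0.
have Ls0 : 0 < Ls by apply: lt_le_trans L1.
have sm1 : smin <= 1.
  rewrite /smin ler_pdivrMr ?mul1r; last first.
    by rewrite !mulr_gt0 // sqrtr_gt0 ltr0n.
  apply: (le_trans baBa); apply: (@le_trans _ _ (2 * Ls)).
    by have := lambda0; rewrite /smoothness => ?; have := sqr_ge0 (Ba - 1); nra.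
  by rewrite ler_peMr // mulr_ge0 // ltW.
have h2 : 2 <= h by rewrite lerDr divr_ge0 ?sqr_ge0 // ltW.
rewrite /width_step; apply/andP; split; first apply: ltW.
  by apply: mulr_gt0; [rewrite invr_gt0 mulr_gt0 | exact: divr_gt0 smin0 _].
rewrite [leLHS]mulrC ler_pdivrMr ?mulr_gt0 // mul1r; move: sm1 h2.
by move: smin h => *; lra.
Qed.

(** [10 = 8 + 2]: the factor [alpha * h / tau] amplifies by at most [W ^+ 8]. *)
Lemma sqrt_rounds : (1 - cz * (smin / 2)) ^+ n2 <= (W ^+ 10)^-1.
Proof. by apply: geometric_le => //; exact: width_rate_le1. Qed.

Lemma mul_inv_le (x y : R) i j : 0 <= x <= W ^+ i -> 0 <= y <= (W ^+ (i + j))^-1 ->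
  x * y <= (W ^+ j)^-1.
Proof.
move=> /andP[x0 x1] /andP[y0 y1]; apply: le_trans (ler_pM x0 y0 x1 y1) _.
by rewrite exprD invfM mulrA divff ?mul1r // expf_neq0 // gt_eqF.
Qed.

Let delta0 : 0 <= delta. Proof. by rewrite invr_ge0 exprn_ge0 // ltW. Qed.

Lemma Ba_delta : Ba * delta <= (W ^+ 11)^-1.
Proof. by apply: (mul_inv_le (i := 1) (j := 11)) => //; rewrite delta0 /=. Qed.

Let Winv_le i j : (i <= j)%N -> (W ^+ j)^-1 <= (W ^+ i)^-1.
Proof. by move=> ij; rewrite lef_pV2 ?posrE ?exprn_gt0 ?XW. Qed.

Lemma Ba_delta_le1 : Ba * delta <= 1.
Proof. by apply: le_trans Ba_delta _; rewrite invf_le1 ?exprn_gt0 // exprn_ege1. Qed.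

Lemma delta_smin : 2 * (Ba * delta) <= smin ^+ 2.
Proof.
apply: (@le_trans _ _ (W ^+ 6)^-1); last first.
  rewrite -[smin]invrK exprVn lef_pV2 ?posrE ?exprn_gt0 ?invr_gt0 //.
  by have /andP[_] := le_mulX siW siW; rewrite expr2.
apply: (@le_trans _ _ (W * (W ^+ 11)^-1)).
  apply: ler_pM Ba_delta => //; last by move: W8; lra.
  by rewrite mulr_ge0 // ltW.
apply: (mul_inv_le (i := 1)) => //; first by rewrite expr1 lexx ltW.
by rewrite invr_ge0 exprn_ge0 ?(ltW W0) //= Winv_le.
Qed.

(** Three errors (linear reading, perturbed width, unfinished root) are each at most [(W ^+ 2)^-1],
    hence at most [W^-1 <= eps / 8]. *)
Lemma value_error (l l' z z' : R) : `|l - l'| <= Ba * delta * rb ->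
  `|z - z'| <= Ba * delta / smin + (1 - cz * (smin / 2)) ^+ n2 * h ->
  `|(l / tau + alpha / tau * z) - (l' + alpha * z') / tau| <= eps / 2.
Proof.
move=> hl hz.
have -> : l / tau + alpha / tau * z - (l' + alpha * z') / tau
    = tau^-1 * (l - l') + tau^-1 * (alpha * (z - z')) by ring.
have /andP[ti0 _] := tiW; have /andP[al0 _] := alW.
apply: le_trans (ler_normD _ _) _; rewrite !normrM (ger0_norm ti0) (ger0_norm al0).
have b1 : tau^-1 * `|l - l'| <= (W ^+ 2)^-1.
  apply: le_trans (ler_wpM2l ti0 hl) _.
  have -> : tau^-1 * (Ba * delta * rb) = (tau^-1 * Ba * rb) * delta by ring.
  apply: (mul_inv_le (i := 1 + 1 + 2)); first by do 2 apply: le_mulX => //.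
  by rewrite delta0 /= Winv_le.
have b2 : tau^-1 * (alpha * (Ba * delta / smin)) <= (W ^+ 2)^-1.
  have -> : tau^-1 * (alpha * (Ba * delta / smin)) = (tau^-1 * alpha * Ba * smin^-1) * delta.
    by ring.
  apply: (mul_inv_le (i := 1 + 4 + 1 + 3)); first by do 3 apply: le_mulX => //.
  by rewrite delta0 /= Winv_le.
have b3 : tau^-1 * (alpha * ((1 - cz * (smin / 2)) ^+ n2 * h)) <= (W ^+ 2)^-1.
  set rho := _ ^+ n2.
  have -> : tau^-1 * (alpha * (rho * h)) = (tau^-1 * alpha * h) * rho by ring.
  apply: (mul_inv_le (i := 1 + 4 + 3)); first by do 2 apply: le_mulX => //.
  rewrite sqrt_rounds andbT exprn_ge0 // subr_ge0.
  by have /andP[] := width_rate_le1.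
have b23 : tau^-1 * (alpha * `|z - z'|) <= (W ^+ 2)^-1 + (W ^+ 2)^-1.
  apply: le_trans (lerD b2 b3); rewrite -!mulrDr.
  by rewrite ler_wpM2l // ler_wpM2l.
apply: le_trans (lerD b1 b23) _.
have [_ _ eW _ _] := big_scale_bounds T0 d0 A0 sigma0 ba0 Ba0 Bw0 lambda0 eps01 tau01.
have e0 : 0 < eps by case/andP: eps01.
have Wi : W^-1 <= eps / 8.
  rewrite ler_pdivlMr // mulrC ler_pdivrMr // -ler_pdivrMl //.
  by rewrite mulrC.
have W2 : (W ^+ 2)^-1 <= W^-1 by rewrite -[in leRHS](expr1 W) Winv_le.
by move: W2 Wi e0; move: (_ ^-1) (_ ^-1) => *; lra.
Qed.

Variables (D : seq (round R d A)) (s : 'M[R]_(d, A)).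
Hypothesis D_size : (size D <= T)%N.
Hypothesis D_ok : forall n, (n < size D)%N -> let x := nth (Round 0 0 0) D n in
  [/\ forall k, norm2 (col k (rd_state x)) <= Ba, norm2 (rd_action x) <= Ba
    & `|rd_reward x| <= rb].
Hypothesis s_ub : forall k, norm2 (col k s) <= Ba.
Hypothesis s_lb : forall k, ba <= norm2 (col k s).

Notation N := ((size D).*2.+1).
Notation u0 := (prompt D s).

Let rb0 : 0 <= rb. Proof. by case/andP: rbW. Qed.
Let Bage0 : 0 <= Ba. Proof. exact: ltW. Qed.

Let N_le : (N <= 3 * T)%N.
Proof. exact: tokens_le. Qed.

Let muN : N%:R * mu <= lambda.
Proof.
rewrite /convexity mulrA ler_pdivrMr ?mulr_gt0 ?ltr0n // mulrC ler_wpM2l ?(ltW lambda0) //.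
by rewrite -natrM ler_nat.
Qed.

Let actB i : norm2 (acts u0 i) <= Ba. Proof. exact: norm_acts D_ok _. Qed.
Let rewB i : `|rews u0 i| <= rb. Proof. exact: norm_rews D_ok _. Qed.
Let stB i k : norm2 (sts u0 i k) <= Ba. Proof. exact: norm_sts D_ok s_ub _ _. Qed.
Let smooth : lambda + Ba ^+ 2 <= mu / q ^+ 2. Proof. exact: smooth_rate. Qed.

Notation out k := (lin_read u0 lambda mu q n1 (size D).*2 k / tau
  + alpha / tau * sqrt_iter cz (quad u0 lambda mu q n1 (size D).*2 k) n2).

Lemma out_error k :
  `|out k - ucb_value T sigma Ba Bw lambda D s k / tau| <= eps / 2.
Proof.
have iN : ((size D).*2 < N)%N by [].
apply: value_error.
  have -> : dot (col k s) (ridge lambda D) = \sum_(j < N)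
      dot (acts u0 j) (inv_st u0 lambda (size D).*2 k) * rews u0 j.
    rewrite dot_ridge // sum_prompt; apply: eq_bigr => x _.
    by rewrite /inv_st sts_last gramv_prompt.
  exact: (dist_lin_read lambda0 mu0 q0 q1 muN smooth actB rewB stB delta0 agd_rounds _ iN).
have -> : dot (col k s) (invmx (gram lambda D) *m col k s)
    = quad0 u0 lambda (size D).*2 k.
  by rewrite /quad0 /inv_st sts_last gramv_prompt.
apply: (dist_sqrt lambda0 mu0 q0 q1 muN smooth Bage0 actB stB delta0 agd_rounds
  Ba_delta_le1 smin0 delta_smin _ iN).
apply: (@le_trans _ _ (ba ^+ 2 / (lambda + N%:R * Ba ^+ 2))).
  exact: width_min_sqr.
rewrite /quad0; apply: le_trans (dot_inv_lb lambda0 _ (fun j _ => actB j)).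
rewrite sts_last ler_wpM2r ?invr_ge0 ?addr_ge0 ?mulr_ge0 ?sqr_ge0 ?(ltW lambda0) //.
by rewrite ler_sqr ?nnegrE ?norm2_ge0 // ltW.
Qed.

Lemma softmax_error (v : 'cV[R]_A) k : (forall l, v l 0 = out l) ->
  `|ln (soft_linucb T sigma Ba Bw lambda tau D s k) - ln (softmax v k)| <= eps.
Proof.
move=> vE; rewrite distrC -[leRHS](@divfK _ 2) ?pnatr_eq0 // mulrC.
by apply: ln_softmax_dist => l; rewrite vE mxE; exact: out_error.
Qed.

Let bpW : 0 <= bp <= W ^+ 5.
Proof.
have b3 : 0 <= 3 * (Ba / mu) <= W ^+ (1 + 2).
  by apply: le_mulX BmW; move: W8; rewrite expr1; lra.
by have /andP[-> h1] := le_mulX BaW b3; apply: le_trans h1 (XW _).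
Qed.

Let b3 : 3 * (Ba / mu) <= W ^+ 9.
Proof.
have /andP[_ h1] : 0 <= 3 * (Ba / mu) <= W ^+ (1 + 2).
  by apply: le_mulX BmW; move: W8; rewrite expr1; lra.
exact: le_trans h1 (XW _).
Qed.

Let linW i k : (i < N)%N -> `|lin_read u0 lambda mu q n1 i k| <= W ^+ 7.
Proof.
move=> iN; have h1 := lin_read_le lambda0 mu0 q0 q1 muN smooth Bage0 actB rewB stB n1 k iN.
by apply: le_trans h1 _; have /andP[_] := le_mulX bpW rbW.
Qed.

Let sqrtW n i k : (i < N)%N -> 0 <= sqrt_iter cz (quad u0 lambda mu q n1 i k) n <= h.
Proof.
move=> iN; exact: (sqrt_iter_le lambda0 mu0 q0 q1 muN smooth Bage0 actB stB delta0
  agd_rounds Ba_delta_le1 n k iN).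
Qed.

Let promptW i c : (i < N)%N -> `|u0 i c| <= W ^+ 9.
Proof.
move=> iN; have W9 : 0 <= W ^+ 9 by rewrite exprn_ge0 // ltW.
have BW : Ba <= W ^+ 9 by case/andP: BaW => _ h1; apply: le_trans h1 (XW _).
elim/coordP: c => [l||k l|k|k l|k l|k|k|m].
- have := norm_coord_le (acts u0 i) l; rewrite mxE => h1.
  exact: le_trans h1 (le_trans (actB i) BW).
- apply: le_trans (rewB i) _; case/andP: rbW => _ h1; exact: le_trans h1 (XW _).
- have := norm_coord_le (sts u0 i k) l; rewrite mxE => h1.
  exact: le_trans h1 (le_trans (stB i k) BW).
- by rewrite prompt_O normr0.
- by rewrite prompt_X normr0.
- by rewrite prompt_Y normr0.
- by rewrite prompt_Q normr0.
- by rewrite prompt_Z normr0.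
have iW : 0 <= (i.+1%:R : R) <= W ^+ 1.
  rewrite ler0n expr1 /=.
  have [_ STW _ _ _] := big_scale_bounds T0 d0 A0 sigma0 ba0 Ba0 Bw0 lambda0 eps01 tau01.
  apply: le_trans STW; apply: (@le_trans _ _ (8 * T%:R)).
    by rewrite -natrM ler_nat; apply: leq_trans iN (leq_trans N_le _); rewrite leq_mul2r orbT.
  have [S1 _ _ _ _] := scale_bounds sigma0 ba0 Ba0 Bw0 lambda0.
  by rewrite ler_wpM2r // ler_peMr.
rewrite prompt_P; case: m => [[|[|[|m]]] //= _].
- by rewrite normr_nat; case/andP: iW => _ h1; apply: le_trans h1 (XW _).
- rewrite ger0_norm ?sqr_ge0 // expr2.
  by have /andP[_ h1] := le_mulX iW iW; apply: le_trans h1 (XW _).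
- by rewrite normr1 exprn_ege1.
Qed.

(** [W ^+ 9] bounds all coordinates; the tightest is the output block, a sum of two terms of size at
    most [W ^+ 8]. *)
Lemma alg_tf_error L (theta : L.-tuple (tf_layer R (tdim d A) (4 * A) 0)) k :
  tval theta = ucb_layers lambda mu q bp cz (h ^+ 2) alpha tau n1 n2 ->
  `|ln (soft_linucb T sigma Ba Bw lambda tau D s k)
    - ln (@alg_tf R d A (pad_len d A) _ _ _ theta (W ^+ 12) D s k)| <= eps.
Proof.
move=> thetaE; apply: softmax_error => l.
have bp0 : 0 <= bp by case/andP: bpW.
have hge0 := ltW h0; have h_W9 : h <= W ^+ 9.
  by case/andP: hW => _ h1; apply: le_trans h1 (XW _).
(* The dimension is at most [11 d A], hence at most [W ^+ 2], so columns have norm at most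
   [W ^+ 11], within the radius. *)
have dimW : (tdim d A)%:R * W ^+ 9 <= W ^+ 12.
  have dim1 : (tdim d A)%:R <= W ^+ 2.
    have [_ _ _ _ dAW] := big_scale_bounds T0 d0 A0 sigma0 ba0 Ba0 Bw0 lambda0 eps01 tau01.
    apply: (@le_trans _ _ (11 * (d%:R * A%:R))).
      by rewrite -!natrM ler_nat tdim_le.
    by move: dAW W8; move: (d%:R * A%:R : R) W => x y *; nra.
  by apply: le_trans (ler_wpM2r (exprn_ge0 _ (ltW W0)) dim1) _; rewrite -exprD XW.
have readb i j (k' : 'I_A) : (i < N)%N -> (j < i)%N ->
    dot (sol u0 lambda mu q n1 i k') (sts u0 j k') <= bp.
  move=> iN _; apply: le_trans (dot_le _ _) _; rewrite mulrC ler_pM ?norm2_ge0 //.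
  exact: (norm_sol lambda0 mu0 q0 q1 muN smooth Bage0 actB stB n1 k' iN).
have solb n i (k' : 'I_A) : (i < N)%N -> norm2 (sol u0 lambda mu q n i k') <= W ^+ 9.
  move=> iN; apply: le_trans b3.
  exact: (norm_sol lambda0 mu0 q0 q1 muN smooth Bage0 actB stB n k' iN).
have auxb n i (k' : 'I_A) : (i < N)%N -> norm2 (aux u0 lambda mu q n i k') <= W ^+ 9.
  move=> iN; apply: le_trans b3.
  exact: (norm_aux lambda0 mu0 q0 q1 muN smooth Bage0 actB stB n k' iN).
have quadb i (k' : 'I_A) : (i < N)%N -> `|quad u0 lambda mu q n1 i k'| <= W ^+ 9.
  move=> iN; rewrite ger0_norm; last exact: quad_ge0.
  apply: le_trans h_W9; exact: (quad_le lambda0 mu0 q0 q1 muN smooth Bage0 actB stB delta0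
    agd_rounds Ba_delta_le1 k' iN).
have linb i (k' : 'I_A) : (i < N)%N -> `|lin_read u0 lambda mu q n1 i k'| <= W ^+ 9.
  by move=> iN; apply: le_trans (linW k' iN) (XW _).
have sqrtb n i (k' : 'I_A) : (i < N)%N ->
    `|sqrt_iter cz (quad u0 lambda mu q n1 i k') n| <= W ^+ 9.
  by move=> iN; have /andP[z0 z1] := sqrtW n k' iN; rewrite ger0_norm // (le_trans z1).
have sqrtz n i j (k' : 'I_A) : (i < N)%N -> (j < i)%N ->
    sqrt_iter cz (quad u0 lambda mu q n1 i k') n
    * sqrt_iter cz (quad u0 lambda mu q n1 j k') n <= h ^+ 2.
  move=> iN ji; have /andP[z0 z1] := sqrtW n k' iN.
  have /andP[y0 y1] := sqrtW n k' (ltn_trans ji iN).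
  by rewrite expr2 ler_pM.
have outb i (k' : 'I_A) : (i < N)%N ->
    `|lin_read u0 lambda mu q n1 i k' / tau
      + alpha / tau * sqrt_iter cz (quad u0 lambda mu q n1 i k') n2| <= W ^+ 9.
  move=> iN; have /andP[z0 z1] := sqrtW n2 k' iN.
  have /andP[ti0 _] := tiW; have /andP[al0 _] := alW.
  have e1 : `|lin_read u0 lambda mu q n1 i k' / tau| <= W ^+ 8.
    rewrite normrM (ger0_norm ti0).
    have l1 : 0 <= `|lin_read u0 lambda mu q n1 i k'| <= W ^+ 7 by rewrite normr_ge0 linW.
    by have /andP[] := le_mulX l1 tiW.
  have e2 : `|alpha / tau * sqrt_iter cz (quad u0 lambda mu q n1 i k') n2| <= W ^+ 8.
    rewrite ger0_norm ?mulr_ge0 //.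
    have l1 : 0 <= sqrt_iter cz (quad u0 lambda mu q n1 i k') n2 <= W ^+ 3.
      by rewrite z0 /= (le_trans z1) //; case/andP: hW.
    by have /andP[] := le_mulX (le_mulX alW tiW) l1.
  apply: le_trans (ler_normD _ _) (le_trans (lerD e1 e2) _).
  rewrite [W ^+ 9]exprS -mulr2n -mulr_natl ler_wpM2r ?exprn_ge0 ?(ltW W0) //.
  by apply: le_trans W8; rewrite ler_nat.
rewrite token_matrix_tokmx /transformer.
rewrite (transformer_ucb A0 (prompt_pos_ok D s) (prompt_O D s) (prompt_X D s)
  (prompt_Y D s) (prompt_Q D s) (prompt_Z D s) bp0 (sqr_ge0 h) dimW promptW solb auxb
  readb quadb linb sqrtb sqrtz outb thetaE).
by rewrite extract_tokmx.
Qed.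

End SoftLinUCBTransformer.

(** * Radius, depth and norm against the announced bounds *)

Section Sizes.
Context {R : realType}.
Variables (T d A : nat) (sigma ba Ba Bw lambda eps tau : R).
Hypothesis T0 : (0 < T)%N.
Hypothesis d0 : (0 < d)%N.
Hypothesis A0 : (0 < A)%N.
Hypothesis sigma0 : 0 < sigma.
Hypothesis ba0 : 0 < ba.
Hypothesis Ba0 : 0 < Ba.
Hypothesis Bw0 : 0 < Bw.
Hypothesis lambda0 : 0 < lambda.
Hypothesis eps01 : 0 < eps < 1.
Hypothesis tau01 : 0 < tau < 1.

Notation S := (scale sigma ba Ba Bw lambda).
Notation Lam := (log_scale T d A eps tau).
Notation W := (big_scale T d A sigma ba Ba Bw lambda eps tau).
Notation alpha := (@ucb_alpha R d T sigma Ba Bw lambda).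
Notation mu := (convexity T lambda).
Notation q := (rate T Ba lambda).
Notation h := (width_max Ba lambda).
Notation smin := (width_min T ba Ba lambda).
Notation cz := (width_step Ba lambda).
Notation bp := (read_margin T Ba lambda).
Notation O_ := (soft_O_factor (10 ^+ 4) 7 1 sigma ba Ba Bw lambda T A d eps tau).

Let S1 : 1 <= S. Proof. by have [] := scale_bounds sigma0 ba0 Ba0 Bw0 lambda0. Qed.
Let S0 : 0 <= S. Proof. exact: le_trans ler01 S1. Qed.
Let L1 : 1 <= Lam. Proof. exact: log_scale_ge1. Qed.
Let SX i j : (i <= j)%N -> S ^+ i <= S ^+ j.
Proof. by move=> ij; rewrite ler_weXn2l. Qed.
Let SXge1 i : 1 <= S ^+ i. Proof. exact: exprn_ege1. Qed.

Lemma soft_O_ge (c i : nat) : (c <= 10 ^ 4)%N -> (i <= 7)%N ->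
  c%:R * S ^+ i * Lam <= O_.
Proof.
move=> c1 i7; rewrite /soft_O_factor expr1 -/(scale _ _ _ _ _) -/(log_scale _ _ _ _ _).
apply: ler_wpM2r; first exact: le_trans ler01 L1.
by apply: ler_pM; rewrite ?ler0n ?exprn_ge0 ?SX // -natrX ler_nat.
Qed.

Lemma soft_O_ge_pow (c i : nat) : (c <= 10 ^ 4)%N -> (i <= 7)%N -> c%:R * S ^+ i <= O_.
Proof.
move=> c1 i7; apply: le_trans (soft_O_ge c1 i7).
by rewrite ler_peMr // mulr_ge0 // exprn_ge0.
Qed.

Lemma radius_bound : 0 < W ^+ 12 /\ `|ln (W ^+ 12)| <= O_.
Proof.
have [W8 _ _ _ _] := big_scale_bounds T0 d0 A0 sigma0 ba0 Ba0 Bw0 lambda0 eps01 tau01.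
have W0 : 0 < W by apply: lt_le_trans W8.
have /andP[l0 l1] := ln_big_scale T0 d0 A0 sigma0 ba0 Ba0 Bw0 lambda0 eps01 tau01.
split; first exact: exprn_gt0.
rewrite lnXn // ger0_norm ?mulrn_wge0 //.
apply: le_trans (@soft_O_ge 108 1 _ _) => //.
rewrite expr1 (_ : 108 * S * Lam = 12 * (9 * S * Lam)); last by ring.
by rewrite -[leLHS]mulr_natl ler_wpM2l.
Qed.

(** The square root phase dominates in [S]: its inverse rate [4 h / smin] costs [24 S ^ 6 sqrt T],
    and [ln W] one more [S], whence exponent 7. The total constant is [3208 = 1044 + 2160 + 4]. *)
Lemma depth_bound n1 n2 :
  n1%:R <= 29 * ln W / q + 1 -> n2%:R <= 10 * ln W / (cz * (smin / 2)) + 1 ->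
  (n1 + n2 + 2)%:R <= O_ * Num.sqrt T%:R.
Proof.
move=> h1 h2; have /andP[s1 _] := @sqrtT_le R _ T0.
have sT0 : 0 <= Num.sqrt T%:R :> R by exact: le_trans ler01 s1.
have /andP[l0 l1] := ln_big_scale T0 d0 A0 sigma0 ba0 Ba0 Bw0 lambda0 eps01 tau01.
have Lam0 : 0 <= Lam by exact: le_trans ler01 L1.
have q0 : 0 < q by exact: rate_gt0.
have /andP[h0 h3] := width_max_bound sigma0 ba0 Ba0 Bw0 lambda0.
have s0 : 0 < smin by exact: width_min_gt0.
have e1 : n1%:R <= 29 * (9 * S * Lam) * (4 * S ^+ 3 * Num.sqrt T%:R) + 1.
  apply: le_trans h1 _; rewrite lerD2r ler_pM ?invr_ge0 ?mulr_ge0 ?(ltW q0) //.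
    by rewrite ler_wpM2l.
  exact: rate_inv.
have e2 : n2%:R <= 10 * (9 * S * Lam) * (24 * S ^+ 6 * Num.sqrt T%:R) + 1.
  apply: le_trans h2 _; rewrite lerD2r.
  have p0 : 0 <= (cz * (smin / 2))^-1.
    rewrite invr_ge0; apply/ltW/mulr_gt0; last exact: divr_gt0 s0 _.
    by rewrite invr_gt0 mulr_gt0.
  rewrite ler_pM ?mulr_ge0 //; first by rewrite ler_wpM2l.
  have -> : (cz * (smin / 2))^-1 = 4 * h * smin^-1.
    by rewrite /cz; field; rewrite !gt_eqF.
  have -> : 24 * S ^+ 6 * Num.sqrt T%:R
    = (4 * (3 * S ^+ 3)) * (2 * S ^+ 3 * Num.sqrt T%:R) by ring.
  apply: ler_pM; last exact: width_min_inv.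
  - by rewrite mulr_ge0 // ltW.
  - by rewrite invr_ge0 ltW.
  - by rewrite ler_wpM2l.
rewrite !natrD; apply: le_trans (lerD (lerD e1 e2) (lexx _)) _.
have Z1 : 1 <= Lam * Num.sqrt T%:R by rewrite mulr_ege1.
have x4 : S ^+ 4 * (Lam * Num.sqrt T%:R) <= S ^+ 7 * (Lam * Num.sqrt T%:R).
  by rewrite ler_wpM2r ?SX // mulr_ge0.
have x0 : 1 <= S ^+ 7 * (Lam * Num.sqrt T%:R) by rewrite mulr_ege1.
apply: (@le_trans _ _ (3208 * (S ^+ 7 * (Lam * Num.sqrt T%:R)))).
  have -> : 29 * (9 * S * Lam) * (4 * S ^+ 3 * Num.sqrt T%:R)
    = 1044 * (S ^+ 4 * (Lam * Num.sqrt T%:R)) by ring.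
  have -> : 10 * (9 * S * Lam) * (24 * S ^+ 6 * Num.sqrt T%:R)
    = 2160 * (S ^+ 7 * (Lam * Num.sqrt T%:R)) by ring.
  by move: x4 x0; move: (S ^+ 4 * _) (S ^+ 7 * _) => *; lra.
rewrite (_ : 3208 * _ = 3208 * S ^+ 7 * Lam * Num.sqrt T%:R); last by ring.
by rewrite ler_wpM2r //; apply: soft_O_ge.
Qed.

Lemma norm_bound n1 n2 :
  \big[Num.max/0]_(l <- @ucb_layers R d A lambda mu q bp cz (h ^+ 2) alpha tau n1 n2)
    layer_norm l
  <= O_ * (A%:R + T%:R * Num.sqrt d%:R / (tau * eps `^ 4^-1)).
Proof.
have tau0 : 0 < tau by case/andP: tau01. have tau1 : tau < 1 by case/andP: tau01.
have eps0 : 0 < eps by case/andP: eps01. have eps1 : eps < 1 by case/andP: eps01.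
have T1 : 1 <= T%:R :> R by rewrite ler1n.
have A1 : 1 <= A%:R :> R by rewrite ler1n.
have /andP[al0 al1] := ucb_alpha_bound T0 d0 sigma0 ba0 Ba0 Bw0 lambda0.
have /andP[h0 h3] := width_max_bound sigma0 ba0 Ba0 Bw0 lambda0.
have /andP[B0 B1] := Ba_convexity T0 sigma0 ba0 Ba0 Bw0 lambda0.
have [_ _ _ BaS _] := scale_bounds sigma0 ba0 Ba0 Bw0 lambda0.
set Y := T%:R / tau.
have t1 : 1 <= tau^-1 := inv_ge1 tau01.
have YT : T%:R <= Y by rewrite ler_peMr // ltW // ltr0n.
have Yt : tau^-1 <= Y by rewrite ler_peMl // invr_ge0 ltW.
have Y0 : 0 <= Y by apply: le_trans YT; apply: le_trans T1.
(* Since [1 <= d] and [eps < 1], the announced second term exceeds [T / tau], and this much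
   suffices. *)
have YE : Y <= T%:R * Num.sqrt d%:R / (tau * eps `^ 4^-1).
  have e1 : eps `^ 4^-1 <= 1.
    have := @ge0_ler_powR R 4^-1 _ eps 1 _ _ (ltW eps1).
    by rewrite powR1; apply; rewrite ?nnegrE ?invr_ge0 ?ler01 ?(ltW eps0).
  have e0 : 0 < eps `^ 4^-1 by exact: powR_gt0.
  have sd : 1 <= Num.sqrt d%:R :> R by rewrite -[leLHS]sqrtr1 ler_wsqrtr // ler1n.
  have -> : T%:R * Num.sqrt d%:R / (tau * eps `^ 4^-1)
      = Y * (Num.sqrt d%:R * (eps `^ 4^-1)^-1).
    by rewrite /Y; field; rewrite !gt_eqF.
  by rewrite ler_peMr // mulr_ege1 // invf_ge1.
set a := S ^+ 7 * A%:R; set y := S ^+ 7 * Y.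
have aA : A%:R <= a by rewrite ler_peMl.
have a1 : 1 <= a by apply: le_trans aA.
have yY : Y <= y by rewrite ler_peMl.
have main : 100 * (a + y) <= O_ * (A%:R + T%:R * Num.sqrt d%:R / (tau * eps `^ 4^-1)).
  rewrite /a /y -mulrDr mulrA.
  apply: ler_pM.
  - by rewrite mulr_ge0 // exprn_ge0.
  - by rewrite addr_ge0.
  - exact: soft_O_ge_pow.
  - by rewrite lerD2l.
have S6 : S ^+ 6 <= a.
  by apply: (@le_trans _ _ (S ^+ 7)); [exact: SX | rewrite ler_peMr // exprn_ge0].
have S4 : S ^+ 4 * Y <= y by rewrite ler_wpM2r // SX.
have y0 : 0 <= y by apply: le_trans Y0 yY.
have Ba_mu : bp <= 9 * y.
  have TT : T%:R * S ^+ 3 <= y.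
    by rewrite mulrC ler_pM ?exprn_ge0 // SX.
  apply: (@le_trans _ _ (S * (3 * (3 * T%:R * S ^+ 2)))).
    apply: ler_pM => //; first exact: ltW.
      by rewrite mulr_ge0.
    by rewrite ler_wpM2l.
  have -> : S * (3 * (3 * T%:R * S ^+ 2)) = 9 * (T%:R * S ^+ 3) by ring.
  by rewrite ler_wpM2l.
have h2 : 2 <= h by rewrite lerDr divr_ge0 ?sqr_ge0 // ltW.
have hh : h ^+ 2 <= 9 * a.
  apply: (@le_trans _ _ ((3 * S ^+ 3) ^+ 2)).
    by rewrite ler_sqr ?nnegrE // ?mulr_ge0 ?exprn_ge0 // ltW.
  have -> : (3 * S ^+ 3) ^+ 2 = 9 * S ^+ 6 by ring.
  by rewrite ler_wpM2l.
have cz1 : cz <= 1.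
  by rewrite invf_le1 ?mulr_gt0 //; move: h2; move: h => *; lra.
have cz0 : 0 <= cz by rewrite invr_ge0 mulr_ge0 // ltW.
have cA : (A%:R + 1) * cz <= A%:R + 1 by rewrite ler_piMr // addr_ge0.
have at1 : alpha / tau <= 7 * y.
  apply: (@le_trans _ _ (7 * S ^+ 4 * T%:R / tau)).
    by rewrite ler_wpM2r // invr_ge0 ltW.
  have -> : 7 * S ^+ 4 * T%:R / tau = 7 * (S ^+ 4 * Y) by rewrite /Y; ring.
  by rewrite ler_wpM2l.
apply: le_trans main; apply: ucb_layers_norm => //.
- exact: rate_gt0.
- exact: rate_lt1.
- exact: convexity_gt0.
- exact: step_le1.
- by rewrite mulr_ge0 ?(ltW Ba0) // mulr_ge0.
- exact: sqr_ge0.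
- by move: aA y0 A1; clearbody a y; move: (A%:R : R) => *; lra.
- by move: Ba_mu aA y0 a1; move: bp (A%:R : R) => *; lra.
- by move: hh cA aA y0 a1; clearbody a y; move: ((A%:R + 1) * cz) (h ^+ 2) => *; lra.
- by move: at1 Yt yY a1 y0; move: (alpha / tau) (tau^-1) => *; lra.
Qed.

End Sizes.

Lemma norm_reward_le (R : realType) d A T dO (Omega : measurableType dO)
    (P : probability Omega R) (b : linear_bandit d A T P) omega c t
    (sigma Ba Bw : R) :
  0 <= Bw -> `|noise b t omega| <= sigma ->
  (forall k, norm2 (col k (action b t omega)) <= Ba) -> norm2 (weight b) <= Bw ->
  `|dot (col (c t) (action b t omega)) (weight b) + noise b t omega| <= Ba * Bw + sigma.
Proof.
move=> Bw0 ns aB wB; apply: le_trans (ler_normD _ _) _; rewrite lerD //.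
by apply: le_trans (norm_dot_le _ _) _; rewrite ler_pM ?norm2_ge0.
Qed.

Theorem theorem8 (R : realType) :
  exists (C : R) (p q : nat),
  forall (T d A : nat) (sigma ba Ba Bw lambda eps tau : R),
    (0 < T)%N -> (0 < d)%N -> (0 < A)%N ->
    0 < sigma -> 0 < ba -> 0 < Ba -> 0 < Bw -> 0 < lambda ->
    0 < eps < 1 -> 0 < tau < 1 ->
  let O_ := soft_O_factor C p q sigma ba Ba Bw lambda T A d eps tau in
  exists (pad L M D' : nat) (r : R)
         (theta : L.-tuple (tf_layer R (token_dim d A pad) M D')),
    [/\ 0 < r /\ `|ln r| <= O_,
        (token_dim d A pad)%:R <= C * (d * A)%:R,
        L%:R <= O_ * Num.sqrt T%:R,
        (M <= 4 * A)%N &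
    [/\ D'%:R <= O_ * (d%:R + A%:R * Num.sqrt (T%:R * d%:R / (tau * eps))),
        tf_norm theta
          <= O_ * (A%:R + T%:R * Num.sqrt d%:R / (tau * eps `^ 4^-1)) &
        forall (dO : measure_display) (Omega : measurableType dO)
               (P : probability Omega R) (b : linear_bandit d A T P),
          (forall t omega, `|noise b t omega| <= sigma) ->
          (forall t omega k, ba <= norm2 (col k (action b t omega)) <= Ba) ->
          norm2 (weight b) <= Bw ->
          forall (omega : Omega) (c : 'I_T -> 'I_A) (t : 'I_T) (k : 'I_A),
            let D := dataset b omega c t in
            let s := action b t omega in
            `|ln (soft_linucb T sigma Ba Bw lambda tau D s k)
              - ln (alg_tf theta r D s k)| <= eps]].
Proof.
(* The constant exceeds the 3208 of the depth, the 108 of the radius and the 11 of the dimension.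
   The exponent 7 comes from the depth, and the single logarithm is [ln W]. *)
exists (10 ^+ 4), 7, 1 => T d A sigma ba Ba Bw lambda eps tau T0 d0 A0.
move=> sigma0 ba0 Ba0 Bw0 lambda0 eps01 tau01 O_.
set W := big_scale T d A sigma ba Ba Bw lambda eps tau.
have /andP[lW0 _] := ln_big_scale T0 d0 A0 sigma0 ba0 Ba0 Bw0 lambda0 eps01 tau01.
have q0 : 0 < rate T Ba lambda by exact: rate_gt0.
have /andP[h0 _] := width_max_bound sigma0 ba0 Ba0 Bw0 lambda0.
have s0 : 0 < width_min T ba Ba lambda by exact: width_min_gt0.
have p0 : 0 < width_step Ba lambda * (width_min T ba Ba lambda / 2).
  by apply: mulr_gt0; [rewrite invr_gt0 mulr_gt0 | exact: divr_gt0 s0 _].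
have [n1 /andP[n1l n1u]] : exists n : nat,
    29 * ln W / rate T Ba lambda <= n%:R <= 29 * ln W / rate T Ba lambda + 1.
  by apply: nat_ceil; rewrite divr_ge0 ?mulr_ge0 // ltW.
have [n2 /andP[n2l n2u]] : exists n : nat,
    10 * ln W / (width_step Ba lambda * (width_min T ba Ba lambda / 2)) <= n%:R
    <= 10 * ln W / (width_step Ba lambda * (width_min T ba Ba lambda / 2)) + 1.
  by apply/nat_ceil/(divr_ge0 _ (ltW p0)); exact: mulr_ge0.
rewrite ler_pdivrMr // [leRHS]mulrC in n1l.
rewrite ler_pdivrMr // [leRHS]mulrC in n2l.
pose layers := @ucb_layers R d A lambda (convexity T lambda) (rate T Ba lambda)
  (read_margin T Ba lambda) (width_step Ba lambda) (width_max Ba lambda ^+ 2)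
  (@ucb_alpha R d T sigma Ba Bw lambda) tau n1 n2.
have rO : 0 < W ^+ 12 /\ `|ln (W ^+ 12)| <= O_ by exact: radius_bound.
have O0 : 0 <= O_ by apply: le_trans (normr_ge0 _) rO.2.
exists (pad_len d A), (size layers), (4 * A)%N, 0%N, (W ^+ 12), (in_tuple layers).
split=> //.
- rewrite -natrX -natrM ler_nat; apply: leq_trans (tdim_le d0 A0) _.
  by apply: leq_mul.
- by rewrite size_ucb_layers; apply: depth_bound n1u n2u.
split.
- by rewrite mulr_ge0 // addr_ge0 // mulr_ge0 ?sqrtr_ge0.
- exact: norm_bound.
move=> dO Omega P b nB aB wB omega c t k; cbv zeta.
(* Read off the norm of an actual action, so available only once an environment is given. *)
have baBa : ba <= Ba by have /andP[h1 h2] := aB t omega k; apply: le_trans h1 h2.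
apply: (@alg_tf_error R T d A sigma ba Ba Bw lambda eps tau) => //.
- exact: n1l.
- exact: n2l.
- by rewrite /dataset size_map size_filter -[leqRHS]size_enum_ord count_size.
- rewrite /dataset => n; rewrite size_map => nD; cbv zeta; rewrite (nth_map t) //=.
  set j := nth _ _ _; have aU k' : norm2 (col k' (action b j omega)) <= Ba.
    by have /andP[] := aB j omega k'.
  by split=> //; apply: norm_reward_le => //; exact: ltW.
- by move=> k'; have /andP[] := aB t omega k'.
- by move=> k'; have /andP[] := aB t omega k'.
Qed.
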